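(* Let $r,s\ge1$ and let $P,Q,A_1,\dots,A_r,B_1,\dots,B_s\in\mathbb{C}^{N\times N}$ be pairwise commuting matrices with $\Re(P)>0$, $\Re(Q)>0$, $\Re(A_i)>0$ for $1\le i\le r$, $\Re(B_j)>0$ for $1\le j\le s$, and $\Re(B_1-A_1)>0$. Let $x>0$. Then $${}_{r}e_{s}\left[(x,P,Q;z)\left|\begin{matrix}A_1,\dots,A_r\\ B_1,\dots,B_s\end{matrix}\right.\right]=\Gamma(B_1)\Gamma^{-1}(A_1)\Gamma^{-1}(B_1-A_1)\int_0^1 t^{A_1-I}(1-t)^{B_1-A_1-I}\;{}_{r-1}e_{s-1}\left[(x,P,Q;zt)\left|\begin{matrix}A_2,\dots,A_r\\ B_2,\dots,B_s\end{matrix}\right.\right]dt$$ and $${}_{r}E_{s}\left[(x,P,Q;z)\left|\begin{matrix}A_1,\dots,A_r\\ B_1,\dots,B_s\end{matrix}\right.\right]=\Gamma(B_1)\Gamma^{-1}(A_1)\Gamma^{-1}(B_1-A_1)\int_0^1 t^{A_1-I}(1-t)^{B_1-A_1-I}\;{}_{r-1}E_{s-1}\left[(x,P,Q;zt)\left|\begin{matrix}A_2,\dots,A_r\\ B_2,\dots,B_s\end{matrix}\right.\right]dt.$$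
   Context: $I$ is the identity matrix in $\mathbb{C}^{N\times N}$; $t^{M}=\exp(M\ln t)$ for $t>0$; $\Re(M)>0$ means that every eigenvalue of $M$ has positive real part. For $\Re(M)>0$ and $x>0$: $\gamma(M,x)=\int_0^x u^{M-I}e^{-u}du$, $\Gamma(M,x)=\int_x^\infty u^{M-I}e^{-u}du$, $\Gamma(M)=\int_0^\infty u^{M-I}e^{-u}du$, $\Gamma^{-1}(M)=\Gamma(M)^{-1}$. Pochhammer symbol: $(M)_0=I$, $(M)_\ell=M(M+I)\cdots(M+(\ell-1)I)$. The generalized incomplete exponential matrix functions are $${}_re_s\left[(x,P,Q;z)\left|\begin{matrix}A_1,\dots,A_r\\ B_1,\dots,B_s\end{matrix}\right.\right]=\sum_{\ell=0}^\infty \frac{z^\ell}{\ell!}\prod_{i=1}^r(A_i)_\ell\Big[\prod_{j=1}^s(B_j)_\ell\Big]^{-1}\gamma(\ell P+Q,x)\Gamma^{-1}(\ell P+Q),$$ $${}_rE_s\left[(x,P,Q;z)\left|\begin{matrix}A_1,\dots,A_r\\ B_1,\dots,B_s\end{matrix}\right.\right]=\sum_{\ell=0}^\infty \frac{z^\ell}{\ell!}\prod_{i=1}^r(A_i)_\ell\Big[\prod_{j=1}^s(B_j)_\ell\Big]^{-1}\Gamma(\ell P+Q,x)\Gamma^{-1}(\ell P+Q).$$ Empty products equal $I$. The identities are understood for those $z\in\mathbb{C}$ for which the series involved converge. *)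

(* Defs.v *)
From HB Require Import structures.
From mathcomp Require Import all_boot all_order all_algebra.
From mathcomp Require Import all_classical all_reals all_analysis.
From mathcomp Require Import complex.

Set Implicit Arguments.
Unset Strict Implicit.
Unset Printing Implicit Defensive.

Import Order.TTheory GRing.Theory Num.Theory numFieldNormedType.Exports.

Local Open Scope classical_set_scope.
Local Open Scope ring_scope.
Local Open Scope complex_scope.

(* Equips R[i] with the topology of its modulus, which the library attaches to
   every numClosedFieldType; matrices over R[i] then carry the entrywise
   topology, in which all limits below are taken. *)
HB.instance Definition _ (R : realType) :=
  NormedModule.copy R[i] (R[i] : numClosedFieldType).

Section MatrixFunctions.
Context {R : realType} {N : nat}.
Implicit Types (M P Q : 'M[R[i]]_N) (F : R -> 'M[R[i]]_N).

Definition pos_spectrum M : Prop :=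
  forall a : R[i], eigenvalue M a -> 0 < complex.Re a.

Definition mxexp M : 'M[R[i]]_N :=
  limn (series (fun k : nat => (k`!%:R)^-1 *: M ^+ k)).

(* only meaningful for 0 < t *)
Definition mxpow (t : R) M : 'M[R[i]]_N := mxexp ((ln t)%:C *: M).

Definition mx_Rintegral (D : set R) F : 'M[R[i]]_N :=
  \matrix_(i, j) ((\int[lebesgue_measure]_(u in D) complex.Re (F u i j)) +i*
                  (\int[lebesgue_measure]_(u in D) complex.Im (F u i j))).

(* Improper integral at both endpoints: the limit of the integrals over [c, d]
   as c decreases to a and d increases to b. *)
Definition mx_improper_fmap (a b : R) F : set_system 'M[R[i]]_N :=
  (fun cd : R * R => mx_Rintegral `[cd.1, cd.2] F) @ filter_prod a^'+ b^'-.

Definition mx_improper_cvg (a b : R) F : Prop := cvg (mx_improper_fmap a b F).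

Definition mx_improper_integral (a b : R) F : 'M[R[i]]_N :=
  lim (mx_improper_fmap a b F).

Definition gamma_integrand M (u : R) : 'M[R[i]]_N :=
  (expR (- u))%:C *: mxpow u (M - 1).

Definition mxGamma M : 'M[R[i]]_N :=
  mx_Rintegral `]0, +oo[ (gamma_integrand M).

Definition mx_lower_gamma M (x : R) : 'M[R[i]]_N :=
  mx_Rintegral `]0, x[ (gamma_integrand M).

Definition mx_upper_gamma M (x : R) : 'M[R[i]]_N :=
  mx_Rintegral `]x, +oo[ (gamma_integrand M).

Definition mx_pochhammer M (l : nat) : 'M[R[i]]_N :=
  \prod_(k < l) (M + k%:R).

Definition hyp_term r s (A : 'I_r -> 'M[R[i]]_N) (B : 'I_s -> 'M[R[i]]_N)
    (z : R[i]) (l : nat) : 'M[R[i]]_N :=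
  (z ^+ l / l`!%:R) *:
  ((\prod_(i < r) mx_pochhammer (A i) l) *
   invmx (\prod_(j < s) mx_pochhammer (B j) l)).

Definition lower_e_term (x : R) P Q r s (A : 'I_r -> 'M[R[i]]_N)
    (B : 'I_s -> 'M[R[i]]_N) (z : R[i]) (l : nat) : 'M[R[i]]_N :=
  hyp_term A B z l * mx_lower_gamma (P *+ l + Q) x * invmx (mxGamma (P *+ l + Q)).

Definition upper_E_term (x : R) P Q r s (A : 'I_r -> 'M[R[i]]_N)
    (B : 'I_s -> 'M[R[i]]_N) (z : R[i]) (l : nat) : 'M[R[i]]_N :=
  hyp_term A B z l * mx_upper_gamma (P *+ l + Q) x * invmx (mxGamma (P *+ l + Q)).

Definition lower_e (x : R) P Q r s (A : 'I_r -> 'M[R[i]]_N)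
    (B : 'I_s -> 'M[R[i]]_N) (z : R[i]) : 'M[R[i]]_N :=
  limn (series (lower_e_term x P Q A B z)).

Definition upper_E (x : R) P Q r s (A : 'I_r -> 'M[R[i]]_N)
    (B : 'I_s -> 'M[R[i]]_N) (z : R[i]) : 'M[R[i]]_N :=
  limn (series (upper_E_term x P Q A B z)).

End MatrixFunctions.

Definition fam_behead T r (A : 'I_r.+1 -> T) : 'I_r -> T :=
  fun i => A (lift ord0 i).

(* Main.v *)
(* Write M = B_1 - A_1, let c_l be the l-th term of the series with A_1, B_1
   removed and S_l the l-th partial sum of sum_l (A_1)_l (B_1)_l^-1 c_l.  With
   E_l = (B_1)_l ((A_1)_(l+1))^-1, the function
     H(t) = t^A_1 (1 - t)^M sum_l E_l S_l t^l
   is an antiderivative of the integrand on ]0, 1[, by summation by parts; only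
   the convergence of the two series, not absolute convergence, is needed.  H
   vanishes at 0.  At 1 an Abelian argument gives its limit: E_l is the l-th
   coefficient (M)_l / l! of (1 - t)^-M times a factor converging to
   Gamma(M) Gamma(B_1)^-1 Gamma(A_1).  That convergence, and the invertibility
   of Gamma on matrices with spectrum in the right half-plane, both come from
   Gamma(M + m + 1) (m + 1)^-M / m! --> I, which is obtained by estimating
   (u / (m + 1))^M - I under the integral of u^m e^-u / m!. *)
Require Import Defs.
From HB Require Import structures.
From mathcomp Require Import all_boot all_order all_algebra.
From mathcomp Require Import all_classical all_reals all_analysis.
From mathcomp Require Import measurable_realfun complex.
From mathcomp Require Import ring lra.

Set Implicit Arguments.
Unset Strict Implicit.
Unset Printing Implicit Defensive.

Import Order.TTheory GRing.Theory Num.Theory numFieldNormedType.Exports.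

Local Open Scope classical_set_scope.
Local Open Scope ring_scope.
Local Open Scope complex_scope.

(** * Norms and limits of complex matrices *)

(** It is found by comparing coefficients: for f = sum_l C_l t^l the derivative of t^A_1 (1 - t)^M f
    is t^(A_1 - I) (1 - t)^(M - I) times the series with coefficients (A_1 + l) C_l - (B_1 + l - 1)
    C_(l-1). With C_l = E_l S_l both products acquire the left factor (B_1)_l (A_1)_l^-1, which
    leaves S_l - S_(l-1). The obstacle at 1 is that matrix weights have no sign. Where the scalar
    Abelian argument uses positive coefficients of (1 - t)^-M, a bound uniform in t on the sum of
    the norms of (1 - t)^M (M)_l t^l / l! takes over. The spectral input to these estimates is one
    bound, exp(s M) = O(e^(mu s)) for s <= 0 with some mu > 0, proved by stripping off the factors
    of the characteristic polynomial instead of passing to a Jordan form. *)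

Section Coordinates.
Context {R : realType} {N : nat}.
Local Notation MC := 'M[R[i]]_N.
Local Notation idx := (bool * 'I_N * 'I_N)%type.
Implicit Types (X Y Z : MC) (k : idx) (z w : R[i]).

(** The boolean of the index selects the real or the imaginary part. Limits, derivatives and
    integrals of matrix functions are all reduced to these 2 N^2 real coordinates. *)
Definition co k X : R :=
  if k.1.1 then complex.Re (X k.1.2 k.2) else complex.Im (X k.1.2 k.2).

Lemma ReD z w : complex.Re (z + w) = complex.Re z + complex.Re w.
Proof. by case: z; case: w. Qed.
Lemma ImD z w : complex.Im (z + w) = complex.Im z + complex.Im w.
Proof. by case: z; case: w. Qed.
Lemma ReN z : complex.Re (- z) = - complex.Re z.
Proof. by case: z. Qed.
Lemma ImN z : complex.Im (- z) = - complex.Im z.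
Proof. by case: z. Qed.
Lemma ReM z w : complex.Re (z * w) =
  complex.Re z * complex.Re w - complex.Im z * complex.Im w.
Proof. by case: z; case: w. Qed.
Lemma ImM z w : complex.Im (z * w) =
  complex.Re z * complex.Im w + complex.Im z * complex.Re w.
Proof. by case: z => a b; case: w => c d. Qed.

Lemma co0 k : co k 0 = 0.
Proof. by rewrite /co mxE if_same. Qed.
Lemma coD k X Y : co k (X + Y) = co k X + co k Y.
Proof. by rewrite /co !mxE; case: ifP; rewrite ?ReD ?ImD. Qed.
Lemma coN k X : co k (- X) = - co k X.
Proof. by rewrite /co !mxE; case: ifP; rewrite ?ReN ?ImN. Qed.
Lemma coB k X Y : co k (X - Y) = co k X - co k Y.
Proof. by rewrite coD coN. Qed.
Lemma coZ k (r : R) X : co k (r%:C *: X) = r * co k X.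
Proof.
by rewrite /co !mxE ReM ImM /=; case: ifP; rewrite mul0r ?subr0 ?addr0.
Qed.
Lemma co_sum k (I : Type) (s : seq I) (P : pred I) (F : I -> MC) :
  co k (\sum_(i <- s | P i) F i) = \sum_(i <- s | P i) co k (F i).
Proof. exact: (big_morph (co k) (coD k) (co0 k)). Qed.

(** One formula serves both parts: negating the boolean exchanges real and imaginary parts, and
    [(-1) ^+ k.1.1] is the sign coming from i^2 = -1. *)
Lemma coM k X Y : co k (X * Y) =
  \sum_l (co (true, k.1.2, l) X * co (k.1.1, l, k.2) Y +
          (-1) ^+ k.1.1 * (co (false, k.1.2, l) X * co (~~ k.1.1, l, k.2) Y)).
Proof.
rewrite /co mxE; case: k => [[[] i] j] /=.
  rewrite (big_morph _ ReD (erefl (complex.Re 0))).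
  by apply: eq_bigr => l _; rewrite ReM expr1 mulN1r.
rewrite (big_morph _ ImD (erefl (complex.Im 0))).
by apply: eq_bigr => l _; rewrite ImM expr0 mul1r.
Qed.

Lemma co_inj X Y : (forall k, co k X = co k Y) -> X = Y.
Proof.
move=> h; apply/matrixP => i j; have := h (true, i, j); have := h (false, i, j).
by rewrite /co /=; case: (X i j) => a b; case: (Y i j) => c d /= -> ->.
Qed.

Definition cnorm1 z : R := `|complex.Re z| + `|complex.Im z|.

(* The l^1 norm: real valued and submultiplicative, unlike the max norm of the
   library. *)
Definition mnorm X : R := \sum_i \sum_j cnorm1 (X i j).

Lemma cnorm1_ge0 z : 0 <= cnorm1 z. Proof. exact: addr_ge0. Qed.

Lemma cnorm1D z w : cnorm1 (z + w) <= cnorm1 z + cnorm1 w.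
Proof. by rewrite /cnorm1 ReD ImD addrACA lerD// ler_normD. Qed.

Lemma cnorm1M z w : cnorm1 (z * w) <= cnorm1 z * cnorm1 w.
Proof.
rewrite /cnorm1 ReM ImM mulrDl !mulrDr -!normrM.
have -> (a b c d : R) : a + b + (c + d) = (a + d) + (b + c) by ring.
by rewrite lerD//; [exact: ler_normB|exact: ler_normD].
Qed.

Lemma cnorm1_sum (I : Type) (s : seq I) (P : pred I) (F : I -> R[i]) :
  cnorm1 (\sum_(i <- s | P i) F i) <= \sum_(i <- s | P i) cnorm1 (F i).
Proof.
elim/big_rec2: _ => [|i a b _ h]; first by rewrite /cnorm1 /= normr0 addr0.
by apply: le_trans (cnorm1D _ _) _; rewrite lerD2l.
Qed.

Lemma mnormE X : mnorm X = \sum_k `|co k X|.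
Proof.
rewrite -(pair_bigA _ (fun (bi : bool * 'I_N) j => `|co (bi, j) X|)) /=.
rewrite -(pair_bigA _ (fun (b : bool) i => \sum_j `|co (b, i, j) X|)) /=.
rewrite big_bool /= -big_split /=; apply: eq_bigr => i _.
by rewrite -big_split.
Qed.

Lemma mnorm_ge0 X : 0 <= mnorm X.
Proof. by rewrite mnormE sumr_ge0. Qed.

Lemma mnorm0 : mnorm 0 = 0.
Proof. by rewrite mnormE big1// => k _; rewrite co0 normr0. Qed.

Lemma mnormN X : mnorm (- X) = mnorm X.
Proof. by rewrite !mnormE; apply: eq_bigr => k _; rewrite coN normrN. Qed.

Lemma mnormD X Y : mnorm (X + Y) <= mnorm X + mnorm Y.
Proof.
by rewrite !mnormE -big_split ler_sum// => k _; rewrite coD ler_normD.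
Qed.

Lemma mnormB X Y : mnorm (X - Y) <= mnorm X + mnorm Y.
Proof. by rewrite -(mnormN Y) mnormD. Qed.

Lemma mnormZ (r : R) X : mnorm (r%:C *: X) = `|r| * mnorm X.
Proof.
by rewrite !mnormE mulr_sumr; apply: eq_bigr => k _; rewrite coZ normrM.
Qed.

Lemma mnorm_sum (I : Type) (s : seq I) (P : pred I) (F : I -> MC) :
  mnorm (\sum_(i <- s | P i) F i) <= \sum_(i <- s | P i) mnorm (F i).
Proof.
elim/big_rec2: _ => [|i a b _ h]; first by rewrite mnorm0.
by apply: le_trans (mnormD _ _) _; rewrite lerD2l.
Qed.

Lemma mnormM X Y : mnorm (X * Y) <= mnorm X * mnorm Y.
Proof.
rewrite {1 2}/mnorm mulr_suml; apply: ler_sum => i _.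
apply: (@le_trans _ _ (\sum_j \sum_l cnorm1 (X i l) * cnorm1 (Y l j))).
  apply: ler_sum => j _; rewrite mxE; apply: (le_trans (cnorm1_sum _ _ _)).
  by apply: ler_sum => l _; exact: cnorm1M.
rewrite exchange_big mulr_suml /=; apply: ler_sum => l _.
rewrite -mulr_sumr ler_wpM2l ?cnorm1_ge0//.
rewrite /mnorm [leRHS](bigD1 l) //= lerDl sumr_ge0// => m _.
by rewrite sumr_ge0// => j _; exact: cnorm1_ge0.
Qed.

Lemma co_le_mnorm k X : `|co k X| <= mnorm X.
Proof. by rewrite mnormE (bigD1 k)//= lerDl sumr_ge0. Qed.

Lemma mnorm_eq0 X : mnorm X <= 0 -> X = 0.
Proof.
move=> h; apply: co_inj => k; rewrite co0; apply/eqP; rewrite -normr_le0.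
exact: le_trans (co_le_mnorm k X) h.
Qed.

(** In the l^1 norm the identity has norm N, not 1, and exponent 0 attains this factor. *)
Lemma mnormX_le X n : mnorm (X ^+ n) <= mnorm 1 * mnorm X ^+ n.
Proof.
elim: n => [|n IH]; first by rewrite !expr0 mulr1.
rewrite !exprSr mulrA; apply: le_trans (mnormM _ _) _.
by rewrite ler_wpM2r// mnorm_ge0.
Qed.

Lemma mxscaleAl (a : R[i]) X Y : a *: (X * Y) = (a *: X) * Y.
Proof. exact: scalemxAl. Qed.

Lemma mxscaleAr (a : R[i]) X Y : a *: (X * Y) = X * (a *: Y).
Proof. exact: scalemxAr. Qed.

End Coordinates.

Section Limits.
Context {R : realType} {N : nat}.
Local Notation MC := 'M[R[i]]_N.
Implicit Types (X Y Z : MC).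

Lemma normc_le_cnorm1 (z : R[i]) : `|z| <= (cnorm1 z)%:C.
Proof.
case: z => a b; rewrite /cnorm1 /=.
have -> : a +i* b = a%:C + 'i%C * b%:C by rewrite [LHS]complexE.
apply: le_trans (ler_normD _ _) _.
rewrite normrM rmorphD /= lerD//.
- by rewrite normc_def /= expr0n addr0 sqrtr_sqr.
- by rewrite !normc_def /= !expr0n /= addr0 add0r expr1n sqrtr1 mul1r sqrtr_sqr.
Qed.

Lemma cnorm1_le_normc (z : R[i]) : (cnorm1 z)%:C <= 2%:R * `|z|.
Proof.
rewrite mulr_natl mulr2n /cnorm1 rmorphD /= lerD ?normc_ge_Re//.
rewrite -(_ : `|z * 'i%C| = `|z|).
  by apply: le_trans (normc_ge_Re _); rewrite ReiNIm normrN.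
by rewrite normrM [X in _ * X]normc_def /= expr0n add0r expr1n sqrtr1 mulr1.
Qed.

Lemma mxnorm_entry_le (X : MC) i j : `|X i j| <= `|X|.
Proof.
rewrite /Num.norm /= mx_normE.
exact: (le_bigmax _ (fun ij => `|X ij.1 ij.2|%:nng) (i, j)).
Qed.

Lemma mxnorm_le_mnorm (X : MC) : `|X| <= (mnorm X)%:C.
Proof.
have -> : `|X| = mx_norm X by [].
have [e|/mx_norm_neq0 [[i j] Xij]] := eqVneq (mx_norm X) 0.
  by rewrite e lecR mnorm_ge0.
rewrite Xij /=; apply: le_trans (normc_le_cnorm1 _) _.
rewrite lecR /mnorm (bigD1 i)//= (bigD1 j)//= -addrA lerDl addr_ge0 ?sumr_ge0//.
  by move=> *; exact: cnorm1_ge0.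
by move=> *; rewrite sumr_ge0// => *; exact: cnorm1_ge0.
Qed.

Lemma cvg_mnormP {T : Type} {F : set_system T} {FF : Filter F} (f : T -> MC) X :
  f @ F --> X <-> mnorm (f t - X) @[t --> F] --> 0.
Proof.
split=> [/cvgrPdist_lt h|/cvgrPdist_lt h].
- apply/cvgrPdist_lt => e e0.
  (* Each of the N^2 entries contributes at most twice its modulus; the + 1 keeps [D] positive when
     N = 0 and makes the final inequality strict. *)
  pose D := 2 * (N * N)%:R + 1 : R.
  have D0 : 0 < D by rewrite ltr_wpDl// mulr_ge0.
  have /h : 0 < (e / D)%:C by rewrite (ltcR 0) divr_gt0.
  apply: filterS => t ht; rewrite sub0r normrN ger0_norm ?mnorm_ge0//.
  have hij i j : cnorm1 ((f t - X) i j) <= 2 * (e / D).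
    rewrite -lecR; apply: le_trans (cnorm1_le_normc _) _.
    rewrite rmorphM /= rmorph_nat ler_wpM2l//; apply: le_trans (ltW ht).
    by rewrite distrC; exact: mxnorm_entry_le.
  apply: (@le_lt_trans _ _ (\sum_(i < N) \sum_(j < N) 2 * (e / D))).
    by apply: ler_sum => i _; apply: ler_sum => j _.
  rewrite !sumr_const !card_ord -mulrnA -(mulr_natr _ (N * N)) mulrAC mulrA.
  rewrite ltr_pdivrMr// mulrC ltr_pM2l//.
  by rewrite /D ltrDl.
(* A positive element of [R[i]] is real, so its imaginary part e' vanishes. *)
- apply/cvgrPdist_lt => -[e e']; rewrite ltcE /= => /andP[/eqP -> e1].
  have := h _ e1; apply: filterS => t; rewrite sub0r normrN ger0_norm ?mnorm_ge0//.
  move=> ht; apply: (@le_lt_trans _ _ (mnorm (f t - X))%:C); last by rewrite ltcR.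
  by rewrite distrC mxnorm_le_mnorm.
Qed.

Section Filter.
Context {T : Type} {F : set_system T} {FF : ProperFilter F}.
Implicit Types (f g : T -> MC).

Lemma mx_cvg_lim f X : f @ F --> X -> lim (f @ F) = X.
Proof. by move=> fX; apply: cvg_lim fX; exact: norm_hausdorff. Qed.

Lemma squeeze_mnorm (b : T -> R) f X :
  (\forall t \near F, mnorm (f t - X) <= b t) -> b @ F --> (0 : R) -> f @ F --> X.
Proof.
move=> fb b0; apply/cvg_mnormP; apply: (squeeze_cvgr _ (cvg_cst 0) b0).
by apply: filterS fb => t ht; rewrite mnorm_ge0.
Qed.

Lemma cvg_coP f X : f @ F --> X <-> forall k, co k (f t) @[t --> F] --> co k X.
Proof.
split=> [/cvg_mnormP h k|h].
  apply/cvgrPdistC_lt => e e0; move/cvgr_lt : h => /(_ _ e0).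
  apply: filterS => t; apply: le_lt_trans.
  by rewrite -coB co_le_mnorm.
apply/cvg_mnormP; under eq_fun do rewrite mnormE.
suff /cvg_trans : (fun t => \sum_k `|co k (f t - X)|) @ F -->
    \sum_(k : bool * 'I_N * 'I_N) (0 : R).
  by apply; rewrite big1.
apply: (@cvg_big _ _ +%R (0 : R) xpredT (@add_continuous R)) => k _.
rewrite -(normr0 R); apply: cvg_norm.
under eq_fun do rewrite coB.
by rewrite -(subrr (co k X)); apply: cvgB; [exact: h|exact: cvg_cst].
Qed.

Lemma mxcvgM f g X Y : f @ F --> X -> g @ F --> Y ->
  (fun t => f t * g t) @ F --> X * Y.
Proof.
move=> /cvg_mnormP fX /cvg_mnormP gY.
apply: (@squeeze_mnorm (fun t => mnorm (f t - X) * (mnorm (g t - Y) + mnorm Y) +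
   mnorm X * mnorm (g t - Y))).
  apply: nearW => t.
  have -> : f t * g t - X * Y = (f t - X) * ((g t - Y) + Y) + X * (g t - Y).
    by rewrite subrK mulrBl mulrBr addrA subrK.
  apply: le_trans (mnormD _ _) _; apply: lerD; last exact: mnormM.
  apply: le_trans (mnormM _ _) _; apply: ler_wpM2l; first exact: mnorm_ge0.
  exact: mnormD.
have := cvgD (cvgM fX (cvgD gY (cvg_cst (mnorm Y))))
  (cvgM (cvg_cst (mnorm X)) gY).
by rewrite mul0r mulr0 addr0; apply.
Qed.

Lemma mxcvg_cst X : (fun _ : T => X) @ F --> X.
Proof. exact: cvg_cst. Qed.

Lemma mxcvgMl f X Y : f @ F --> Y -> (fun t => X * f t) @ F --> X * Y.
Proof. by move=> fY; exact: (mxcvgM (@mxcvg_cst X) fY). Qed.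

Lemma mxcvgMr f X Y : f @ F --> Y -> (fun t => f t * X) @ F --> Y * X.
Proof. by move=> fY; exact: (mxcvgM fY (@mxcvg_cst X)). Qed.

Lemma mxcvgZ (r : T -> R) f (r0 : R) X : r @ F --> r0 -> f @ F --> X ->
  (fun t => (r t)%:C *: f t) @ F --> r0%:C *: X.
Proof.
move=> rr /cvg_coP fX; apply/cvg_coP => k; under eq_fun do rewrite coZ.
by rewrite coZ; apply: cvgM.
Qed.

Lemma mxcvgD f g X Y : f @ F --> X -> g @ F --> Y ->
  (fun t => f t + g t) @ F --> X + Y.
Proof. exact: cvgD. Qed.

Lemma mxcvg_unique f X Y : f @ F --> X -> f @ F --> Y -> X = Y.
Proof. by move=> /mx_cvg_lim <- /mx_cvg_lim. Qed.

Lemma mxcvg_le_mnorm f X (K : R) : (\forall t \near F, mnorm (f t) <= K) ->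
  f @ F --> X -> mnorm X <= K.
Proof.
move=> fK fX; apply/ler_addgt0Pl => e e0.
have /cvg_mnormP/cvgr_lt/(_ _ e0) fe := fX.
have [t [ftK fte]] := filter_ex (filterI fK fe).
have -> : X = - (f t - X) + f t by rewrite opprB subrK.
by apply: le_trans (mnormD _ _) _; rewrite mnormN lerD// ltW.
Qed.

End Filter.

End Limits.

Arguments mx_cvg_lim {R N T F FF f X} _.
Arguments mxcvg_unique {R N T F FF f X Y} _ _.
Arguments mxcvgM {R N T F FF f g X Y} _ _.
Arguments mxcvgD {R N T F FF f g X Y} _ _.
Arguments mxcvgZ {R N T F FF r f r0 X} _ _.
Arguments mxcvgMl {R N T F FF f} X {Y} _.
Arguments mxcvgMr {R N T F FF f} X {Y} _.
Arguments mxcvg_cst {R N T F FF} X.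
Arguments squeeze_mnorm {R N T F FF} b {f X} _ _.
Arguments mxcvg_le_mnorm {R N T F FF f X K} _ _.

(** * Derivatives and power series *)

Section RealPowerSeries.
Context {R : realType}.
Implicit Types (f : R^nat) (q r z rho K : R).

(** Each of the n + 1 terms of 1 + q + ... + q^n is at least q^n, and the geometric sum is at most 1
    / (1 - q). *)
Lemma mulrn_expr_le q n : 0 <= q < 1 -> n.+1%:R * q ^+ n <= (1 - q)^-1.
Proof.
move=> /andP[q0 q1].
have h : n.+1%:R * q ^+ n <= \sum_(l < n.+1) q ^+ l.
  rewrite mulr_natl -[X in _ *+ X]card_ord -sumr_const; apply: ler_sum => l _.
  by apply: ler_wiXn2l => //; [exact: ltW|rewrite -ltnS].
apply: le_trans h _; rewrite -[leRHS]mul1r ler_pdivlMr ?subr_gt0//.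
have := subrX1 q n.+1; have := exprn_ge0 n.+1 q0; lra.
Qed.

(** Comparison with a geometric series of ratio |z| / rho. Boundedness of [f n * rho ^+ n] is the
    form in which radii of convergence are carried from here on. *)
Lemma cvg_pseries_bounded f rho K z :
  (forall n, `|f n| * rho ^+ n <= K) -> `|z| < rho -> cvgn (pseries f z).
Proof.
move=> fK zr; have r0 : 0 < rho by exact: le_lt_trans zr.
apply: normed_cvg.
apply: (@series_le_cvg _ _ (geometric K (`|z| / rho))) => //=.
- move=> n; apply: mulr_ge0; last by rewrite exprn_ge0// divr_ge0// ltW.
  by apply: le_trans (fK 0%N); rewrite mulr_ge0// exprn_ge0// ltW.
- move=> n; rewrite normrM normrX expr_div_n mulrA ler_pdivlMr ?exprn_gt0//.
  by rewrite mulrAC ler_wpM2r.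
- apply: is_cvg_geometric_series.
  by rewrite normrM normr_id normfV (gtr0_norm r0) ltr_pdivrMr ?mul1r.
Qed.

(** Differentiation costs some radius: (n + 1) (r / rho)^n is bounded because r < rho. *)
Lemma pseries_diffs_bounded f rho r K :
  (forall n, `|f n| * rho ^+ n <= K) -> 0 <= r < rho ->
  forall n, `|pseries_diffs f n| * r ^+ n <= K / (rho - r).
Proof.
move=> fK /andP[r0 rr] n; have rho0 : 0 < rho by exact: le_lt_trans rr.
have q01 : 0 <= r / rho < 1.
  by rewrite divr_ge0 ?(ltW rho0)//= ltr_pdivrMr// mul1r.
have -> : `|pseries_diffs f n| * r ^+ n =
    (`|f n.+1| * rho ^+ n.+1) * (n.+1%:R * (r / rho) ^+ n / rho).
  rewrite /pseries_diffs normrM ger0_norm// expr_div_n exprS.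
  by field; rewrite expf_neq0 gt_eqF.
have -> : (rho - r)^-1 = (1 - r / rho)^-1 / rho.
  by field; rewrite !gt_eqF ?subr_gt0.
apply: ler_pM => //.
- by rewrite mulr_ge0// exprn_ge0// ltW.
- by rewrite !mulr_ge0 ?invr_ge0 ?exprn_ge0 ?(ltW rho0)//; case/andP: q01.
- by rewrite ler_wpM2r ?invr_ge0 ?(ltW rho0)// mulrn_expr_le.
Qed.

Lemma is_derive_pseries f rho K z :
  (forall n, `|f n| * rho ^+ n <= K) -> `|z| < rho ->
  is_derive z (1 : R) (fun x => limn (pseries f x))
    (limn (pseries (pseries_diffs f) z)).
Proof.
move=> fK zr; have z0 := normr_ge0 z.
(* Three radii strictly between |z| and rho: two are spent on the two differentiations, and all
   three series must converge at the smallest, [m 1]. *)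
pose m (i : nat) : R := `|z| + (rho - `|z|) * (i%:R / 4%:R).
have m12 : m 1%N < m 2%N by rewrite /m; lra.
have m23 : m 2%N < m 3%N by rewrite /m; lra.
have m34 : m 3%N < rho by rewrite /m; lra.
have m1 : `|z| < m 1%N by rewrite /m; lra.
have h1 := pseries_diffs_bounded fK (r := m 3%N).
have h2 := pseries_diffs_bounded (h1 _) (r := m 2%N).
have {}h1 := h1 _; have {}h2 := h2 _ _.
have e3 : 0 <= m 3%N < rho by apply/andP; split; lra.
have e2 : 0 <= m 2%N < m 3%N by apply/andP; split; lra.
have g1 : `|m 1%N| = m 1%N by rewrite ger0_norm; lra.
apply: (@pseries_snd_diffs _ f (m 1%N)).
- by apply: cvg_pseries_bounded fK _; rewrite g1; lra.
- by apply: cvg_pseries_bounded (h1 e3) _; rewrite g1; lra.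
- by apply: cvg_pseries_bounded (h2 e3 e2) _; rewrite g1; lra.
- by rewrite g1.
Qed.

End RealPowerSeries.

(** * Derivatives of matrix functions, coordinate by coordinate *)

Section MatrixDerivative.
Context {R : realType} {N : nat}.
Local Notation MC := 'M[R[i]]_N.
Implicit Types (X Y Z : MC) (F G : R -> MC) (t : R).

Definition is_mxderive t F X :=
  forall k, is_derive t (1 : R) (fun u => co k (F u)) (co k X).

Lemma is_mxderive_eq t F X Y : is_mxderive t F X -> X = Y -> is_mxderive t F Y.
Proof. by move=> h <-. Qed.

Lemma is_mxderive_cst t X : is_mxderive t (fun=> X) 0.
Proof. by move=> k; rewrite co0; exact: is_derive_cst. Qed.

Lemma is_mxderiveD t F G X Y : is_mxderive t F X -> is_mxderive t G Y ->
  is_mxderive t (fun u => F u + G u) (X + Y).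
Proof.
move=> FX GY k; have {}FX := FX k; have {}GY := GY k.
rewrite coD (_ : (fun _ => _) = (fun u => co k (F u)) + (fun u => co k (G u))).
  exact: is_deriveD.
by apply/funext => u; rewrite coD.
Qed.

Lemma is_mxderiveM t F G X Y : is_mxderive t F X -> is_mxderive t G Y ->
  is_mxderive t (fun u => F u * G u) (X * G t + F t * Y).
Proof.
move=> FX GY k; rewrite coD !coM -big_split /=.
pose h l := (fun u => co (true, k.1.2, l) (F u)) * (fun u => co (k.1.1, l, k.2) (G u)) +
  (-1) ^+ k.1.1 *: ((fun u => co (false, k.1.2, l) (F u)) *
     (fun u => co (~~ k.1.1, l, k.2) (G u))).
rewrite (_ : (fun _ => _) = \sum_l h l); last first.
  by apply/funext => u; rewrite coM fct_sumE.
pose dh l := (co (true, k.1.2, l) (F t) *: co (k.1.1, l, k.2) Y +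
    co (k.1.1, l, k.2) (G t) *: co (true, k.1.2, l) X) +
  (-1) ^+ k.1.1 *: (co (false, k.1.2, l) (F t) *: co (~~ k.1.1, l, k.2) Y +
    co (~~ k.1.1, l, k.2) (G t) *: co (false, k.1.2, l) X) : R.
have dl (l : 'I_N) : is_derive t (1 : R) (h l) (dh l).
  exact: (is_deriveD (is_deriveM (FX _) (GY _))
    (is_deriveZ _ (is_deriveM (FX _) (GY _)))).
apply: (is_derive_eq (is_derive_sum dl)).
by apply: eq_bigr => l _; rewrite /dh /GRing.scale /=; ring.
Qed.

Lemma is_mxderiveZ t (r : R -> R) (dr : R) F X :
  is_derive t (1 : R) r dr -> is_mxderive t F X ->
  is_mxderive t (fun u => (r u)%:C *: F u) (dr%:C *: F t + (r t)%:C *: X).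
Proof.
move=> hr FX k; have {}FX := FX k.
rewrite coD !coZ (_ : (fun _ => _) = r * (fun u => co k (F u))).
  by apply: is_derive_eq; rewrite /GRing.scale /=; ring.
by apply/funext => u; rewrite coZ.
Qed.

Lemma is_mxderiveMl t F X Y : is_mxderive t F Y ->
  is_mxderive t (fun u => X * F u) (X * Y).
Proof.
move=> h; apply: is_mxderive_eq (is_mxderiveM (is_mxderive_cst t X) h) _.
by rewrite mul0r add0r.
Qed.

Lemma is_mxderiveMr t F X Y : is_mxderive t F X ->
  is_mxderive t (fun u => F u * Y) (X * Y).
Proof.
move=> h; apply: is_mxderive_eq (is_mxderiveM h (is_mxderive_cst t Y)) _.
by rewrite mulr0 addr0.
Qed.

Lemma is_mxderive_comp t F X (g : R -> R) (dg : R) :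
  is_derive t (1 : R) g dg -> is_mxderive (g t) F X ->
  is_mxderive t (fun u => F (g u)) (dg%:C *: X).
Proof.
move=> hg FX k; rewrite coZ mulrC.
exact: (@is_derive1_comp _ (fun u => co k (F u)) g).
Qed.

Lemma is_mxderive_cvg t F X : is_mxderive t F X -> F u @[u --> t] --> F t.
Proof.
move=> h; apply/(@cvg_coP R N R (nbhs t) _ F (F t)) => k.
have /derivable1_diffP/differentiable_continuous := @ex_derive _ _ _ _ _ _ _ (h k).
exact.
Qed.

Lemma is_mxderive0_cst F : (forall t, is_mxderive t F 0) -> forall a b, F a = F b.
Proof.
move=> h a b; apply: co_inj => k.
apply: (@is_derive_0_is_cst _ (fun u => co k (F u))) => t.
by have := h t k; rewrite co0.
Qed.

Lemma is_mxderive0_cst_oo F (a b : R) :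
  (forall t, a < t < b -> is_mxderive t F 0) ->
  forall s t, a < s < b -> a < t < b -> F s = F t.
Proof.
move=> h s t; wlog st : s t / s <= t.
  by move=> H sab tab; have [/H->|/ltW/H->] := leP s t.
move=> /andP[as_ sb] /andP[at_ tb]; apply: co_inj => k.
have d u : s <= u <= t -> is_derive u (1 : R) (fun u => co k (F u)) 0.
  move=> /andP[su ut]; rewrite -(co0 k); apply: h.
  by rewrite (lt_le_trans as_ su) (le_lt_trans ut tb).
have [||c _] := @MVT_segment _ (fun u => co k (F u)) (fun=> 0) _ _ st.
- by move=> u; rewrite in_itv /= => /andP[su ut]; apply: d; rewrite !ltW.
- apply: derivable_within_continuous => u; rewrite in_itv /= => /d hu.
  exact: ex_derive.
- by rewrite mul0r => /eqP; rewrite subr_eq0 => /eqP ->.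
Qed.

End MatrixDerivative.

(* Sealed, as is mexp below: otherwise unification unfolds the limits. *)
HB.lock Definition mpseries {R : realType} {N : nat} (C : nat -> 'M[R[i]]_N) (t : R) :
  nat -> 'M[R[i]]_N := series (fun l => (t ^+ l)%:C *: C l).
HB.lock Definition mps {R : realType} {N : nat} (C : nat -> 'M[R[i]]_N) (t : R) :
  'M[R[i]]_N := limn (mpseries C t).

Section MatrixPowerSeries.
Context {R : realType} {N : nat}.
Local Notation MC := 'M[R[i]]_N.
Implicit Types (C : nat -> MC) (t rho K : R).

Definition mps_diffs C (l : nat) : MC := l.+1%:R%:C *: C l.+1.

Lemma co_mpseries k C t n :
  co k (mpseries C t n) = pseries (fun l => co k (C l)) t n.
Proof.
rewrite mpseries.unlock /pseries /series /= co_sum.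
by apply: eq_bigr => l _; rewrite coZ mulrC.
Qed.

Lemma co_bounded C rho K : 0 < rho -> (forall l, mnorm (C l) * rho ^+ l <= K) ->
  forall k l, `|co k (C l)| * rho ^+ l <= K.
Proof.
move=> r0 CK k l; apply: le_trans (CK l).
by rewrite ler_wpM2r ?co_le_mnorm// exprn_ge0// ltW.
Qed.

(** The limit is assembled from the limits of the coordinates; the second conjunct is what gives
    access to the scalar results on power series. *)
Lemma mps_spec C rho K t : (forall l, mnorm (C l) * rho ^+ l <= K) -> `|t| < rho ->
  (mpseries C t n @[n --> \oo] --> mps C t) /\
  (forall k, co k (mps C t) = limn (pseries (fun l => co k (C l)) t)).
Proof.
move=> CK tr; have r0 : 0 < rho by exact: le_lt_trans tr.
have ck k := cvg_pseries_bounded (co_bounded r0 CK k) tr.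
pose L : MC := \matrix_(i, j)
  (limn (pseries (fun l => co (true, i, j) (C l)) t) +i*
   limn (pseries (fun l => co (false, i, j) (C l)) t)).
have coL k : co k L = limn (pseries (fun l => co k (C l)) t).
  by case: k => [[[] i] j]; rewrite /co mxE.
have CL : mpseries C t n @[n --> \oo] --> L.
  apply/cvg_coP => k; rewrite coL.
  by under eq_fun do rewrite co_mpseries; exact: ck.
by rewrite mps.unlock (mx_cvg_lim CL).
Qed.

Lemma mps_cvg C rho K t : (forall l, mnorm (C l) * rho ^+ l <= K) -> `|t| < rho ->
  mpseries C t n @[n --> \oo] --> mps C t.
Proof. by move=> CK /(mps_spec CK)[]. Qed.

Lemma mps_diffs_bounded C rho K r :
  (forall l, mnorm (C l) * rho ^+ l <= K) -> 0 <= r < rho ->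
  exists K', forall l, mnorm (mps_diffs C l) * r ^+ l <= K'.
Proof.
move=> CK /[dup] /andP[r0 rr] rrho; have rho0 : 0 < rho by exact: le_lt_trans rr.
exists (\sum_(k : bool * 'I_N * 'I_N) K / (rho - r)) => l.
rewrite mnormE mulr_suml; apply: ler_sum => k _.
rewrite (_ : co k _ = pseries_diffs (fun l => co k (C l)) l).
  exact: pseries_diffs_bounded (co_bounded rho0 CK k) rrho l.
by rewrite /mps_diffs coZ.
Qed.

Lemma is_mxderive_mps C rho K t : (forall l, mnorm (C l) * rho ^+ l <= K) ->
  `|t| < rho -> is_mxderive t (mps C) (mps (mps_diffs C) t).
Proof.
move=> CK tr k; have r0 : 0 < rho by exact: le_lt_trans tr.
have d := is_derive_pseries (co_bounded r0 CK k) tr.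
pose r := (`|t| + rho) / 2.
have rr : 0 <= r < rho.
  by have := normr_ge0 t; rewrite /r => ?; apply/andP; split; lra.
have tr' : `|t| < r by rewrite /r; lra.
have [K' dK'] := mps_diffs_bounded CK rr.
have [_ ->] := mps_spec dK' tr'.
rewrite (_ : (fun l => co k (mps_diffs C l)) = pseries_diffs (fun l => co k (C l))).
  (* The formula for the coordinates is known only inside the disc of radius rho, so the two
     functions agree near t rather than everywhere. *)
  apply: near_eq_is_derive d => //; near=> u.
  have ur : `|u| < rho.
    near: u; have := @cvgr_norm_lt _ _ _ (nbhs t) _ id t cvg_id rho tr.
    exact.
  by have [_ ->] := mps_spec CK ur.
by apply/funext => l; rewrite /mps_diffs coZ.
Unshelve. all: by end_near. Qed.

End MatrixPowerSeries.

Arguments mps_cvg {R N C rho K t} _ _.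
Arguments is_mxderive_cvg {R N t F X} _.

(** * The matrix exponential *)

(** The real factor s is kept apart from M so that s -> exp(s M) can be differentiated; t^M is its
    value at ln t. *)
HB.lock Definition mexp {R : realType} {N : nat} (M : 'M[R[i]]_N) (s : R) :
  'M[R[i]]_N := mxexp (s%:C *: M).

Section MatrixExponential.
Context {R : realType} {N : nat}.
Local Notation MC := 'M[R[i]]_N.
Implicit Types (X Y M A B : MC) (F : R -> MC) (s t : R).

Definition exp_coeffs M (l : nat) : MC := (l`!%:R^-1)%:C *: M ^+ l.

Lemma mx_exprZn (a : R[i]) M l : (a *: M) ^+ l = a ^+ l *: M ^+ l.
Proof.
elim: l => [|l IH]; first by rewrite !expr0 scale1r.
by rewrite !exprS IH -mxscaleAl -mxscaleAr scalerA.
Qed.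

Lemma mexpE M : mexp M = mps (exp_coeffs M).
Proof.
apply/funext => s; rewrite mexp.unlock /mxexp mps.unlock mpseries.unlock; congr (limn (series _)).
apply/funext => l; rewrite mx_exprZn /exp_coeffs !scalerA rmorphXn /=.
by rewrite fmorphV rmorph_nat mulrC.
Qed.

Lemma series_exp_le (x : R) n : 0 <= x -> \sum_(l < n) x ^+ l / l`!%:R <= expR x.
Proof.
move=> x0; rewrite -(big_mkord xpredT (fun l => x ^+ l / l`!%:R)).
apply: (@nondecreasing_cvgn_le _ (series (exp_coeff x))).
  by apply: nondecreasing_series => l _ _; exact: exp_coeff_ge0.
exact: is_cvg_series_exp_coeff.
Qed.

Lemma mnorm_exp_coeffs M l :
  mnorm (exp_coeffs M l) <= mnorm (1 : MC) * (mnorm M ^+ l / l`!%:R).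
Proof.
rewrite /exp_coeffs mnormZ ger0_norm ?invr_ge0// mulrA mulrC.
by rewrite ler_wpM2r ?invr_ge0// mnormX_le.
Qed.

Lemma exp_coeffs_bounded M rho : 0 <= rho ->
  forall l, mnorm (exp_coeffs M l) * rho ^+ l <= mnorm (1 : MC) * expR (mnorm M * rho).
Proof.
move=> r0 l; have mr : 0 <= mnorm M * rho by rewrite mulr_ge0// mnorm_ge0.
apply: (@le_trans _ _ (mnorm (1 : MC) * ((mnorm M * rho) ^+ l / l`!%:R))).
  rewrite exprMn mulrAC mulrA ler_wpM2r ?exprn_ge0//.
  exact: mnorm_exp_coeffs.
rewrite ler_wpM2l ?mnorm_ge0//; apply: le_trans (series_exp_le l.+1 mr).
by rewrite big_ord_recr /= lerDr sumr_ge0// => i _; rewrite divr_ge0// exprn_ge0.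
Qed.

Let ltr_normD1 s : `|s| < `|s| + 1. Proof. by rewrite ltrDl. Qed.
Let normD1_ge0 s : 0 <= `|s| + 1. Proof. exact: addr_ge0. Qed.

Lemma mexp_cvg M s : mpseries (exp_coeffs M) s n @[n --> \oo] --> mexp M s.
Proof.
by rewrite mexpE; exact: mps_cvg (exp_coeffs_bounded M (normD1_ge0 s)) (ltr_normD1 s).
Qed.

Lemma exp_coeffs_diffs M : mps_diffs (exp_coeffs M) = fun l => M * exp_coeffs M l.
Proof.
apply/funext => l; rewrite /mps_diffs /exp_coeffs scalerA -rmorphM /=.
rewrite factS natrM invfM mulVKf ?pnatr_eq0// -mxscaleAr exprS.
by [].
Qed.

Lemma mpseries_scalel M (C : nat -> MC) s n :
  mpseries (fun l => M * C l) s n = M * mpseries C s n.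
Proof.
rewrite mpseries.unlock /series /= mulr_sumr; apply: eq_bigr => l _.
by rewrite -mxscaleAr.
Qed.

Lemma mpseries_scaler M (C : nat -> MC) s n :
  mpseries (fun l => C l * M) s n = mpseries C s n * M.
Proof.
rewrite mpseries.unlock /series /= mulr_suml; apply: eq_bigr => l _.
by rewrite -mxscaleAl.
Qed.

Lemma mexp_derive M s : is_mxderive s (mexp M) (M * mexp M s).
Proof.
have d := is_mxderive_mps (exp_coeffs_bounded M (normD1_ge0 s)) (ltr_normD1 s).
rewrite mexpE; apply: is_mxderive_eq d _; rewrite exp_coeffs_diffs [in LHS]mps.unlock.
apply: mx_cvg_lim; rewrite (_ : mpseries _ s =
    (fun n => M * mpseries (exp_coeffs M) s n)).
  by apply: mxcvgMl; rewrite -mexpE; exact: mexp_cvg.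
by apply/funext => n; exact: mpseries_scalel.
Qed.

Lemma mexp_commM M s : M * mexp M s = mexp M s * M.
Proof.
have e : (fun n => mpseries (exp_coeffs M) s n * M) =
    (fun n => M * mpseries (exp_coeffs M) s n).
  apply/funext => n; rewrite -mpseries_scaler -mpseries_scalel.
  by congr (mpseries _ s n); apply/funext => l; rewrite /exp_coeffs -mxscaleAl
    -mxscaleAr -exprS -exprSr.
apply: (mxcvg_unique (mxcvgMl M (@mexp_cvg M s))).
by rewrite -e; exact: mxcvgMr (@mexp_cvg M s).
Qed.

Lemma mps0 (C : nat -> MC) rho K : 0 < rho ->
  (forall l, mnorm (C l) * rho ^+ l <= K) -> mps C 0 = C 0%N.
Proof.
move=> r0 CK; have := @mps_cvg _ _ C rho K 0 CK; rewrite normr0 => /(_ r0) h.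
apply: (mxcvg_unique h); rewrite -cvg_shiftS.
rewrite (_ : (fun n => _) = (fun=> C 0%N)); first exact: cvg_cst.
apply/funext => n; rewrite mpseries.unlock /series /= big_nat_recl//= big1 ?addr0.
  by rewrite expr0 scale1r.
by move=> i _; rewrite expr0n /= scale0r.
Qed.

Lemma mexp0 M : mexp M 0 = 1.
Proof.
rewrite mexpE (mps0 ltr01 (exp_coeffs_bounded M ler01)).
by rewrite /exp_coeffs expr0 invr1 scale1r.
Qed.

Lemma is_deriveNid1 s : is_derive s (1 : R) (fun u : R => - u) (-1).
Proof. exact: is_deriveNid. Qed.

Lemma mexpN_derive M s : is_mxderive s (fun u => mexp M (- u)) (- (M * mexp M (- s))).
Proof.
apply: is_mxderive_eq (is_mxderive_comp (F := mexp M)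
  (g := fun u => - u) (is_deriveNid1 s) (mexp_derive M (- s))) _.
by apply: co_inj => k; rewrite coZ coN mulN1r.
Qed.

Lemma mexpNK M s : mexp M (- s) * mexp M s = 1.
Proof.
have d t : is_mxderive t (fun u => mexp M (- u) * mexp M u) 0.
  apply: is_mxderive_eq (is_mxderiveM (mexpN_derive M t) (mexp_derive M t)) _.
  by rewrite (mexp_commM M (- t)) mulNr mulrA addNr.
by rewrite (is_mxderive0_cst d s 0) oppr0 mexp0 mulr1.
Qed.

Lemma mexpKN M s : mexp M s * mexp M (- s) = 1.
Proof. by rewrite -[X in mexp M X * _](opprK s) mexpNK. Qed.

(** Uniqueness for F' = M F, since exp(-s M) F(s) has zero derivative. The later identities for the
    exponential are obtained by checking this equation and the value at 0. *)
Lemma mexp_ode M F : (forall s, is_mxderive s F (M * F s)) ->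
  forall s, F s = mexp M s * F 0.
Proof.
move=> FM s; have d t : is_mxderive t (fun u => mexp M (- u) * F u) 0.
  apply: is_mxderive_eq (is_mxderiveM (mexpN_derive M t) (FM t)) _.
  by rewrite (mexp_commM M (- t)) mulNr mulrA addNr.
rewrite -[LHS]mul1r -(mexpKN M s) -mulrA (is_mxderive0_cst d s 0).
by rewrite oppr0 mexp0 mul1r.
Qed.

Lemma mexp_comm X M s : GRing.comm X M -> GRing.comm X (mexp M s).
Proof.
move=> XM; rewrite /GRing.comm.
have d t : is_mxderive t (fun u => X * mexp M u) (M * (X * mexp M t)).
  by apply: is_mxderive_eq (is_mxderiveMl X (mexp_derive M t)) _; rewrite !mulrA XM.
by rewrite (mexp_ode d) mexp0 mulr1.
Qed.

Lemma mexpD M s t : mexp M (s + t) = mexp M s * mexp M t.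
Proof.
have sh u : is_derive u (1 : R) (fun v : R => v + t) 1.
  exact: is_derive_shift.
have d u : is_mxderive u (fun v => mexp M (v + t)) (M * mexp M (u + t)).
  apply: is_mxderive_eq (is_mxderive_comp (F := mexp M)
    (g := fun v => v + t) (sh u) (mexp_derive M (u + t))) _.
  by rewrite scale1r.
by rewrite (mexp_ode d) add0r.
Qed.

Lemma mexpMD A B s : GRing.comm A B -> mexp (A + B) s = mexp A s * mexp B s.
Proof.
move=> AB; have d u : is_mxderive u (fun v => mexp A v * mexp B v)
    ((A + B) * (mexp A u * mexp B u)).
  apply: is_mxderive_eq (is_mxderiveM (mexp_derive A u) (mexp_derive B u)) _.
  rewrite mulrDl mulrA; congr (_ + _); rewrite !mulrA; congr (_ * _).
  by rewrite -(mexp_comm u (commr_sym AB)).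
by rewrite (mexp_ode d) !mexp0 !mulr1.
Qed.

Lemma mexp_cst (r s : R) :
  mexp (r%:C *: (1 : MC)) s = (expR (r * s))%:C *: (1 : MC).
Proof.
have d u : is_mxderive u (fun v => (expR (r * v))%:C *: (1 : MC))
    ((r%:C *: (1 : MC)) * ((expR (r * u))%:C *: (1 : MC))).
  have de : is_derive u (1 : R) (fun v => expR (r * v)) (expR (r * u) * r).
    apply: (@is_derive1_comp _ expR (fun v => r * v)).
    have := is_deriveZ r (is_derive_id u (1 : R)).
    by rewrite /GRing.scale /= mulr1.
  apply: is_mxderive_eq (is_mxderiveZ de (is_mxderive_cst u 1)) _.
  by rewrite scaler0 addr0 -mxscaleAr mulr1 scalerA -rmorphM.
by rewrite (mexp_ode d) mulr0 expR0 scale1r mulr1.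
Qed.

Lemma comm_scalar1 X (z : R[i]) : GRing.comm X (z *: (1 : MC)).
Proof. by rewrite /GRing.comm -mxscaleAr -mxscaleAl mulr1 mul1r. Qed.

Lemma mexpD_scalar M (r s : R) :
  mexp (M + r%:C *: (1 : MC)) s = (expR (r * s))%:C *: mexp M s.
Proof.
by rewrite mexpMD ?mexp_cst; [rewrite -mxscaleAr mulr1|exact: comm_scalar1].
Qed.

(** The constant term of the series cancels against 1, so the bound tends to 0 with s; this is what
    makes (u / w)^M - I small for u near w. *)
Lemma mexp_norm_sub1 M s :
  mnorm (mexp M s - 1) <= mnorm (1 : MC) * (expR (`|s| * mnorm M) - 1).
Proof.
have sM : 0 <= `|s| * mnorm M by rewrite mulr_ge0// mnorm_ge0.
apply: (mxcvg_le_mnorm (F := \oo)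
  (f := fun n => mpseries (exp_coeffs M) s n.+1 - 1)).
  apply: nearW => n; rewrite mpseries.unlock /series /= big_nat_recl//=.
  rewrite {1}/exp_coeffs expr0 invr1 !scale1r addrC addKr big_mkord.
  apply: le_trans (mnorm_sum _ _ _) _.
  have /(le_trans _) := series_exp_le n.+1 sM; rewrite big_ord_recl /= => h.
  have {}h : \sum_(l < n) (`|s| * mnorm M) ^+ l.+1 / l.+1`!%:R <=
     expR (`|s| * mnorm M) - 1.
    by rewrite lerBrDl; apply: h; rewrite expr0 divr1.
  apply: le_trans (ler_wpM2l (mnorm_ge0 _) h); rewrite mulr_sumr.
  apply: ler_sum => l _; rewrite mnormZ normrX exprMn -mulrA [leRHS]mulrCA.
  by rewrite ler_wpM2l ?exprn_ge0// mnorm_exp_coeffs.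
apply: mxcvgD; last exact: cvg_cst.
by rewrite (cvg_shiftS (mpseries (exp_coeffs M) s)); exact: mexp_cvg.
Qed.

Lemma mexp_norm M s : mnorm (mexp M s) <= mnorm (1 : MC) * expR (`|s| * mnorm M).
Proof.
rewrite -[mexp M s](subrK 1); apply: le_trans (mnormD _ _) _.
by have := mexp_norm_sub1 M s; rewrite mulrBr mulr1; lra.
Qed.

End MatrixExponential.

Section MeanValue.
Context {R : realType}.

(** Both g + f and g - f have nonnegative derivatives, hence increase from a to b. *)
Lemma ler_dist_derive (f df g dg : R -> R) (a b : R) : a <= b ->
  (forall u, a <= u <= b -> is_derive u (1 : R) f (df u)) ->
  (forall u, a <= u <= b -> is_derive u (1 : R) g (dg u)) ->
  (forall u, a <= u <= b -> `|df u| <= dg u) -> `|f b - f a| <= g b - g a.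
Proof.
move=> ab hf hg hfg.
have mono (h dh : R -> R) : (forall u, a <= u <= b -> is_derive u (1 : R) h (dh u)) ->
    (forall u, a <= u <= b -> 0 <= dh u) -> h a <= h b.
  move=> hh dh0.
  have [||c] := @MVT_segment _ h dh _ _ ab.
  - by move=> u; rewrite in_itv /= => /andP[au ub]; apply: hh; rewrite !ltW.
  - apply: derivable_within_continuous => u; rewrite in_itv /= => /hh hu.
    exact: ex_derive.
  - rewrite in_itv /= => /dh0 c0 e; rewrite -subr_ge0 e mulr_ge0// subr_ge0.
    exact: ab.
rewrite ler_norml; apply/andP; split.
- suff : 0 <= g b + f b - (g a + f a) by lra.
  rewrite subr_ge0; apply: mono (fun u hu => is_deriveD (hg u hu) (hf u hu)) _.
  by move=> u /hfg; rewrite ler_norml => /andP[]; lra.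
- suff : 0 <= g b - f b - (g a - f a) by lra.
  rewrite subr_ge0; apply: mono (fun u hu => is_deriveB (hg u hu) (hf u hu)) _.
  by move=> u /hfg; rewrite ler_norml => /andP[]; lra.
Qed.

(* The sum of a constant over the 2 N^2 real coordinates is the price of applying
   the scalar mean value inequality coordinatewise. *)
Lemma mnorm_dist_derive N (F dF : R -> 'M[R[i]]_N) (g dg : R -> R) (a b : R) : a <= b ->
  (forall u, a <= u <= b -> is_mxderive u F (dF u)) ->
  (forall u, a <= u <= b -> is_derive u (1 : R) g (dg u)) ->
  (forall u, a <= u <= b -> mnorm (dF u) <= dg u) ->
  mnorm (F b - F a) <= \sum_(k : bool * 'I_N * 'I_N) (g b - g a).
Proof.
move=> ab hF hg hFg; rewrite mnormE; apply: ler_sum => k _; rewrite coB.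
apply: (ler_dist_derive (f := fun u => co k (F u)) (df := fun u => co k (dF u)) ab _ hg).
  by move=> u hu; exact: hF.
by move=> u hu; apply: le_trans (hFg u hu); exact: co_le_mnorm.
Qed.

End MeanValue.

(** * Decay of exp(s A) as s tends to minus infinity, from the spectrum of A *)

Section SpectralBound.
Context {R : realType} {N : nat}.
Local Notation MC := 'M[R[i]]_N.
Implicit Types (A X Y : MC) (s mu : R) (z : R[i]).

(** Euler's formula: both sides solve F' = i b F with value I at 0. *)
Lemma mexp_imaginary (b s : R) :
  mexp ((b *i) *: (1 : MC)) s =
  (cos (b * s))%:C *: (1 : MC) + (sin (b * s))%:C *: ('i%C *: (1 : MC)).
Proof.
have db u : is_derive u (1 : R) (fun v : R => b * v) b.
  by have := is_deriveZ b (is_derive_id u (1 : R)); rewrite /GRing.scale /= mulr1.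
have dc u : is_derive u (1 : R) (fun v : R => cos (b * v)) (- sin (b * u) * b).
  exact: (@is_derive1_comp _ cos (fun v => b * v)).
have ds u : is_derive u (1 : R) (fun v : R => sin (b * v)) (cos (b * u) * b).
  exact: (@is_derive1_comp _ sin (fun v => b * v)).
have d u : is_mxderive u (fun v => (cos (b * v))%:C *: (1 : MC) +
    (sin (b * v))%:C *: ('i%C *: (1 : MC)))
    (((b *i) *: (1 : MC)) * ((cos (b * u))%:C *: (1 : MC) +
    (sin (b * u))%:C *: ('i%C *: (1 : MC)))).
  apply: is_mxderive_eq (is_mxderiveD (is_mxderiveZ (dc u) (is_mxderive_cst u 1))
    (is_mxderiveZ (ds u) (is_mxderive_cst u ('i%C *: (1 : MC))))) _.
  rewrite !scaler0 !addr0 !scalerA -mxscaleAl mul1r scalerDr !scalerA addrC.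
  congr (_ *: _ + _ *: _); apply/eqP; rewrite eq_complex /=; apply/andP; split;
    apply/eqP; ring.
by rewrite (mexp_ode d) mulr0 cos0 sin0 scale1r scale0r addr0 mulr1.
Qed.

(** The imaginary part of z contributes only a bounded oscillation, so the rate is exactly Re z for
    s of either sign. *)
Lemma mexp_scalar_bound z : exists2 K, 0 <= K &
  forall s, mnorm (mexp (z *: (1 : MC)) s) <= K * expR (complex.Re z * s).
Proof.
exists (mnorm (1 : MC) + mnorm ('i%C *: (1 : MC))) => [|s].
  by rewrite addr_ge0 ?mnorm_ge0.
have -> : z *: (1 : MC) = ((complex.Im z) *i) *: (1 : MC) + (complex.Re z)%:C *: (1 : MC).
  rewrite -scalerDl; congr (_ *: _).
  by case: z => a b; apply/eqP; rewrite eq_complex ReD ImD /= add0r addr0 !eqxx.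
rewrite mexpD_scalar mexp_imaginary mnormZ mulrC ger0_norm ?expR_ge0//.
rewrite ler_wpM2r ?expR_ge0//; apply: le_trans (mnormD _ _) _; rewrite !mnormZ.
apply: lerD; rewrite -[leRHS]mul1r ler_wpM2r ?mnorm_ge0// ler_norml.
- by rewrite cos_geN1 cos_le1.
- by rewrite sin_geN1 sin_le1.
Qed.

(* Removes one factor of a polynomial annihilating A: the hypothesis bounds
   the derivative of exp(s (A - z)) Y, which is integrated from s to 0. *)
Lemma mexp_bound_step A Y z mu C : 0 <= C -> mu < complex.Re z ->
  (forall s, s <= 0 -> mnorm (mexp A s * ((A - z *: (1 : MC)) * Y)) <= C * expR (mu * s)) ->
  exists2 C', 0 <= C' &
    forall s, s <= 0 -> mnorm (mexp A s * Y) <= C' * expR (mu * s).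
Proof.
move=> C0 muz bF; set a := complex.Re z in muz *.
have [K1 K10 K1P] := mexp_scalar_bound z.
have [K2 K20 K2P] := mexp_scalar_bound (- z).
have am : 0 < a - mu by rewrite subr_gt0.
(* Chosen so that - c e^((mu - a) u) is a primitive of the bound K2 C e^((mu - a) u) on the
   derivative of [H]. *)
pose c := K2 * C / (a - mu).
have c0 : 0 <= c by rewrite divr_ge0 ?mulr_ge0// ltW.
pose H s := mexp (A - z *: (1 : MC)) s * Y.
have Hz s : H s = mexp (- z *: (1 : MC)) s * (mexp A s * Y).
  rewrite /H addrC -scaleNr mexpMD; first by rewrite mulrA.
  exact/commr_sym/comm_scalar1.
have GH s : mexp A s * Y = mexp (z *: (1 : MC)) s * H s.
  rewrite Hz mulrA -mexpMD; last exact: comm_scalar1.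
  rewrite -scalerDl subrr scale0r; have := mexp_cst (N := N) (0 : R) s.
  by rewrite scale0r mul0r expR0 scale1r => ->; rewrite mul1r.
have dH u : is_mxderive u H (mexp (- z *: (1 : MC)) u * (mexp A u * ((A - z *: (1 : MC)) * Y))).
  apply: is_mxderive_eq (is_mxderiveMr Y (mexp_derive (A - z *: (1 : MC)) u)) _.
  rewrite mexp_commM [in X in X * _ * _ = _]addrC -[in X in X * _ * _ = _]scaleNr.
  rewrite mexpMD; first by rewrite !mulrA.
  exact/commr_sym/comm_scalar1.
have bH s : s <= 0 ->
  mnorm (H 0 - H s) <= \sum_(k : bool * 'I_N * 'I_N) c * expR ((mu - a) * s).
  move=> s0; apply: le_trans (mnorm_dist_derive
     (g := fun u => - c * expR ((mu - a) * u))
     (dg := fun u => K2 * C * expR ((mu - a) * u)) s0 _ _ _) _.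
  - by move=> u _; exact: dH.
  - move=> u _.
    have de : is_derive u (1 : R) (fun v => expR ((mu - a) * v))
        (expR ((mu - a) * u) * (mu - a)).
      apply: (@is_derive1_comp _ expR (fun v => (mu - a) * v)).
      by have := is_deriveZ (mu - a) (is_derive_id u (1 : R));
        rewrite /GRing.scale /= mulr1.
    apply: (is_derive_eq (is_deriveZ (- c) de)); rewrite /GRing.scale /= /c.
    by field; rewrite gt_eqF.
  - move=> u /andP[_ u0]; apply: le_trans (mnormM _ _) _.
    have -> : (mu - a) * u = complex.Re (- z) * u + mu * u by rewrite ReN /a; ring.
    rewrite expRD mulrACA; apply: ler_pM; rewrite ?mnorm_ge0//; exact: bF.
  - apply: ler_sum => k _; rewrite mulr0 expR0; lra.
pose D := mnorm Y + \sum_(k : bool * 'I_N * 'I_N) c.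
have D0 : 0 <= D by rewrite addr_ge0 ?mnorm_ge0// sumr_ge0.
exists (K1 * D) => [|s s0]; first exact: mulr_ge0.
rewrite GH; apply: le_trans (mnormM _ _) _.
have -> : mu * s = complex.Re z * s + (mu - a) * s by rewrite /a; ring.
rewrite expRD mulrACA; apply: ler_pM; rewrite ?mnorm_ge0//.
have -> : H s = H 0 - (H 0 - H s) by rewrite opprB addrC subrK.
apply: le_trans (mnormB _ _) _; rewrite mulrDl; apply: lerD.
  (* For s <= 0 and mu < a the factor e^((mu - a) s) is at least 1, so it may be put on the constant
     [mnorm Y]. *)
  rewrite /H mexp0 mul1r -[leLHS]mulr1 ler_wpM2l ?mnorm_ge0//.
  by rewrite -expR0 ler_expR mulr_le0// subr_le0 ltW.
by apply: le_trans (bH s s0) _; rewrite mulr_suml.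
Qed.

(** The full product annihilates exp(s A), so the bound starts with constant 0; removing the factors
    one by one leaves exp(s A). Repeated roots do no harm because mu lies strictly below every real
    part. *)
Lemma mexp_bound_prod A mu (r : seq R[i]) : all (fun z => mu < complex.Re z) r ->
  \prod_(z <- r) (A - z *: (1 : MC)) = 0 ->
  exists2 C, 0 <= C & forall s, s <= 0 -> mnorm (mexp A s) <= C * expR (mu * s).
Proof.
move=> mur r0; suff [C C0 CP] : exists2 C, 0 <= C &
    forall s, s <= 0 -> mnorm (mexp A s * 1) <= C * expR (mu * s).
  by exists C => // s /CP; rewrite mulr1.
have [C C0] : exists2 C, 0 <= C & forall s, s <= 0 ->
    mnorm (mexp A s * \prod_(z <- r) (A - z *: (1 : MC))) <= C * expR (mu * s).
  by exists 0 => // s _; rewrite r0 mulr0 mnorm0 mul0r.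
elim: r mur {r0} C C0 => [|z r IH] /=; first by move=> _ C C0; rewrite big_nil; exists C.
move=> /andP[muz mur] C C0; rewrite big_cons => /(mexp_bound_step C0 muz)[C' C'0 h].
exact: (IH mur C').
Qed.

(** The cap mu <= 1 is there for later estimates, which use the concavity of u^mu and u^mu <= 1 +
    u. *)
Lemma all_gt_exists (r : seq R) : all (fun x => 0 < x) r ->
  exists2 mu, 0 < mu <= 1 & all (fun x => mu < x) r.
Proof.
elim: r => [|x r IH] /=; first by exists 1; rewrite // ltr01 lexx.
move=> /andP[x0 /IH[mu /andP[mu0 mu1] h]].
exists (Num.min mu (x / 2)); first by rewrite lt_min mu0 divr_gt0//= ge_min mu1.
rewrite gt_min; apply/andP; split; first by apply/orP; right; lra.
by apply: sub_all h => y; rewrite gt_min => ->.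
Qed.

End SpectralBound.

(** By Cayley-Hamilton the product of A - z over the roots z of the split characteristic polynomial
    is 0. In terms of powers, t^A = O(t^mu) as t tends to 0. *)
Lemma mexp_pos_spectrum {R : realType} {N : nat} (A : 'M[R[i]]_N) : pos_spectrum A ->
  exists mu C, [/\ 0 < mu <= 1, 0 <= C &
    forall s, s <= 0 -> mnorm (mexp A s) <= C * expR (mu * s)].
Proof.
case: N A => [|n] A hA.
  (* In size 0 every norm is an empty sum; Cayley-Hamilton is applied in positive size. *)
  exists 1, 0; split; rewrite ?ltr01 ?lexx// => s _.
  by rewrite /mnorm big_ord0 mul0r.
have [r rP] := closed_field_poly_normal (char_poly A).
rewrite (eqP (char_poly_monic A)) scale1r in rP.
have rpos : all (fun x => 0 < x) (map (@complex.Re R) r).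
  rewrite all_map; apply/allP => z zr /=; apply: hA.
  by rewrite eigenvalue_root_char rP root_prod_XsubC.
have [mu mu01 mur] := all_gt_exists rpos.
rewrite all_map in mur.
have [|C C0 CP] := mexp_bound_prod (A := A) mur; last by exists mu, C.
have := Cayley_Hamilton A; rewrite rP rmorph_prod /= => e.
rewrite -[RHS]e; apply: eq_bigr => z _.
by rewrite rmorphB /= horner_mx_X horner_mx_C scalemx1.
Qed.

(** If A + n were singular, -n would be an eigenvalue of A with nonpositive real part. *)
Lemma pos_spectrum_unit {R : realType} {N : nat} (A : 'M[R[i]]_N) (n : nat) :
  pos_spectrum A -> A + n%:R \in unitmx.
Proof.
move=> hA; apply: contraT => h; have := hA (- n%:R).
rewrite /eigenvalue /eigenspace kermx_eq0 row_free_unit.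
have -> : A - (- n%:R)%:M = A + n%:R.
  rewrite raddfN opprK; congr (_ + _); elim: n {h} => [|n IH]; first by rewrite raddf0.
  by rewrite -[in RHS]natr1 -IH -natr1 raddfD.
move=> /(_ h); rewrite ReN oppr_gt0 ltNge; case/negP.
by elim: n {h} => [//|n IH]; rewrite -natr1 ReD addr_ge0.
Qed.

(** * Integrals over the half-line *)

Section HalfLine.
Context {R : realType}.
Local Notation mu := (@lebesgue_measure R).
Local Notation D := (`]0, +oo[%classic : set R).
Implicit Types (f g F G : R -> R) (a b u K : R).

Lemma Rintegral_FTC F f a b : a <= b ->
  (forall u, a <= u <= b -> is_derive u (1 : R) F (f u)) ->
  (forall u, a <= u <= b -> {for u, continuous f}) ->
  \int[mu]_(u in `[a, b]) f u = F b - F a.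
Proof.
rewrite le_eqVlt => /predU1P[<-{b} _ _|ab dF cf].
  by rewrite set_itv1 Rintegral_set1 subrr.
have cF u : a <= u <= b -> {for u, continuous F}.
  move=> /dF hu; apply/differentiable_continuous/derivable1_diffP.
  exact: ex_derive.
have wf : {within `[a, b], continuous f}.
  apply: continuous_in_subspaceT => u; rewrite inE /= in_itv /= => /cf.
  exact.
rewrite /Rintegral (@continuous_FTC2 _ f F a b ab wf) //=.
- split=> /=.
  + move=> u; rewrite in_itv /= => /andP[au ub].
    by have hu := dF u; apply: ex_derive; apply: hu; rewrite !ltW.
  + by apply: cvg_at_right_filter; apply: cF; rewrite lexx ltW.
  + by apply: cvg_at_left_filter; apply: cF; rewrite lexx ltW.
- move=> u; rewrite in_itv /= => /andP[au ub]; rewrite derive1E.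
  have au_b : a <= u <= b by rewrite !ltW.
  by have hu := dF u au_b; exact: derive_val.
Qed.

(** Compact intervals exhausting the half-line while avoiding 0, where the integrands may be
    singular; the fundamental theorem is applied on each. *)
Definition expanding_itv (n : nat) : set R := `[n.+1%:R^-1, n.+1%:R]%classic.
Local Notation I := expanding_itv.

Lemma expanding_itv_le n : 0 < n.+1%:R^-1 :> R /\ n.+1%:R^-1 <= n.+1%:R :> R.
Proof.
rewrite invr_gt0 ltr0n; split=> //; apply: (@le_trans _ _ 1); last by rewrite ler1n.
by rewrite invf_le1// ler1n.
Qed.

Lemma expanding_itv_sub n : I n `<=` D.
Proof.
move=> u; rewrite /I /= !in_itv /= andbT => /andP[nu _].
by apply: lt_le_trans nu; case: (expanding_itv_le n).
Qed.

Lemma nondecreasing_expanding_itv : nondecreasing_seq I.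
Proof.
apply/nondecreasing_seqP => n; apply/subsetPset => u; rewrite /I /= !in_itv /=.
move=> /andP[nu un]; apply/andP; split.
  by apply: le_trans nu; rewrite lef_pV2 ?posrE// ler_nat.
by apply: le_trans un _; rewrite ler_nat.
Qed.

Lemma bigcup_expanding_itv : \bigcup_n I n = D.
Proof.
apply/seteqP; split=> [u [n _ /expanding_itv_sub//]|u].
rewrite /= in_itv /= andbT => u0.
pose n := Num.Def.archi_bound (u + u^-1).
have un : u + u^-1 < n%:R by apply: archi_boundP; rewrite addr_ge0 ?invr_ge0 ?ltW.
have iu : 0 < u^-1 by rewrite invr_gt0.
have nn : n%:R <= n.+1%:R :> R by rewrite ler_nat.
exists n => //; rewrite /I /= in_itv /=; apply/andP; split; last by lra.
by rewrite -[leRHS]invrK lef_pV2 ?posrE//; lra.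
Qed.

Lemma measurable_pos_continuous f : (forall u, 0 < u -> {for u, continuous f}) ->
  measurable_fun D f.
Proof.
move=> cf; apply: open_continuous_measurable_fun => // u.
by rewrite inE /= in_itv /= andbT; exact: cf.
Qed.

(** Monotone convergence: bounded increments of a primitive bound the integrals over all the compact
    intervals at once. *)
Lemma ge0_integrable_pos g G K :
  (forall u, 0 < u -> {for u, continuous g}) ->
  (forall u, 0 < u -> 0 <= g u) ->
  (forall u, 0 < u -> is_derive u (1 : R) G (g u)) ->
  (forall a b, 0 < a -> a <= b -> G b - G a <= K) ->
  mu.-integrable D (EFin \o g).
Proof.
move=> cg g0 dG GK; have mg := measurable_pos_continuous cg.
apply/integrableP; split; first exact/measurable_EFinP.
have -> : (\int[mu]_(x in D) `|(EFin \o g) x| = \int[mu]_(x in D) (g x)%:E)%E.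
  apply: eq_integral => u; rewrite inE /= in_itv /= andbT => u0.
  by rewrite ger0_norm// g0.
have h n : (\int[mu]_(x in I n) (g x)%:E <= K%:E)%E.
  have [n0 nn] := expanding_itv_le n.
  have hI : mu.-integrable (I n) (EFin \o g).
    apply: continuous_compact_integrable; first exact: segment_compact.
    apply: continuous_in_subspaceT => u; rewrite inE => /expanding_itv_sub /=.
    by rewrite in_itv /= andbT => /cg; exact.
  rewrite -[leLHS]fineK; last first.
    by have := integrable_fin_num _ hI; apply; exact: measurable_itv.
  have dI u : n.+1%:R^-1 <= u <= n.+1%:R -> is_derive u (1 : R) G (g u).
    by move=> /andP[nu _]; apply: dG; exact: lt_le_trans nu.
  have cI u : n.+1%:R^-1 <= u <= n.+1%:R -> {for u, continuous g}.
    by move=> /andP[nu _]; apply: cg; exact: lt_le_trans nu.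
  by rewrite lee_fin -/(Rintegral mu (I n) g) (Rintegral_FTC nn dI cI); exact: GK.
apply: (@le_lt_trans _ _ K%:E); last exact: ltry.
rewrite -bigcup_expanding_itv.
apply: (@cvge_le nat \oo _ R (fun n => \int[mu]_(x in I n) (g x)%:E)%E); first exact: nearW.
apply: ge0_nondecreasing_set_cvg_integral => //.
- exact: nondecreasing_expanding_itv.
- by move=> n; exact: measurable_itv.
- move=> n; apply/measurable_EFinP; apply: measurable_funS mg => //.
  exact: expanding_itv_sub.
- move=> n u /expanding_itv_sub /=; rewrite in_itv /= andbT lee_fin.
  exact: g0.
Qed.

Lemma le_integrable_pos f g :
  (forall u, 0 < u -> {for u, continuous f}) ->
  (forall u, 0 < u -> `|f u| <= g u) ->
  mu.-integrable D (EFin \o g) -> mu.-integrable D (EFin \o f).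
Proof.
move=> cf fg; apply: le_integrable => //.
  by apply/measurable_EFinP; exact: (measurable_pos_continuous cf).
move=> u /=; rewrite in_itv /= andbT => u0; rewrite lee_fin.
exact: le_trans (fg u u0) (ler_norm _).
Qed.

Lemma cvg_Rintegral_expanding f : mu.-integrable D (EFin \o f) ->
  \int[mu]_(u in I n) f u @[n --> \oo] --> \int[mu]_(u in D) f u.
Proof.
move=> fi; have mf := measurable_int _ fi.
rewrite /Rintegral; apply: fine_cvg; rewrite fineK; last exact: integrable_fin_num.
have h : (fun n => \int[mu]_(x in D) ((EFin \o f) \_ (I n)) x)%E @ \oo -->
    (\int[mu]_(x in D) (EFin \o f) x)%E.
  apply: (@dominated_cvg _ _ _ mu D _ (fun n => (EFin \o f) \_ (I n)) (EFin \o f)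
    (abse \o (EFin \o f))) => //.
  - move=> n; apply/(measurable_restrict (EFin \o f)).
    + exact: measurable_itv.
    + exact: measurable_itv.
    + by apply: measurable_funS mf => //; exact: subIsetl.
  - move=> u; rewrite -bigcup_expanding_itv => -[m _ um].
    apply: cvg_near_cst; near=> n; rewrite patchE ifT// inE.
    have /(_ m n) := nondecreasing_expanding_itv.
    have mn : (m <= n)%N by near: n; exact: nbhs_infty_ge.
    by move=> /(_ mn)/subsetPset; exact.
  - exact: integrable_abse.
  - move=> n u Du; rewrite patchE; case: ifPn => //= _; rewrite ?normr0 lee_fin//.
apply: cvg_trans h; apply: near_eq_cvg; apply: nearW => n.
by rewrite -integral_mkcondr setIidr//; exact: expanding_itv_sub.
Unshelve. all: by end_near. Qed.

Lemma Rintegral_pos_FTC F f l0 loo :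
  (forall u, 0 < u -> is_derive u (1 : R) F (f u)) ->
  (forall u, 0 < u -> {for u, continuous f}) ->
  mu.-integrable D (EFin \o f) ->
  F u @[u --> 0^'+] --> l0 -> F u @[u --> +oo] --> loo ->
  \int[mu]_(u in D) f u = loo - l0.
Proof.
move=> dF cf fi F0 Foo; have := cvg_Rintegral_expanding fi.
have e n : \int[mu]_(u in I n) f u = F n.+1%:R - F n.+1%:R^-1.
  have [n0 nn] := expanding_itv_le n.
  apply: Rintegral_FTC => // u /andP[nu _]; [apply: dF|apply: cf];
    exact: lt_le_trans nu.
under eq_fun do rewrite e.
move/cvg_lim => <-//; apply: cvg_lim => //; apply: cvgB.
- move/cvg_pinftyP : Foo; apply; rewrite (cvg_shiftS (fun n => n%:R : R)).
  exact: cvgr_idn.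
- move/cvg_at_rightP : F0; apply; split; last exact: cvg_harmonic.
  by move=> n; case: (expanding_itv_le n).
Qed.

End HalfLine.

(** * Integrals of u^k e^-u and integrability of u^(m-1) e^-u *)

Section FactorialIntegral.
Context {R : realType}.
Local Notation mu := (@lebesgue_measure R).
Local Notation D := (`]0, +oo[%classic : set R).
Implicit Types (u m : R).

Lemma is_derive_continuous (f : R -> R) (u d : R) :
  is_derive u (1 : R) f d -> {for u, continuous f}.
Proof.
by move=> hu; apply/differentiable_continuous/derivable1_diffP; exact: ex_derive.
Qed.

Lemma is_derive_expRN u : is_derive u (1 : R) (fun v => expR (- v)) (- expR (- u)).
Proof.
rewrite -mulrN1; exact: (@is_derive1_comp _ expR (fun v => - v)).
Qed.

Lemma is_derive_expR_ln m u : 0 < u ->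
  is_derive u (1 : R) (fun v => expR (m * ln v)) (expR (m * ln u) * (m / u)).
Proof.
move=> u0; apply: (@is_derive1_comp _ expR (fun v => m * ln v)).
exact: (is_deriveZ m (is_derive1_ln u0)).
Qed.

Lemma is_derive_pow k u : is_derive u (1 : R) (fun v => v ^+ k.+1) (k.+1%:R * u ^+ k).
Proof.
elim: k => [|k IH].
  by rewrite expr0 mulr1; exact: is_derive_id.
rewrite (_ : (fun v => _) = (@id R) * (fun v => v ^+ k.+1)); last first.
  by apply/funext => v; rewrite exprS.
apply: (is_derive_eq (is_deriveM (is_derive_id u (1 : R)) IH)).
rewrite /GRing.scale /= [in RHS]exprS -natr1 exprS; ring.
Qed.

Lemma expR_ge_pow u k : 0 <= u -> u ^+ k / k`!%:R <= expR u.
Proof.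
move=> u0; apply: le_trans (series_exp_le k.+1 u0); rewrite big_ord_recr /=.
by rewrite lerDr sumr_ge0// => i _; rewrite divr_ge0// exprn_ge0.
Qed.

Lemma cvg_pow_expRN k : u ^+ k * expR (- u) @[u --> +oo] --> (0 : R).
Proof.
apply/cvgrPdist_lt => e e0; near=> u.
have u0 : 0 < u by near: u; exact: nbhs_pinfty_gt.
(* From e^u >= u^(k+1) / (k+1)! one gets u^k e^-u <= (k+1)! / u. *)
have ue : k.+1`!%:R / e < u by near: u; apply: nbhs_pinfty_gt; exact: num_real.
rewrite sub0r normrN ger0_norm; last by rewrite mulr_ge0 ?expR_ge0// exprn_ge0// ltW.
rewrite expRN ltr_pdivrMr ?expR_gt0//.
have := expR_ge_pow k.+1 (ltW u0); rewrite ler_pdivrMr ?ltr0n ?fact_gt0// => h.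
move: ue; rewrite ltr_pdivrMr// => ue.
have f0 : 0 < k.+1`!%:R :> R by rewrite ltr0n fact_gt0.
rewrite -(ltr_pM2r f0); apply: (@lt_le_trans _ _ (u ^+ k * (u * e))).
  by rewrite ltr_pM2l// exprn_gt0.
rewrite mulrA -exprSr mulrC -mulrA ler_wpM2l// ltW//.
Unshelve. all: by end_near. Qed.

(** Repeated integration by parts: this is - e^-u times the sum of k!/j! u^j over j <= k. *)
Fixpoint antideriv (k : nat) (u : R) : R :=
  if k is k'.+1 then k%:R * antideriv k' u - u ^+ k * expR (- u) else - expR (- u).

Lemma is_derive_antideriv k u : is_derive u (1 : R) (antideriv k) (u ^+ k * expR (- u)).
Proof.
elim: k => [|k IH] /=.
  rewrite expr0 mul1r -[X in is_derive _ _ _ X]opprK.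
  exact: is_deriveN (is_derive_expRN u).
apply: (is_derive_eq (is_deriveB (is_deriveZ k.+1%:R IH)
   (is_deriveM (is_derive_pow k u) (is_derive_expRN u)))).
rewrite /GRing.scale /= exprS; ring.
Qed.

Lemma antideriv0 k : antideriv k 0 = - k`!%:R.
Proof.
elim: k => [|k IH] /=; first by rewrite oppr0 expR0.
by rewrite IH expr0n mul0r subr0 mulrN -natrM factS.
Qed.

Lemma antideriv_le0 k u : 0 <= u -> antideriv k u <= 0.
Proof.
move=> u0; elim: k => [|k IH] /=; first by rewrite oppr_le0 expR_ge0.
by rewrite subr_le0 (@le_trans _ _ 0)// ?mulr_ge0_le0// mulr_ge0 ?expR_ge0 ?exprn_ge0.
Qed.

Lemma antideriv_ge k u : 0 <= u -> - k`!%:R <= antideriv k u.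
Proof.
move=> u0; rewrite -antideriv0 -subr_ge0.
apply: (le_trans (normr_ge0 (antideriv k u - antideriv k 0))).
apply: (@ler_dist_derive _ _ (fun v => v ^+ k * expR (- v)) _
  (fun v => v ^+ k * expR (- v))) => //.
- by move=> v _; exact: is_derive_antideriv.
- by move=> v _; exact: is_derive_antideriv.
- by move=> v /andP[v0 _]; rewrite ger0_norm// mulr_ge0 ?expR_ge0 ?exprn_ge0.
Qed.

Lemma continuous_pow_expRN k u : {for u, continuous (fun v : R => v ^+ k * expR (- v))}.
Proof.
case: k => [|k].
  rewrite (_ : (fun v => _) = (fun v => expR (- v))); last first.
    by apply/funext => v; rewrite expr0 mul1r.
  exact: is_derive_continuous (is_derive_expRN u).
exact: is_derive_continuous (is_deriveM (is_derive_pow k u) (is_derive_expRN u)).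
Qed.

Lemma integrable_pow_expRN k :
  mu.-integrable D (EFin \o (fun u => u ^+ k * expR (- u))).
Proof.
apply: (@ge0_integrable_pos _ _ (antideriv k) k`!%:R).
- by move=> u _; exact: continuous_pow_expRN.
- by move=> u u0; rewrite mulr_ge0 ?expR_ge0// exprn_ge0// ltW.
- by move=> u _; exact: is_derive_antideriv.
- move=> a b a0 ab.
  have := antideriv_ge k (ltW a0); have := antideriv_le0 k (ltW (lt_le_trans a0 ab)).
  lra.
Qed.

Lemma Rintegral_pow_expRN k : \int[mu]_(u in D) (u ^+ k * expR (- u)) = k`!%:R.
Proof.
have F0 : antideriv k u @[u --> 0^'+] --> (- k`!%:R : R).
  rewrite -antideriv0; apply: cvg_at_right_filter.
  exact: is_derive_continuous (is_derive_antideriv k 0).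
have Foo : antideriv k u @[u --> +oo] --> (0 : R).
  elim: k {F0} => [|k IH] /=.
    rewrite -oppr0; apply: cvgN.
    by have := cvg_pow_expRN 0; under eq_fun do rewrite expr0 mul1r.
  have := cvgB (cvgM (cvg_cst (k.+1%:R : R)) IH) (cvg_pow_expRN k.+1).
  by rewrite mulr0 subr0; apply.
have := Rintegral_pos_FTC (fun u _ => is_derive_antideriv k u)
  (fun u _ => @continuous_pow_expRN k u) (integrable_pow_expRN k) F0 Foo.
by rewrite sub0r opprK.
Qed.

Lemma expR_ln_le1D m u : 0 < u -> 0 <= m <= 1 -> expR (m * ln u) <= 1 + u.
Proof.
move=> u0 /andP[m0 m1]; have [u1|u1] := leP u 1.
  apply: (@le_trans _ _ 1); last by rewrite lerDl ltW.
  by rewrite -expR0 ler_expR mulr_ge0_le0// ln_le0.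
apply: (@le_trans _ _ u); last by rewrite lerDr.
rewrite -[leRHS](lnK (u0 : u \in Num.pos)) ler_expR ler_piMl// ln_ge0// ltW//.
Qed.

(** [g] adds to u^(m-1) e^-u the term m^-1 (1 + u - u^m) e^-u, nonnegative as u^m <= 1 + u. The sum
    has the elementary primitive [G]: u^m e^-u / m accounts for the powers u^(m-1) and u^m, and - (2
    + u) e^-u is a primitive of (1 + u) e^-u. *)
Lemma integrable_expR_ln m : 0 < m <= 1 ->
  mu.-integrable D (EFin \o (fun u => expR (m * ln u) / u * expR (- u))).
Proof.
move=> /andP[m0 m1]; have nm : m != 0 by rewrite gt_eqF.
pose f u := expR (m * ln u) / u * expR (- u).
pose g u := f u + m^-1 * ((1 + u) * expR (- u) - expR (m * ln u) * expR (- u)).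
pose G u := m^-1 * (expR (m * ln u) * expR (- u) - (2 + u) * expR (- u)).
have cln u : 0 < u -> {for u, continuous (fun v => expR (m * ln v))}.
  by move=> u0; exact: is_derive_continuous (is_derive_expR_ln m u0).
have cexp u : {for u, continuous (fun v : R => expR (- v))}.
  exact: is_derive_continuous (is_derive_expRN u).
have cf u : 0 < u -> {for u, continuous f}.
  move=> u0; apply: continuousM (cexp u); apply: continuousM (cln u u0) _.
  by apply: continuousV; [rewrite gt_eqF|exact: cvg_id].
have fg u : 0 < u -> `|f u| <= g u.
  move=> u0; rewrite ger0_norm; last by rewrite mulr_ge0 ?expR_ge0// divr_ge0 ?expR_ge0// ltW.
  rewrite /g lerDl mulr_ge0 ?invr_ge0 ?(ltW m0)// -mulrBl mulr_ge0 ?expR_ge0//.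
  by rewrite subr_ge0 expR_ln_le1D// m1 ltW.
apply: (le_integrable_pos cf fg).
(* The 3 is 1 + 2, from b^m e^-b <= (1 + b) e^-b <= 1 and (2 + a) e^-a <= 2. *)
apply: (@ge0_integrable_pos _ g G (m^-1 * 3)).
- move=> u u0; apply: continuousD; first exact: cf.
  apply: continuousM; first exact: cst_continuous.
  apply: continuousB; last by apply: continuousM (cexp u); exact: cln.
  by apply: continuousM (cexp u); apply: continuousD; [exact: cst_continuous|exact: cvg_id].
- by move=> u /fg; apply: le_trans.
- move=> u u0; have du := is_deriveD (is_derive_cst (2 : R) u (1 : R)) (is_derive_id u (1 : R)).
  apply: (is_derive_eq (is_deriveZ m^-1 (is_deriveB
    (is_deriveM (is_derive_expR_ln m u0) (is_derive_expRN u))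
    (is_deriveM du (is_derive_expRN u))))).
  rewrite /GRing.scale /= /g /f fctE /cst; field.
  by rewrite nm gt_eqF.
- move=> a b a0 ab; have b0 := lt_le_trans a0 ab.
  rewrite /G -mulrBr ler_wpM2l ?invr_ge0 ?(ltW m0)//.
  have e1 (v : R) : (1 + v) * expR (- v) <= 1.
    by rewrite expRN ler_pdivrMr ?expR_gt0// mul1r expR_ge1Dx.
  have hb : expR (m * ln b) * expR (- b) <= 1.
    by apply: le_trans (e1 b); rewrite ler_wpM2r ?expR_ge0// expR_ln_le1D// m1 ltW.
  have ha := e1 a; have ea := expR_ge0 (- a); have eb := expR_ge0 (- b).
  have p1 : 0 <= expR (m * ln a) * expR (- a) by rewrite mulr_ge0 ?expR_ge0.
  have p2 : 0 <= (2 + b) * expR (- b) by rewrite mulr_ge0// addr_ge0// ltW.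
  have p3 : 0 <= a * expR (- a) by rewrite mulr_ge0// ltW.
  nra.
Qed.

End FactorialIntegral.

(** * Powers t^M, written [mexp M (ln t)], for t > 0 *)

Section MatrixPower.
Context {R : realType} {N : nat}.
Local Notation MC := 'M[R[i]]_N.
Implicit Types (A B M X : MC) (t u : R).

Lemma mxpowE t M : mxpow t M = mexp M (ln t).
Proof. by rewrite mexp.unlock. Qed.

Lemma natr_mx n : (n%:R : MC) = (n%:R)%:C *: (1 : MC).
Proof.
elim: n => [|n IH]; first by rewrite scale0r.
by rewrite -natr1 IH -natr1 rmorphD /= scalerDl scale1r.
Qed.

Lemma mexp_lnM M t u : 0 < t -> 0 < u ->
  mexp M (ln (t * u)) = mexp M (ln t) * mexp M (ln u).
Proof. by move=> t0 u0; rewrite lnM ?posrE// mexpD. Qed.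

Lemma mexp_lnDn M n t : 0 < t ->
  mexp (M + n%:R) (ln t) = (t ^+ n)%:C *: mexp M (ln t).
Proof.
by move=> t0; rewrite natr_mx mexpD_scalar expRM_natl lnK.
Qed.

Lemma mexp_lnB1 M t : 0 < t -> mexp (M - 1) (ln t) = t^-1%:C *: mexp M (ln t).
Proof.
move=> t0; have {2}-> : M = M - 1 + 1%:R by rewrite subrK.
by rewrite mexp_lnDn// expr1 scalerA -rmorphM /= mulVf ?gt_eqF// scale1r.
Qed.

Lemma is_mxderive_mexp_ln M t : 0 < t ->
  is_mxderive t (fun u => mexp M (ln u)) (M * mexp (M - 1) (ln t)).
Proof.
move=> t0; apply: is_mxderive_eq (is_mxderive_comp (F := mexp M) (g := @ln R)
  (is_derive1_ln t0) (mexp_derive M (ln t))) _.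
by rewrite mexp_lnB1// mxscaleAr.
Qed.

Lemma mexp_ln_le1 M : pos_spectrum M -> exists mu C, [/\ 0 < mu <= 1, 0 <= C &
  forall t, 0 < t <= 1 -> mnorm (mexp M (ln t)) <= C * expR (mu * ln t)].
Proof.
move=> /mexp_pos_spectrum[mu [C [mu01 C0 h]]]; exists mu, C; split=> // t /andP[t0 t1].
exact/h/ln_le0.
Qed.

(** The spectral bound serves for t <= 1 and the crude bound by the norm of M for t > 1. The
    exponent is [nu.+1] so that t^(M - I) still has a natural power of t in its bound. *)
Lemma mexp_ln_bound M : pos_spectrum M -> exists mu nu C, [/\ 0 < mu <= 1, 0 <= C &
  forall t, 0 < t -> mnorm (mexp M (ln t)) <= C * (expR (mu * ln t) + t ^+ nu.+1)].
Proof.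
move=> /mexp_ln_le1[mu [C [mu01 C0 h]]].
pose nu := Num.Def.archi_bound (mnorm M).
have hnu : mnorm M < nu.+1%:R.
  apply: (@lt_le_trans _ _ nu%:R); first exact/archi_boundP/mnorm_ge0.
  by rewrite ler_nat.
have N0 : 0 <= mnorm (1 : MC) by exact: mnorm_ge0.
exists mu, nu, (C + mnorm (1 : MC)); split=> // [|t t0]; first exact: addr_ge0.
have e0 := expR_ge0 (mu * ln t); have tn : 0 <= t ^+ nu.+1 by rewrite exprn_ge0// ltW.
have [t1|t1] := leP t 1.
  apply: le_trans (h t _) _; first by rewrite t0.
  by apply: ler_pM; rewrite ?lerDl ?expR_ge0.
have lt0 : 0 <= ln t by rewrite ln_ge0// ltW.
apply: (@le_trans _ _ (mnorm (1 : MC) * t ^+ nu.+1)); last first.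
  by apply: ler_pM; rewrite ?lerDr.
apply: le_trans (mexp_norm M (ln t)) _; rewrite ler_wpM2l//.
rewrite -[leRHS](lnK (exprn_gt0 nu.+1 t0 : _ \in Num.pos)) ler_expR lnXn//.
by rewrite ger0_norm// -mulr_natr ler_wpM2l// ltW.
Qed.

Lemma pos_spectrumDn M n : pos_spectrum M -> pos_spectrum (M + n%:R).
Proof.
move=> hM a; rewrite /eigenvalue /eigenspace.
have -> : M + n%:R - a%:M = M - (a - n%:R)%:M.
  rewrite raddfB opprB /= addrA addrAC natr_mx rmorph_nat scalemx1.
  by rewrite [M + _]addrC [RHS]addrAC [_%:M + M]addrC.
move=> /hM; rewrite ReD ReN => /lt_le_trans; apply.
rewrite gerBl; elim: n => [//|n IH]; by rewrite -natr1 ReD addr_ge0.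
Qed.

End MatrixPower.

(** * Matrix integrals over the half-line *)

Section MatrixIntegral.
Context {R : realType} {N : nat}.
Local Notation mu := (@lebesgue_measure R).
Local Notation D := (`]0, +oo[%classic : set R).
Local Notation MC := 'M[R[i]]_N.
Implicit Types (f g : R -> R) (F G : R -> MC) (V W X : MC) (v w : R).

(** Integrability travels with the value, since additivity and monotonicity of the integral are
    conditional on it. *)
Definition is_Rint f v := mu.-integrable D (EFin \o f) /\ \int[mu]_(u in D) f u = v.

Definition is_mxint F V := forall k, is_Rint (fun u => co k (F u)) (co k V).

Lemma is_RintD f g v w : is_Rint f v -> is_Rint g w ->
  is_Rint (fun u => f u + g u) (v + w).
Proof.
move=> [fi <-] [gi <-]; split; last by rewrite RintegralD.
have h := integrableD _ fi gi; have {}h := h (measurable_itv _).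
by apply: eq_integrable h => // u _ /=; rewrite EFinD.
Qed.

Lemma is_RintZ a f v : is_Rint f v -> is_Rint (fun u => a * f u) (a * v).
Proof.
move=> [fi <-]; split; last by rewrite RintegralZl.
have h := integrableZl _ a fi; have {}h := h (measurable_itv _).
by apply: eq_integrable h => // u _ /=; rewrite EFinM.
Qed.

Lemma is_Rint0 : is_Rint (fun=> 0) 0.
Proof.
split; first exact: integrable0.
by rewrite /Rintegral integral0.
Qed.

Lemma is_Rint_sum (I : Type) (s : seq I) (f : I -> R -> R) (v : I -> R) :
  (forall i, is_Rint (f i) (v i)) ->
  is_Rint (fun u => \sum_(i <- s) f i u) (\sum_(i <- s) v i).
Proof.
move=> fv; elim: s => [|i s IH].
  rewrite big_nil (_ : (fun u => _) = (fun=> 0)); first exact: is_Rint0.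
  by apply/funext => u; rewrite big_nil.
rewrite big_cons (_ : (fun u => _) = (fun u => f i u + \sum_(j <- s) f j u)).
  exact: is_RintD.
by apply/funext => u; rewrite big_cons.
Qed.

Lemma eq_is_Rint f g v : (forall u, 0 < u -> f u = g u) -> is_Rint f v -> is_Rint g v.
Proof.
move=> fg [fi <-]; split.
  apply: eq_integrable fi => // u; rewrite inE /= in_itv /= andbT => /fg ->.
  by [].
by apply: eq_Rintegral => u; rewrite inE /= in_itv /= andbT => /fg.
Qed.

Lemma eq_is_mxint F G V : (forall u, 0 < u -> F u = G u) -> is_mxint F V -> is_mxint G V.
Proof. by move=> FG h k; apply: eq_is_Rint (h k) => u /FG ->. Qed.

Lemma is_mxintE F V : is_mxint F V -> mx_Rintegral D F = V.
Proof.
move=> h; apply: co_inj => k; have [_ <-] := h k.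
by case: k => [[[] i] j]; rewrite /co mxE.
Qed.

Lemma mxint_integrable F : (forall k, mu.-integrable D (EFin \o (fun u => co k (F u)))) ->
  is_mxint F (mx_Rintegral D F).
Proof.
move=> h k; split; first exact: h.
by case: k => [[[] i] j]; rewrite /co mxE.
Qed.

Lemma is_mxint_unique F V W : is_mxint F V -> is_mxint F W -> V = W.
Proof. by move=> /is_mxintE <- /is_mxintE <-. Qed.

Lemma is_mxintD F G V W : is_mxint F V -> is_mxint G W ->
  is_mxint (fun u => F u + G u) (V + W).
Proof.
move=> FV GW k; rewrite coD; apply: eq_is_Rint (is_RintD (FV k) (GW k)) => u _.
by rewrite coD.
Qed.

Lemma is_mxintZ a F V : is_mxint F V -> is_mxint (fun u => a%:C *: F u) (a%:C *: V).
Proof.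
move=> FV k; rewrite coZ; apply: eq_is_Rint (is_RintZ a (FV k)) => u _.
by rewrite coZ.
Qed.

Lemma is_mxintMl X F V : is_mxint F V -> is_mxint (fun u => X * F u) (X * V).
Proof.
move=> FV k; rewrite coM; apply: eq_is_Rint (is_Rint_sum _ (fun l =>
  is_RintD (is_RintZ (co (true, k.1.2, l) X) (FV (k.1.1, l, k.2)))
   (is_RintZ ((-1) ^+ k.1.1) (is_RintZ (co (false, k.1.2, l) X) (FV (~~ k.1.1, l, k.2)))))).
by move=> u _; rewrite coM.
Qed.

Lemma is_mxintMr X F V : is_mxint F V -> is_mxint (fun u => F u * X) (V * X).
Proof.
move=> FV k; rewrite coM; apply: eq_is_Rint; last first.
  apply: is_Rint_sum => l; apply: is_RintD.
    rewrite mulrC; exact: (is_RintZ (co (k.1.1, l, k.2) X) (FV (true, k.1.2, l))).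
  rewrite mulrA mulrC.
  exact: (is_RintZ (co (~~ k.1.1, l, k.2) X) (is_RintZ ((-1) ^+ k.1.1) (FV (false, k.1.2, l)))).
by move=> u _ /=; rewrite coM; apply: eq_bigr => l _; ring.
Qed.

Lemma is_mxint_scalar f v X : is_Rint f v -> is_mxint (fun u => (f u)%:C *: X) (v%:C *: X).
Proof.
move=> fv k; rewrite coZ mulrC; apply: eq_is_Rint (is_RintZ (co k X) fv) => u _.
by rewrite coZ mulrC.
Qed.

Lemma is_mxint_norm F V g v : is_mxint F V -> is_Rint g v ->
  (forall u, 0 < u -> mnorm (F u) <= g u) ->
  mnorm V <= \sum_(k : bool * 'I_N * 'I_N) v.
Proof.
move=> FV [gi <-] Fg; rewrite mnormE; apply: ler_sum => k _; have [fi <-] := FV k.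
apply: le_trans (le_normr_Rintegral _ fi) _; first exact: measurable_itv.
apply: le_Rintegral; [exact: measurable_itv|exact: integrable_norm|exact: gi|].
move=> u /=; rewrite in_itv /= andbT => /Fg; apply: le_trans; exact: co_le_mnorm.
Qed.

(** The derivative serves to make F continuous on the half-line, hence measurable. *)
Lemma is_mxint_dominated F (dF : R -> MC) g v :
  (forall u, 0 < u -> is_mxderive u F (dF u)) -> is_Rint g v ->
  (forall u, 0 < u -> mnorm (F u) <= g u) -> is_mxint F (mx_Rintegral D F).
Proof.
move=> hF [gi _] Fg; apply: mxint_integrable => k.
apply: (le_integrable_pos _ _ gi) => u u0.
  exact: is_derive_continuous (hF u u0 k).
by apply: le_trans (Fg u u0); exact: co_le_mnorm.
Qed.

Lemma is_mxint_FTC F (dF H : R -> MC) V (L0 Loo : MC) : is_mxint F V ->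
  (forall u, 0 < u -> is_mxderive u F (dF u)) ->
  (forall u, 0 < u -> is_mxderive u H (F u)) ->
  H u @[u --> 0^'+] --> L0 -> H u @[u --> +oo] --> Loo -> V = Loo - L0.
Proof.
move=> FV hF hH /cvg_coP H0 /cvg_coP Hoo; apply: co_inj => k.
have [fi <-] := FV k; rewrite coB.
exact: (Rintegral_pos_FTC (F := fun u => co k (H u)) (fun u u0 => hH u u0 k)
  (fun u u0 => is_derive_continuous (hF u u0 k)) fi (H0 k) (Hoo k)).
Qed.

End MatrixIntegral.

Lemma eq_cvg_to {T : Type} {U : topologicalType} {F : set_system T} (f g : T -> U)
  (l : U) : f =1 g -> f @ F --> l -> g @ F --> l.
Proof. by move=> /funext ->. Qed.

Lemma cvg_to_shiftn {U : ptopologicalType} (a : nat) (u : nat -> U) (l : U) :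
  u (n + a)%N @[n --> \oo] --> l -> u @ \oo --> l.
Proof. by move=> h; rewrite -(cvg_shiftn a). Qed.

Lemma cvg_to_succ {U : ptopologicalType} (u : nat -> U) (l : U) :
  u @ \oo --> l -> u n.+1 @[n --> \oo] --> l.
Proof. by move=> h; rewrite (cvg_shiftS u). Qed.

Lemma cvg_of_succ {U : ptopologicalType} (u : nat -> U) (l : U) :
  u n.+1 @[n --> \oo] --> l -> u @ \oo --> l.
Proof. by move=> h; rewrite -(cvg_shiftS u). Qed.

(** * The matrix gamma function *)

Section FactorialRatios.
Context {R : realType}.

Lemma cvg_succ_ratio (a b : nat) :
  ((m + a)%:R / (m + b.+1)%:R : R) @[m --> \oo] --> (1 : R).
Proof.
have h : (fun m : nat => 1 + (a%:R - b.+1%:R) * ((m + b.+1)%:R : R)^-1) @ \oo --> (1 : R).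
  rewrite -[X in _ --> X]addr0 -[X in _ --> _ + X](mulr0 (a%:R - b.+1%:R)).
  apply: cvgD; first exact: cvg_cst.
  apply: cvgM; first exact: cvg_cst.
  have := cvg_harmonic (R := R); rewrite -(cvg_shiftn b) /harmonic /=.
  by under eq_fun do rewrite -addnS.
apply: eq_cvg_to h => m.
have nz : (m + b.+1)%:R != 0 :> R by rewrite pnatr_eq0 addnS.
by rewrite mulrBl [in LHS]addrC addrAC; move: nz; rewrite !natrD => nz; field.
Qed.

Lemma cvg_fact_ratio a :
  ((m + a)`!%:R / (m`!%:R * m.+1%:R ^+ a) : R) @[m --> \oo] --> (1 : R).
Proof.
elim: a => [|a IH].
  under eq_fun do rewrite addn0 expr0 mulr1 divff ?pnatr_eq0 -?lt0n ?fact_gt0//.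
  exact: cvg_cst.
have := cvgM IH (cvg_succ_ratio a.+1 0); rewrite mulr1 => h; apply: eq_cvg_to (h _) => m /=.
have n1 : m`!%:R != 0 :> R by rewrite pnatr_eq0 -lt0n fact_gt0.
have n2 : m.+1%:R != 0 :> R by [].
have n3 : m.+1%:R ^+ a != 0 :> R by rewrite expf_neq0.
rewrite addn1 addnS factS natrM exprSr; field.
by rewrite n1 n3 nat1r n2.
Qed.

(** After the shift of m by a the subtraction is no longer truncated, and the expression is the
    inverse of the previous ratio times ((m + a + 1) / (m + 1))^a. *)
Lemma cvg_fact_ratioN a :
  ((m - a)`!%:R * m.+1%:R ^+ a / m`!%:R : R) @[m --> \oo] --> (1 : R).
Proof.
have hp j : (((m + a.+1)%:R / (m + 1)%:R : R) ^+ j) @[m --> \oo] --> (1 : R).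
  elim: j => [|j IH]; first by under eq_fun do rewrite expr0; exact: cvg_cst.
  have := cvgM (cvg_succ_ratio a.+1 0) IH; rewrite mulr1 => h.
  by apply: eq_cvg_to (h _) => m /=; rewrite -exprS.
have hv := cvgV (oner_neq0 R) (cvg_fact_ratio a).
have := cvgM (hv _) (hp a); rewrite invr1 mulr1 => h.
apply: (@cvg_to_shiftn _ a); apply: eq_cvg_to (h _ _) => m /=.
have n1 : m`!%:R != 0 :> R by rewrite pnatr_eq0 -lt0n fact_gt0.
have n2 : (m + a)`!%:R != 0 :> R by rewrite pnatr_eq0 -lt0n fact_gt0.
have n3 : m.+1%:R ^+ a != 0 :> R by rewrite expf_neq0.
rewrite addnK addn1 -addnS expr_div_n; field.
by rewrite n1 n2 n3.
Qed.

(* Trades exp |y| - 1 for the symmetric e^y + e^-y - 2: with y = a ln s the latter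
   is s^a + s^-a - 2, which integrates exactly against u^m e^-u. *)
Lemma expR_sub1_le (e y : R) : 0 < e -> 0 <= y ->
  expR y - 1 <= e + (1 + e^-1) * (expR y + expR (- y) - 2).
Proof.
move=> e0 y0; set E := expR y; have E1 : 1 <= E by rewrite -expR0 ler_expR.
have E0 : 0 < E by exact: lt_le_trans E1.
have -> : E + expR (- y) - 2 = (E - 1) ^+ 2 / E.
  by rewrite expRN -/E; field; rewrite gt_eqF.
have ie : 0 < e^-1 by rewrite invr_gt0.
have [h|h] := leP (E - 1) e.
  by apply: le_trans h _; rewrite lerDl mulr_ge0 ?divr_ge0 ?sqr_ge0 ?addr_ge0// ltW.
(* When E - 1 > e, E = 1 + (E - 1) <= (1 + e^-1) (E - 1); this is the origin of the factor. *)
apply: (@le_trans _ _ ((1 + e^-1) * ((E - 1) ^+ 2 / E))); last by rewrite lerDr ltW.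
rewrite expr2 -mulrA mulrCA -[leLHS]mulr1 ler_wpM2l ?subr_ge0// mulrA ler_pdivlMr// mul1r.
have : 1 <= e^-1 * (E - 1) by rewrite mulrC ler_pdivlMr// mul1r ltW.
lra.
Qed.

End FactorialRatios.

Section MatrixGamma.
Context {R : realType} {N : nat}.
Local Notation mu := (@lebesgue_measure R).
Local Notation D := (`]0, +oo[%classic : set R).
Local Notation MC := 'M[R[i]]_N.
Implicit Types (A B M X : MC) (t u : R).

Lemma gamma_integrandE M u :
  gamma_integrand M u = (expR (- u))%:C *: mexp (M - 1) (ln u).
Proof. by rewrite /gamma_integrand mxpowE. Qed.

Lemma is_mxderive_expRN_mexp M u : 0 < u ->
  is_mxderive u (fun v => (expR (- v))%:C *: mexp M (ln v))
    ((expR (- u))%:C *: (M * mexp (M - 1) (ln u)) - (expR (- u))%:C *: mexp M (ln u)).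
Proof.
move=> u0.
apply: is_mxderive_eq (is_mxderiveZ (is_derive_expRN u) (is_mxderive_mexp_ln M u0)) _.
by rewrite addrC rmorphN /= scaleNr.
Qed.

Lemma gamma_integrand_derive M : exists dF : R -> MC,
  forall u, 0 < u -> is_mxderive u (gamma_integrand M) (dF u).
Proof.
have -> : gamma_integrand M = fun v => (expR (- v))%:C *: mexp (M - 1) (ln v).
  by apply/funext => v; exact: gamma_integrandE.
by eexists; exact: (is_mxderive_expRN_mexp (M - 1)).
Qed.

(** The integrand is dominated by C (u^(m-1) + u^nu) e^-u. *)
Lemma is_mxint_mxGamma M : pos_spectrum M -> is_mxint (gamma_integrand M) (mxGamma M).
Proof.
move=> /mexp_ln_bound[m [nu [C [m01 C0 h]]]].
have [dF hdF] := gamma_integrand_derive M.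
have g1 := conj (integrable_expR_ln m01)
  (erefl (\int[mu]_(u in D) (expR (m * ln u) / u * expR (- u)))).
have g2 := conj (@integrable_pow_expRN R nu) (erefl (\int[mu]_(u in D) (u ^+ nu * expR (- u)))).
apply: (is_mxint_dominated hdF (is_RintZ C (is_RintD g1 g2))) => u u0.
rewrite gamma_integrandE mexp_lnB1// scalerA -rmorphM /= mnormZ.
rewrite ger0_norm; last by rewrite mulr_ge0 ?expR_ge0// invr_ge0 ltW.
apply: le_trans (ler_wpM2l _ (h u u0)) _.
  by rewrite mulr_ge0 ?expR_ge0// invr_ge0 ltW.
rewrite le_eqVlt; apply/orP; left; apply/eqP; rewrite exprS; field.
by rewrite gt_eqF.
Qed.

Lemma mxGamma_comm X M : pos_spectrum M -> GRing.comm X M -> GRing.comm X (mxGamma M).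
Proof.
move=> hM XM; have hG := is_mxint_mxGamma hM.
apply: (is_mxint_unique (is_mxintMl X hG)).
apply: eq_is_mxint (is_mxintMr X hG) => u _; rewrite gamma_integrandE.
rewrite -mxscaleAr -mxscaleAl; congr (_ *: _).
by apply/esym/mexp_comm/commrB => //; exact: commr1.
Qed.

Lemma cvg_expR_ln0 (m : R) : 0 < m -> expR (m * ln u) @[u --> 0^'+] --> (0 : R).
Proof.
move=> m0; have := @powR_cvg0 R m m0; apply: cvg_trans; apply: near_eq_cvg.
near=> u; have u0 : 0 < u by near: u; exact: nbhs_right_gt.
by rewrite /powR gt_eqF.
Unshelve. all: by end_near. Qed.

Lemma cvg_mexp_ln0 M : pos_spectrum M -> mexp M (ln u) @[u --> 0^'+] --> (0 : MC).
Proof.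
move=> /mexp_ln_le1[m [C [/andP[m0 _] C0 h]]].
apply: (squeeze_mnorm (fun u => C * expR (m * ln u))).
  near=> u; rewrite subr0; apply: h; apply/andP; split.
    by near: u; exact: nbhs_right_gt.
  by near: u; apply: nbhs_right_le; exact: ltr01.
by have := cvgM (cvg_cst C) (cvg_expR_ln0 m0); rewrite mulr0; apply.
Unshelve. all: by end_near. Qed.

(** Integration by parts: M u^(M - I) e^-u - u^M e^-u is the derivative of e^-u u^M, which vanishes
    at both ends. *)
Lemma mxGammaD1 M : pos_spectrum M -> mxGamma (M + 1) = M * mxGamma M.
Proof.
move=> hM; have hM1 : pos_spectrum (M + 1) := pos_spectrumDn (n := 1) hM.
have h1 := is_mxintMl M (is_mxint_mxGamma hM).
have h2 := is_mxintZ (-1) (is_mxint_mxGamma hM1).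
have h := is_mxintD h1 h2.
pose H u := (expR (- u))%:C *: mexp M (ln u).
pose F u := M * gamma_integrand M u + (-1)%:C *: gamma_integrand (M + 1) u.
have hH u : 0 < u -> is_mxderive u H (F u).
  move=> u0; apply: is_mxderive_eq (is_mxderive_expRN_mexp M u0) _.
  rewrite /F !gamma_integrandE mxscaleAr addrK; congr (_ + _).
  by apply: co_inj => k; rewrite coN !coZ mulN1r.
have [dF hdF] : exists dF : R -> MC, forall u, 0 < u -> is_mxderive u F (dF u).
  have [dG hdG] := gamma_integrand_derive M.
  have [dG1 hdG1] := gamma_integrand_derive (M + 1).
  eexists => u u0; apply: is_mxderiveD (is_mxderiveMl M (hdG u u0)) _.
  exact: (is_mxderiveZ (is_derive_cst _ _ _) (hdG1 u u0)).
have H0 : H u @[u --> 0^'+] --> (0 : MC).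
  apply: (squeeze_mnorm (fun u => mnorm (mexp M (ln u)))).
    near=> u; have u0 : 0 < u by near: u; exact: nbhs_right_gt.
    rewrite subr0 /H mnormZ ger0_norm ?expR_ge0// ler_piMl ?mnorm_ge0//.
    by rewrite -expR0 ler_expR oppr_le0 ltW.
  have /cvg_mnormP := cvg_mexp_ln0 hM.
  by under eq_fun do rewrite subr0.
have Hoo : H u @[u --> +oo] --> (0 : MC).
  have [m [nu [C [m01 C0 hb]]]] := mexp_ln_bound hM.
  apply: (squeeze_mnorm (fun u => C * (u ^+ 0 * expR (- u) + u ^+ 1 * expR (- u) +
     u ^+ nu.+1 * expR (- u)))).
    near=> u; have u0 : 0 < u by near: u; exact: nbhs_pinfty_gt.
    rewrite subr0 /H mnormZ ger0_norm ?expR_ge0//.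
    apply: le_trans (ler_wpM2l (expR_ge0 _) (hb u u0)) _.
    rewrite mulrCA ler_wpM2l// -!mulrDl [leRHS]mulrC ler_wpM2l ?expR_ge0// lerD2r.
    by rewrite expr0 expr1; apply: expR_ln_le1D => //; case/andP: m01 => m0 ->; rewrite ltW.
  have := cvgM (cvg_cst C) (cvgD (cvgD (@cvg_pow_expRN R 0) (@cvg_pow_expRN R 1))
    (@cvg_pow_expRN R nu.+1)).
  by rewrite !addr0 mulr0; apply.
have := is_mxint_FTC h hdF hH H0 Hoo; rewrite subr0 => e.
have -> : mxGamma (M + 1) = - ((-1)%:C *: mxGamma (M + 1)).
  by apply: co_inj => k; rewrite coN coZ mulN1r opprK.
by apply/esym/eqP; rewrite -addr_eq0 e.
Unshelve. all: by end_near. Qed.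

Lemma pochhammerS M n : mx_pochhammer M n.+1 = mx_pochhammer M n * (M + n%:R).
Proof. by rewrite /mx_pochhammer big_ord_recr. Qed.

Lemma comm_pochhammer X M n : GRing.comm X M -> GRing.comm X (mx_pochhammer M n).
Proof.
move=> XM; rewrite /mx_pochhammer; elim/big_ind: _ => [|Y Z|k _].
- exact: commr1.
- exact: commrM.
- by apply: commrD => //; exact: commr_nat.
Qed.

Lemma mxGammaDn M n : pos_spectrum M ->
  mxGamma (M + n%:R) = mx_pochhammer M n * mxGamma M.
Proof.
move=> hM; elim: n => [|n IH]; first by rewrite /mx_pochhammer big_ord0 mul1r addr0.
rewrite -natr1 addrA mxGammaD1; last exact: pos_spectrumDn.
rewrite IH mulrA pochhammerS; congr (_ * _).
apply: comm_pochhammer; apply/commr_sym/commrD => //; exact: commr_nat.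
Qed.

End MatrixGamma.

(** * Asymptotics of Gamma(M + m + 1) and invertibility of Gamma(M) *)

Section GammaAsymptotics.
Context {R : realType} {N : nat}.
Local Notation MC := 'M[R[i]]_N.
Implicit Types (A B M X Y : MC) (t u : R).

(* Gamma(M + m + 1) (m + 1)^-M / m! *)
Definition gamma_ratio M (m : nat) : MC :=
  (m`!%:R^-1)%:C *: (mexp M (ln m.+1%:R^-1) * mxGamma (M + m.+1%:R)).

(** With y = a |ln s| one has s^a + s^-a = e^y + e^-y whatever the sign of ln s, so the absolute
    value disappears. *)
Lemma mnorm_mexp_ln_sub1 M (a : nat) (e s : R) : 0 < e -> 0 < s -> mnorm M <= a%:R ->
  mnorm (mexp M (ln s) - 1) <=
  mnorm (1 : MC) * (e + (1 + e^-1) * (s ^+ a + s^-1 ^+ a - 2)).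
Proof.
move=> e0 s0 Ma; have y0 : 0 <= `|ln s| * a%:R by rewrite mulr_ge0.
apply: le_trans (mexp_norm_sub1 M (ln s)) _; rewrite ler_wpM2l ?mnorm_ge0//.
have h1 := expR_sub1_le e0 y0.
have -> : s ^+ a + s^-1 ^+ a = expR (`|ln s| * a%:R) + expR (- (`|ln s| * a%:R)).
  have es : expR (ln s * a%:R) = s ^+ a by rewrite expRM_natr lnK.
  rewrite exprVn -es -expRN; case: (ger0P (ln s)) => _; first by [].
  by rewrite mulNr opprK addrC.
apply: le_trans h1; rewrite lerD2r ler_expR ler_wpM2l//.
Qed.

(** Against u^m e^-u the terms (u / (m+1))^a and (u / (m+1))^-a integrate to the factorials of m + a
    and m - a; a <= m keeps the second exponent natural. *)
Lemma gamma_ratio_le M (a m : nat) (e : R) : pos_spectrum M -> 0 < e ->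
  mnorm M <= a%:R -> (a <= m)%N ->
  mnorm (gamma_ratio M m - 1) <= \sum_(k : bool * 'I_N * 'I_N) mnorm (1 : MC) *
    (e + (1 + e^-1) * ((m + a)`!%:R / (m`!%:R * m.+1%:R ^+ a) +
       (m - a)`!%:R * m.+1%:R ^+ a / m`!%:R - 2)).
Proof.
move=> hM e0 Ma am; set w : R := m.+1%:R; set c := 1 + e^-1.
have w0 : 0 < w by rewrite ltr0n.
have f0 : m`!%:R != 0 :> R by rewrite pnatr_eq0 -lt0n fact_gt0.
have hG := is_mxint_mxGamma (pos_spectrumDn (n := m.+1) hM).
have h1 := is_mxintMl (mexp M (ln w^-1)) hG.
have rp k := conj (@integrable_pow_expRN R k) (Rintegral_pow_expRN k) :
  is_Rint (fun u => u ^+ k * expR (- u)) k`!%:R.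
have h2 := is_mxint_scalar (- 1 : MC) (rp m).
have h := is_mxintZ (m`!%:R^-1) (is_mxintD h1 h2).
have {}h : is_mxint (fun u => (m`!%:R^-1 * (u ^+ m * expR (- u)))%:C *:
    (mexp M (ln (u / w)) - 1)) (gamma_ratio M m - 1).
  have -> : gamma_ratio M m - 1 = m`!%:R^-1%:C *:
     (mexp M (ln w^-1) * mxGamma (M + m.+1%:R) + (m`!%:R)%:C *: (- 1 : MC)).
    by rewrite scalerDr scalerA -rmorphM /= mulVf// scale1r.
  apply: eq_is_mxint h => u u0; rewrite gamma_integrandE [in RHS]rmorphM -[RHS]scalerA.
  congr (_ *: _); rewrite [RHS]scalerDr; congr (_ + _).
  rewrite -natr1 addrA addrK mexp_lnDn// -!mxscaleAr scalerA -rmorphM /=.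
  by rewrite mulrC mexp_lnM ?invr_gt0// (mexp_comm _ _)//; exact/commr_sym/mexp_comm.
have g := is_RintZ (m`!%:R^-1 * mnorm (1 : MC)) (is_RintD (is_RintZ (e - 2 * c) (rp m))
  (is_RintD (is_RintZ (c * w^-1 ^+ a) (rp (m + a)%N)) (is_RintZ (c * w ^+ a) (rp (m - a)%N)))).
have wa : w ^+ a != 0 by rewrite expf_neq0// gt_eqF.
apply: le_trans (is_mxint_norm h g _) _.
  move=> u u0; rewrite mnormZ ger0_norm; last first.
    by rewrite mulr_ge0 ?invr_ge0// mulr_ge0 ?expR_ge0// exprn_ge0// ltW.
  rewrite -!mulrA ler_wpM2l ?invr_ge0//.
  have uw0 : 0 < u / w by rewrite divr_gt0.
  have /(ler_wpM2l (_ : 0 <= u ^+ m * expR (- u))) := mnorm_mexp_ln_sub1 e0 uw0 Ma.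
  rewrite mulrA => hh; apply: le_trans (hh _) _.
    by rewrite mulr_ge0 ?expR_ge0// exprn_ge0// ltW.
  rewrite mulrCA ler_wpM2l ?mnorm_ge0// le_eqVlt; apply/orP; left; apply/eqP.
  rewrite exprD invf_div -/c -[in u ^+ m](subnK am) exprD !expr_div_n exprVn; field.
  by rewrite wa expf_neq0// gt_eqF.
apply: ler_sum => k _; rewrite le_eqVlt; apply/orP; left; apply/eqP.
by rewrite exprVn; field; rewrite f0 wa.
Qed.

Lemma cvg_gamma_ratio M : pos_spectrum M -> gamma_ratio M @ \oo --> (1 : MC).
Proof.
move=> hM; pose a := Num.Def.archi_bound (mnorm M).
have Ma : mnorm M <= a%:R by apply/ltW/archi_boundP/mnorm_ge0.
pose K : R := \sum_(k : bool * 'I_N * 'I_N) mnorm (1 : MC).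
have K0 : 0 <= K by rewrite sumr_ge0// => *; exact: mnorm_ge0.
pose r (m : nat) : R := (m + a)`!%:R / (m`!%:R * m.+1%:R ^+ a) +
       (m - a)`!%:R * m.+1%:R ^+ a / m`!%:R - 2.
have r0 : r @ \oo --> (0 : R).
  have := cvgB (cvgD (cvg_fact_ratio (R := R) a) (cvg_fact_ratioN (R := R) a)) (cvg_cst (2 : R)).
  by rewrite -[X in 1 + 1 - X]/(1 + 1 : R) subrr; apply.
apply/cvg_mnormP/cvgrPdist_lt => d d0.
(* e is fixed before m because 1 + e^-1 blows up as e shrinks; m is then taken so large that the
   total is at most 2 e K < d. *)
pose e := d / (2 * (K + 1)); have e0 : 0 < e by rewrite divr_gt0// mulr_gt0// ltr_wpDl.
have c0 : 0 < 1 + e^-1 by rewrite addr_gt0// invr_gt0.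
have re : 0 < e / (1 + e^-1) by rewrite divr_gt0.
near=> m; rewrite sub0r normrN ger0_norm ?mnorm_ge0//.
have am : (a <= m)%N by near: m; exact: nbhs_infty_ge.
have rm : r m < e / (1 + e^-1) by near: m; exact: (cvgr_lt (0 : R)).
apply: le_lt_trans (gamma_ratio_le hM e0 Ma am) _.
rewrite -mulr_suml -/K -/(r m); rewrite ltr_pdivlMr// in rm.
apply: (@le_lt_trans _ _ (K * (2 * e))).
  by rewrite ler_wpM2l//; rewrite mulrC in rm; lra.
rewrite /e invfM !mulrA; have -> : K * 2 * d / 2 / (K + 1) = d * (K / (K + 1)).
  by field; rewrite gt_eqF// ltr_wpDl.
by rewrite gtr_pMr// ltr_pdivrMr ?mul1r ?ltrDl// ltr_wpDl.
Unshelve. all: by end_near. Qed.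

(** The left kernel matrix Z of X satisfies Z = - Z (X - 1), so its norm is at most a factor below 1
    times itself, and Z = 0. *)
Lemma mx_near1_unit X : mnorm (X - 1) < 1 -> X \in unitmx.
Proof.
move=> X1; rewrite -row_free_unit -kermx_eq0; apply/eqP/mnorm_eq0.
have e : kermx X = - (kermx X * (X - 1)).
  by rewrite mulrBr mulr1 (mulmx_ker X : kermx X * X = 0) sub0r opprK.
have := mnormM (kermx X) (X - 1); rewrite -[mnorm (_ * _)]mnormN -e.
have := mnorm_ge0 (kermx X); nra.
Qed.

Lemma mulmx_unit_r X Y : X * Y \in unitmx -> Y \in unitmx.
Proof. by rewrite -[X * Y]/(X *m Y) unitmx_mul => /andP[]. Qed.

Lemma cvg_near_unit (f : nat -> MC) : f @ \oo --> (1 : MC) ->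
  \forall m \near \oo, f m \in unitmx.
Proof.
move=> /cvg_mnormP/cvgr_lt/(_ _ ltr01); apply: filterS => m; exact: mx_near1_unit.
Qed.

Lemma cvg_invmx1 (f : nat -> MC) : f @ \oo --> (1 : MC) ->
  invmx (f m) @[m --> \oo] --> (1 : MC).
Proof.
move=> f1; apply: (squeeze_mnorm (fun m => 2 * mnorm (1 : MC) * mnorm (f m - 1))).
  near=> m.
  have fu : f m \in unitmx by near: m; exact: cvg_near_unit.
  (* At distance below 1/2 the inverse Z satisfies |Z| <= |Z| / 2 + |1|, whence the bound 2 |1|. *)
  have h : mnorm (f m - 1) < 2^-1.
    near: m; move/cvg_mnormP/cvgr_lt : f1; apply; by rewrite invr_gt0.
  set Z := invmx (f m); have e : Z - 1 = - (Z * (f m - 1)).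
    by rewrite mulrBr mulr1 (mulVmx fu : Z * f m = 1) opprB.
  have hZ : mnorm (Z - 1) <= mnorm Z * mnorm (f m - 1) by rewrite e mnormN mnormM.
  have hZ2 : mnorm Z <= mnorm (Z - 1) + mnorm (1 : MC).
    by rewrite -[X in mnorm X <= _](subrK 1) mnormD.
  have Z0 := mnorm_ge0 Z; have n0 := mnorm_ge0 (1 : MC); have d0 := mnorm_ge0 (f m - 1).
  have h2 : mnorm Z * mnorm (f m - 1) <= mnorm Z / 2 by rewrite ler_wpM2l// ltW.
  have h3 : mnorm Z <= 2 * mnorm (1 : MC) by lra.
  by apply: le_trans hZ _; rewrite ler_wpM2r.
have := cvgM (cvg_cst (2 * mnorm (1 : MC))) (proj1 (cvg_mnormP f 1) f1).
by rewrite mulr0; apply.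
Unshelve. all: by end_near. Qed.

(** By the functional equation Gamma(M) is a right factor of [gamma_ratio M m], which is invertible
    for large m. *)
Lemma mxGamma_unit M : pos_spectrum M -> mxGamma M \in unitmx.
Proof.
move=> hM; have [m] := filter_ex (cvg_near_unit (cvg_gamma_ratio hM)).
rewrite /gamma_ratio mxGammaDn// mulrA mxscaleAl; exact: mulmx_unit_r.
Qed.

End GammaAsymptotics.

(** * The binomial series *)

Section ScalarSums.
Context {R : realType}.
Implicit Types (h d m : R).

(** The sums are partial sums, with nonnegative terms, of the binomial series of h^-(k+1). *)
Lemma binomial_partial_sum k h n : 0 < h < 1 ->
  h ^+ k.+1 * \sum_(l < n) 'C(l + k, k)%:R * (1 - h) ^+ l <= 1.
Proof.
move=> /andP[h0 h1]; set d := 1 - h; have d0 : 0 <= d by rewrite subr_ge0 ltW.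
elim: k => [|k IH].
  rewrite expr1 (eq_bigr (fun l : 'I_n => d ^+ l)); last by move=> l _; rewrite bin0 mul1r.
  by have := subrX1 d n; have := exprn_ge0 n d0; rewrite /d; lra.
(* Multiplication by h = 1 - d and Pascal's rule lower k by one, up to a nonnegative boundary term
   that is dropped. *)
have e : h * (\sum_(l < n) 'C(l + k.+1, k.+1)%:R * d ^+ l) +
    'C(n + k, k.+1)%:R * d ^+ n = \sum_(l < n) 'C(l + k, k)%:R * d ^+ l.
  elim: n {IH} => [|n IH].
    by rewrite !big_ord0 mulr0 add0r add0n bin_small// mul0r.
  rewrite !big_ord_recr /= -IH addnS addSn !binS !natrD exprS /d; ring.
apply: le_trans IH; rewrite exprSr -mulrA ler_wpM2l ?exprn_ge0 ?(ltW h0)//.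
by rewrite -e lerDl mulr_ge0// exprn_ge0.
Qed.

Lemma pow_le_binomial k l : (l.+1 ^ k <= k`! * 'C(l + k, k))%N.
Proof.
rewrite mulnC bin_ffact; elim: k => [//|k IH].
by rewrite expnS addnS ffactSS leq_mul// ltnS leq_addr.
Qed.

(** A Riemann sum with step h for the integral k! of u^k e^-u, (1 - h)^l standing for e^-u at u = l
    h. The bound is uniform in h and n. *)
Lemma sum_pow_le k h n : 0 < h < 1 ->
  \sum_(l < n) (l.+1%:R * h) ^+ k.+1 / l.+1%:R * (1 - h) ^+ l.+1 <= k`!%:R.
Proof.
move=> /[dup] hh /andP[h0 h1]; have d0 : 0 <= 1 - h by rewrite subr_ge0 ltW.
have b := ler_wpM2l (ler0n R k`!) (binomial_partial_sum k n hh).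
rewrite mulr1 in b; apply: le_trans b; rewrite !mulr_sumr; apply: ler_sum => l _.
have -> : (l.+1%:R * h) ^+ k.+1 / l.+1%:R * (1 - h) ^+ l.+1 =
    h ^+ k.+1 * (l.+1%:R ^+ k * (1 - h) ^+ l.+1).
  rewrite exprMn [l.+1%:R ^+ k.+1]exprSr; field; by rewrite nat1r.
rewrite [leRHS]mulrCA ler_wpM2l ?exprn_ge0 ?(ltW h0)// mulrA; apply: ler_pM.
- by rewrite exprn_ge0.
- by rewrite exprn_ge0.
- by rewrite -natrX -natrM ler_nat pow_le_binomial.
- by rewrite exprS ler_piMl ?exprn_ge0// gerBl ltW.
Qed.

(** The tangent of exp at c = m a lies below exp; its values at 0 and a are combined with weights 1
    - m and m. *)
Lemma expR_convex m a : 0 <= m <= 1 -> expR (m * a) <= 1 - m + m * expR a.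
Proof.
move=> /andP[m0 m1]; set c := m * a.
have h0 : expR c * (1 - c) <= 1.
  by rewrite -[leRHS]expR0 -(subrr c) expRD ler_wpM2l ?expR_ge0// expR_ge1Dx.
have ha : expR c * (1 + (a - c)) <= expR a.
  have -> : a = c + (a - c) by ring.
  by rewrite expRD ler_wpM2l ?expR_ge0// [X in X <= _](_ : _ = 1 + (a - c)) ?expR_ge1Dx//; ring.
have : (1 - m) * (expR c * (1 - c)) <= (1 - m) * 1 by rewrite ler_wpM2l// subr_ge0.
have : m * (expR c * (1 + (a - c))) <= m * expR a by rewrite ler_wpM2l.
have : (1 - m) * (expR c * (1 - c)) + m * (expR c * (1 + (a - c))) = expR c.
  by rewrite /c; ring.
lra.
Qed.

(* By concavity of u^m, the summands are dominated by the increments of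
   l |-> (l h)^m, to which Abel summation applies. *)
Lemma sum_expR_ln_le m h n : 0 < m <= 1 -> 0 < h < 1 ->
  \sum_(l < n) expR (m * ln (l.+1%:R * h)) / l.+1%:R * (1 - h) ^+ l.+1 <= m^-1 * 4.
Proof.
move=> /andP[m0 m1] /[dup] hh /andP[h0 h1]; set d := 1 - h.
have d0 : 0 <= d by rewrite subr_ge0 ltW.
(* [W l] is (l h)^m; l = 0 is a separate case because the formula through [expR] never vanishes. *)
pose W (l : nat) : R := if l is l'.+1 then expR (m * ln (l%:R * h)) else 0.
have W0 l : 0 <= W l by case: l => //= l; exact: expR_ge0.
have WS l : W l.+1 / l.+1%:R <= m^-1 * (W l.+1 - W l).
  have l0 : 0 < l.+1%:R :> R by rewrite ltr0n.
  rewrite [leRHS]mulrC ler_pdivlMr// mulrAC ler_pdivrMr//.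
  case: l l0 => [|l] l0 /=.
    by rewrite subr0 mulr1 ler_piMr ?expR_ge0.
  have l1 : 0 < l.+1%:R :> R by rewrite ltr0n.
  have q0 : 0 < l.+1%:R / l.+2%:R :> R by rewrite divr_gt0.
  have -> : expR (m * ln (l.+1%:R * h)) =
     expR (m * ln (l.+2%:R * h)) * expR (m * ln (l.+1%:R / l.+2%:R)).
    rewrite -expRD -mulrDr -lnM ?posrE ?mulr_gt0//; congr (expR (m * ln _)).
    by field; rewrite -natrD.
  have m01 : 0 <= m <= 1 by rewrite ltW.
  have := expR_convex (ln (l.+1%:R / l.+2%:R)) m01; rewrite lnK// => hc.
  set E := expR (m * ln (l.+2%:R * h)); have E0 : 0 <= E by exact: expR_ge0.
  set q := expR (m * ln (l.+1%:R / l.+2%:R)) in hc *.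
  (* Bernoulli's inequality ((l+1) / (l+2))^m <= 1 - m / (l+2), in which the concavity of u^m
     enters. *)
  have hq : l.+2%:R * q <= l.+2%:R - m.
    have := ler_wpM2l (ltW l0) hc; move/le_trans; apply.
    rewrite le_eqVlt; apply/orP; left; apply/eqP.
    by rewrite -[l.+2]addn1 -[l.+1]addn1 !natrD; field.
  have : E * m <= E * (l.+2%:R - l.+2%:R * q) by rewrite ler_wpM2l//; lra.
  lra.
have abel : \sum_(l < n) (W l.+1 - W l) * d ^+ l.+1 =
    h * \sum_(l < n) W l.+1 * d ^+ l.+1 + W n * d ^+ n.+1.
  elim: n => [|n IH]; first by rewrite !big_ord0 /= mulr0 mul0r addr0.
  by rewrite !big_ord_recr /= -/(W n.+1) IH [d ^+ n.+2]exprS /d; ring.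
have Wle l : W l <= 1 + l%:R * h.
  case: l => [|l] /=; first by rewrite mul0r addr0.
  by apply: expR_ln_le1D; rewrite ?mulr_gt0// ltW.
apply: (@le_trans _ _ (m^-1 * \sum_(l < n) (W l.+1 - W l) * d ^+ l.+1)).
  rewrite mulr_sumr; apply: ler_sum => l _; rewrite mulrA ler_wpM2r ?exprn_ge0//.
  exact: WS.
rewrite ler_wpM2l ?invr_ge0 ?(ltW m0)// abel.
(* Since W l <= 1 + l h, the binomial bounds for k = 0 and k = 1 contribute 1 each. *)
have s1 : h * \sum_(l < n) W l.+1 * d ^+ l.+1 <= 2.
  have b0 := binomial_partial_sum 0 n hh; have b1 := binomial_partial_sum 1 n hh.
  have -> : 2 = 1 + 1 :> R by [].
  apply: le_trans (lerD b0 b1); rewrite expr1 expr2 -mulrA -mulrDr.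
  rewrite ler_wpM2l ?(ltW h0)// mulr_sumr -big_split /=; apply: ler_sum => l _.
  rewrite bin0 bin1 mul1r addn1 mulrA [h * _]mulrC.
  have -> : d ^+ l + l.+1%:R * h * d ^+ l = (1 + l.+1%:R * h) * d ^+ l by ring.
  apply: ler_pM; [exact: (W0 l.+1)|exact: exprn_ge0|exact: (Wle l.+1)|].
  by rewrite exprS ler_piMl ?exprn_ge0// gerBl ltW.
have s2 : W n * d ^+ n.+1 <= 2.
  have hd : 0 <= d < 1 by rewrite d0 /d gtrBl.
  have dn : 0 <= d ^+ n by rewrite exprn_ge0.
  have dn1 : d ^+ n <= 1 by rewrite exprn_ile1//; case/andP: hd => _ /ltW.
  apply: (@le_trans _ _ ((1 + n%:R * h) * d ^+ n)).
    apply: ler_pM; [exact: (W0 n)|exact: exprn_ge0|exact: (Wle n)|].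
    by rewrite exprS ler_piMl// gerBl ltW.
  have := mulrn_expr_le n hd; have -> : 1 - d = h by rewrite /d; ring.
  rewrite -(ler_pM2r h0) mulVf ?gt_eqF// -natr1.
  have : 0 <= d ^+ n * h by rewrite mulr_ge0// ltW.
  lra.
lra.
Qed.

End ScalarSums.

(** * The derivative of t^A (1 - t)^M times a power series *)

Section KernelSeries.
Context {R : realType} {N : nat}.
Local Notation MC := 'M[R[i]]_N.
Implicit Types (A B M X Y Z : MC) (C : nat -> MC) (t d : R).

Lemma mxscaleM2 (a : R[i]) X Y Z : (a *: X) * (Y * Z) = X * (Y * (a *: Z)).
Proof. by rewrite -mxscaleAl -[in RHS]mxscaleAr -mxscaleAr. Qed.

Lemma mps_lim C t X : mpseries C t @ \oo --> X -> mps C t = X.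
Proof. by move=> h; rewrite mps.unlock; exact: mx_cvg_lim. Qed.

(* The coefficients for which t^(A-1) (1-t)^(M-1) sum_l kernel_coeffs l t^l is the
   derivative of t^A (1-t)^M sum_l (C l) t^l. *)
Definition kernel_coeffs A M C (l : nat) : MC :=
  (A + l%:R) * C l - (if l is l'.+1 then (A + M + l'%:R) * C l' else 0).

Lemma mulmxDn A (l : nat) X : (A + l%:R) * X = A * X + (l%:R)%:C *: X.
Proof. by rewrite mulrDl natr_mx -mxscaleAl mul1r. Qed.

Lemma mpseries_kernel_coeffs A M C t n :
  mpseries (kernel_coeffs A M C) t n.+1 =
  A * mpseries C t n.+1 + t%:C *: mpseries (mps_diffs C) t n -
  (t%:C *: ((A + M) * mpseries C t n) + t%:C *: mpseries (fun l => (l%:R)%:C *: C l) t n).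
Proof.
have e : t%:C *: mpseries (mps_diffs C) t n =
    mpseries (fun l => (l%:R)%:C *: C l) t n.+1.
  rewrite mpseries.unlock /series /= big_nat_recl//= scale0r scaler0 add0r scaler_sumr.
  apply: eq_bigr => l _; rewrite /mps_diffs !scalerA -!rmorphM /=.
  by congr ((_ : R)%:C *: _); rewrite exprS; ring.
rewrite e -scalerDr -(mpseries_scalel A C t n.+1) -(mpseries_scalel (A + M) C t n).
have -> : mpseries (fun l => (A + M) * C l) t n +
    mpseries (fun l => (l%:R)%:C *: C l) t n =
    mpseries (fun l => (A + M + l%:R) * C l) t n.
  rewrite mpseries.unlock /series /= -big_split /=; apply: eq_bigr => l _.
  by rewrite -scalerDr mulmxDn.
have -> : mpseries (fun l => A * C l) t n.+1 +
    mpseries (fun l => (l%:R)%:C *: C l) t n.+1 =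
    mpseries (fun l => (A + l%:R) * C l) t n.+1.
  rewrite mpseries.unlock /series /= -big_split /=; apply: eq_bigr => l _.
  by rewrite -scalerDr mulmxDn.
have -> : t%:C *: mpseries (fun l => (A + M + l%:R) * C l) t n =
    mpseries (fun l => if l is l'.+1 then (A + M + l'%:R) * C l' else 0) t n.+1.
  rewrite mpseries.unlock /series /= big_nat_recl//= scaler0 add0r scaler_sumr.
  by apply: eq_bigr => l _; rewrite scalerA -rmorphM -exprS.
by rewrite mpseries.unlock /series /= -sumrB; apply: eq_bigr => l _; rewrite -scalerBr.
Qed.

(** For f the sum of the series of C, the limit equals (1 - t) (A f + t f') - t M f, the factor left
    once t^(A - I) (1 - t)^(M - I) is taken out of the derivative. *)
Lemma mps_kernel_coeffs A M C rho K t :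
  (forall l, mnorm (C l) * rho ^+ l <= K) -> `|t| < rho ->
  mpseries (kernel_coeffs A M C) t @ \oo -->
  A * mps C t + t%:C *: mps (mps_diffs C) t -
  (t%:C *: ((A + M) * mps C t) + t%:C *: (t%:C *: mps (mps_diffs C) t)).
Proof.
move=> CK tr; have cC := mps_cvg CK tr.
pose r := (`|t| + rho) / 2.
have rr : 0 <= r < rho.
  by have := normr_ge0 t; rewrite /r => ?; apply/andP; split; lra.
have tr' : `|t| < r by rewrite /r; lra.
have [K' dK'] := mps_diffs_bounded CK rr.
have cD := mps_cvg dK' tr'.
have cC1 : mpseries C t n.+1 @[n --> \oo] --> mps C t.
  exact: (cvg_to_succ cC).
have ct : (fun _ : nat => t) @ \oo --> t by exact: cvg_cst.
have cT : mpseries (fun l => (l%:R)%:C *: C l) t n @[n --> \oo] -->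
    t%:C *: mps (mps_diffs C) t.
  apply: cvg_of_succ; apply: eq_cvg_to (mxcvgZ ct cD) => n.
  rewrite mpseries.unlock /series /= big_nat_recl//= scale0r scaler0 add0r scaler_sumr.
  apply: eq_bigr => l _; rewrite /mps_diffs !scalerA -!rmorphM /=.
  by congr ((_ : R)%:C *: _); rewrite exprS; ring.
apply: cvg_of_succ; apply: eq_cvg_to (cvgB (mxcvgD (mxcvgMl A cC1) (mxcvgZ ct cD))
  (mxcvgD (mxcvgZ ct (mxcvgMl (A + M) cC)) (mxcvgZ ct cT))) => n.
by rewrite [RHS]mpseries_kernel_coeffs.
Qed.

Lemma is_derive_onem t : is_derive t (1 : R) (fun u : R => 1 - u) (-1).
Proof.
have h := is_deriveB (is_derive_cst (1 : R) t (1 : R)) (is_derive_id t (1 : R)).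
by apply: (is_derive_eq h); rewrite sub0r.
Qed.

Lemma is_mxderive_kernel A M C rho K t : GRing.comm A M ->
  (forall l, mnorm (C l) * rho ^+ l <= K) -> t < rho -> 0 < t < 1 ->
  is_mxderive t (fun u => mexp A (ln u) * (mexp M (ln (1 - u)) * mps C u))
    (mexp (A - 1) (ln t) * (mexp (M - 1) (ln (1 - t)) * mps (kernel_coeffs A M C) t)).
Proof.
move=> AM CK tr /andP[t0 t1]; have tr' : `|t| < rho by rewrite ger0_norm// ltW.
have s0 : 0 < 1 - t by rewrite subr_gt0.
rewrite (mps_lim (@mps_kernel_coeffs A M C rho K t CK tr')).
have d1 := is_mxderive_mexp_ln A t0.
have d2 : is_mxderive t (fun u => mexp M (ln (1 - u)))
    ((-1)%:C *: (M * mexp (M - 1) (ln (1 - t)))).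
  exact: (is_mxderive_comp (F := fun v => mexp M (ln v)) (g := fun u => 1 - u)
    (is_derive_onem t) (is_mxderive_mexp_ln M s0)).
have d3 := is_mxderive_mps CK tr'.
apply: is_mxderive_eq (is_mxderiveM d1 (is_mxderiveM d2 d3)) _.
have eA : mexp A (ln t) = t%:C *: mexp (A - 1) (ln t).
  by rewrite mexp_lnB1// scalerA -rmorphM /= mulfV ?gt_eqF// scale1r.
have eM : mexp M (ln (1 - t)) = (1 - t)%:C *: mexp (M - 1) (ln (1 - t)).
  by rewrite mexp_lnB1// scalerA -rmorphM /= mulfV ?gt_eqF// scale1r.
set f := mps C t; set f' := mps (mps_diffs C) t.
have cA : GRing.comm A (mexp (A - 1) (ln t)).
  by apply/mexp_comm/commrB => //; exact: commr1.
have cAM : GRing.comm A (mexp (M - 1) (ln (1 - t))).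
  by apply/mexp_comm/commrB => //; exact: commr1.
have cM : GRing.comm M (mexp (M - 1) (ln (1 - t))).
  by apply/mexp_comm/commrB => //; exact: commr1.
rewrite eA eM; move: cA cAM cM; rewrite /GRing.comm.
move: (mexp (A - 1) (ln t)) (mexp (M - 1) (ln (1 - t))) => U V cA cAM cM.
have e1 : A * U * ((1 - t)%:C *: V * f) = U * (V * ((1 - t)%:C *: (A * f))).
  by rewrite cA -!mxscaleAl -!mxscaleAr -!mulrA (mulrA A V) cAM -!mulrA.
have e2 : (t%:C *: U) * ((-1)%:C *: (M * V) * f + (1 - t)%:C *: V * f') =
    U * (V * (t%:C *: ((-1)%:C *: (M * f) + (1 - t)%:C *: f'))).
  have -> : (-1)%:C *: (M * V) * f + (1 - t)%:C *: V * f' =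
      V * ((-1)%:C *: (M * f) + (1 - t)%:C *: f').
    by rewrite mulrDr -!mxscaleAl -!mxscaleAr cM -mulrA.
  exact: mxscaleM2.
rewrite e1 e2 -!mulrDr; congr (_ * (_ * _)).
by apply: co_inj => k; rewrite mulrDl !(coD, coN, coZ); ring.
Qed.

End KernelSeries.

(** * The binomial series of (1 - t)^-M *)

Section BinomialSeries.
Context {R : realType} {N : nat}.
Local Notation MC := 'M[R[i]]_N.
Implicit Types (A B M X Y Z : MC) (t d : R).

Definition binomial_coeffs M (l : nat) : MC := (l`!%:R^-1)%:C *: mx_pochhammer M l.

Lemma mxcvg_bounded (f : nat -> MC) X : f @ \oo --> X ->
  exists2 K, 0 <= K & forall m, mnorm (f m) <= K.
Proof.
move=> /cvg_mnormP fX.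
have /cvg_seq_bounded[K [_ hK]] : cvgn (fun m => mnorm (f m - X)).
  by apply/cvg_ex; exists 0.
exists (`|K| + 1 + mnorm X) => [|m]; first by rewrite !addr_ge0 ?mnorm_ge0.
rewrite -[f m](subrK X); apply: le_trans (mnormD _ _) _; rewrite lerD2r.
have K1 : K < `|K| + 1 by rewrite (le_lt_trans (ler_norm K))// ltrDl.
exact: le_trans (ler_norm _) (hK _ K1 m I).
Qed.

(** The definition of [gamma_ratio] solved for the Pochhammer symbol, which thus grows like m!
    (m+1)^M Gamma(M)^-1. *)
Lemma pochhammer_gamma_ratio M m : pos_spectrum M ->
  mx_pochhammer M m.+1 =
  (m`!%:R)%:C *: (mexp M (ln m.+1%:R) * (gamma_ratio M m * invmx (mxGamma M))).
Proof.
move=> hM; have w0 : 0 < m.+1%:R :> R by rewrite ltr0n.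
have f0 : m`!%:R != 0 :> R by rewrite pnatr_eq0 -lt0n fact_gt0.
rewrite /gamma_ratio mxGammaDn// -mxscaleAl -mxscaleAr scalerA -rmorphM /=.
rewrite mulfV// scale1r -!mulrA (mulmxV (mxGamma_unit hM) : mxGamma M * _ = 1) mulr1.
by rewrite mulrA lnV ?posrE// mexpKN mul1r.
Qed.

(** The substitute for positive weights in the Abelian argument. The powers (1 - d)^M and (l+1)^M
    combine into ((l+1) (1 - d))^M, whose two-power bound is summed by the scalar estimates
    above. *)
Lemma binomial_sum_bound M : pos_spectrum M -> exists2 K, 0 <= K &
  forall d n, 0 < d < 1 ->
  \sum_(l < n) mnorm (mexp M (ln (1 - d)) * binomial_coeffs M l) * d ^+ l <= K.
Proof.
move=> hM; have [m [nu [C [m01 C0 hb]]]] := mexp_ln_bound hM.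
have [Kg Kg0 hg] := mxcvg_bounded (cvg_gamma_ratio hM).
pose G := mnorm (invmx (mxGamma M)); have G0 : 0 <= G by exact: mnorm_ge0.
have f0 : 0 <= nu`!%:R :> R by [].
have mi : 0 <= m^-1 * 4 by rewrite mulr_ge0// invr_ge0; case/andP: m01 => /ltW.
exists (C * 2 + C * (Kg * G) * (m^-1 * 4 + nu`!%:R)) => [|d n /andP[d0 d1]].
  by rewrite addr_ge0// !mulr_ge0// addr_ge0.
have h0 : 0 < 1 - d by rewrite subr_gt0.
have h01 : 0 < 1 - d < 1 by rewrite h0 gtrBl.
have dE : d = 1 - (1 - d) by rewrite opprB addrC subrK.
case: n => [|n].
  by rewrite big_ord0 addr_ge0// !mulr_ge0// addr_ge0.
(* The term l = 0 is bounded apart by 2 C, because the asymptotic formula for (M)_l starts at l =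
   1. *)
rewrite big_ord_recl; apply: lerD; first rewrite expr0 [leLHS]mulr1.
  rewrite /binomial_coeffs /mx_pochhammer big_ord0 fact0 invr1 scale1r mulr1.
  apply: le_trans (hb _ h0) _; rewrite ler_wpM2l// [leRHS](_ : _ = 1 + 1)// lerD//.
    rewrite -[leRHS]expR0 ler_expR mulr_ge0_le0//; first by case/andP: m01 => /ltW.
    by apply: ln_le0; lra.
  by apply: exprn_ile1; lra.
have s1 := sum_expR_ln_le n m01 h01; have s2 := sum_pow_le nu n h01.
apply: (le_trans _ (ler_wpM2l _ (lerD s1 s2))); last first.
  by rewrite !mulr_ge0.
rewrite -big_split /= mulr_sumr; apply: ler_sum => l _.
rewrite -[1 - (1 - d)]dE -mulrDl mulrA ler_wpM2r ?exprn_ge0 ?(ltW d0)//.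
set w : R := l.+1%:R; have w0 : 0 < w by rewrite ltr0n.
have -> : mexp M (ln (1 - d)) * binomial_coeffs M l.+1 =
    w^-1%:C *: (mexp M (ln (w * (1 - d))) * (gamma_ratio M l * invmx (mxGamma M))).
  rewrite mulrC mexp_lnM// -mulrA.
  have fl0 : l`!%:R != 0 :> R by rewrite pnatr_eq0 -lt0n fact_gt0.
  have -> : binomial_coeffs M l.+1 =
      w^-1%:C *: (mexp M (ln w) * (gamma_ratio M l * invmx (mxGamma M))).
    rewrite /binomial_coeffs pochhammer_gamma_ratio// scalerA -rmorphM /=.
    by congr (_%:C *: _); rewrite factS natrM invfM mulfVK.
  by rewrite -mxscaleAr.
rewrite mnormZ ger0_norm ?invr_ge0 ?(ltW w0)//.
apply: (@le_trans _ _
  (w^-1 * (C * (expR (m * ln (w * (1 - d))) + (w * (1 - d)) ^+ nu.+1) * (Kg * G)))).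
  rewrite ler_wpM2l ?invr_ge0 ?(ltW w0)//; apply: le_trans (mnormM _ _) _.
  apply: ler_pM; rewrite ?mnorm_ge0 ?hb ?mulr_gt0//.
  by apply: le_trans (mnormM _ _) _; rewrite ler_wpM2r.
by rewrite le_eqVlt; apply/orP; left; apply/eqP; ring.
Qed.

Lemma cvg_ln1B M : pos_spectrum M -> mexp M (ln (1 - d)) @[d --> 1^'-] --> (0 : MC).
Proof.
move=> hM; have h := cvg_mexp_ln0 hM.
apply/cvg_mnormP/cvgrPdist_lt => e e0.
move/cvg_mnormP/cvgrPdist_lt : h => /(_ e e0) [r r0 hr].
exists r => // d /= dr d1; apply: hr => /=; last by rewrite subr_gt0.
by rewrite sub0r normrN ger0_norm ?subr_ge0 ?(ltW d1)//
  -(ger0_norm (_ : 0 <= 1 - d)) ?subr_ge0 ?ltW.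
Qed.

(** A single term of the preceding sum at d = rho, with the invertible factor (1 - rho)^M
    removed. *)
Lemma binomial_coeffs_bounded M rho : pos_spectrum M -> 0 < rho < 1 ->
  exists K, forall l, mnorm (binomial_coeffs M l) * rho ^+ l <= K.
Proof.
move=> hM rho01; have [K K0 hK] := binomial_sum_bound hM.
exists (mnorm (mexp M (- ln (1 - rho))) * K) => l.
have /andP[/ltW r0 _] := rho01.
rewrite -[binomial_coeffs M l]mul1r -(mexpNK M (ln (1 - rho))) -mulrA.
apply: (@le_trans _ _ (mnorm (mexp M (- ln (1 - rho))) *
    (mnorm (mexp M (ln (1 - rho)) * binomial_coeffs M l) * rho ^+ l))).
  by rewrite [leRHS]mulrA ler_wpM2r ?exprn_ge0// mnormM.
rewrite ler_wpM2l ?mnorm_ge0//; apply: le_trans (hK rho l.+1 rho01).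
rewrite big_ord_recr /= lerDr sumr_ge0// => i _.
by rewrite mulr_ge0 ?mnorm_ge0// exprn_ge0.
Qed.

Lemma mul_binomial_coeffs_bounded M (Y : nat -> MC) (KY rho : R) : pos_spectrum M ->
  0 < rho < 1 -> (forall l, mnorm (Y l) <= KY) ->
  exists K, forall l, mnorm (binomial_coeffs M l * Y l) * rho ^+ l <= K.
Proof.
move=> hM rho01 hY; have [K hK] := binomial_coeffs_bounded hM rho01.
have /andP[/ltW r0 _] := rho01.
exists (K * KY) => l; apply: (@le_trans _ _
  (mnorm (binomial_coeffs M l) * rho ^+ l * mnorm (Y l))).
  by rewrite mulrAC ler_wpM2r ?exprn_ge0// mnormM.
by apply: ler_pM => //; [rewrite mulr_ge0 ?mnorm_ge0 ?exprn_ge0|exact: mnorm_ge0].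
Qed.

Lemma mid_rho t : 0 < t < 1 -> 0 < (1 + t) / 2 < 1 /\ t < (1 + t) / 2.
Proof. by move=> /andP[t0 t1]; split; [apply/andP; split|]; lra. Qed.

(** For A = 0 the kernel coefficients vanish by (l+1) b_(l+1) = (M + l) b_l, so the product is
    constant on ]0, 1[; its limit at 0 is I. *)
Lemma binomial_series M t : pos_spectrum M -> 0 < t < 1 ->
  mexp M (ln (1 - t)) * mps (binomial_coeffs M) t = 1.
Proof.
move=> hM t01; pose H u := mexp M (ln (1 - u)) * mps (binomial_coeffs M) u.
have k0 : kernel_coeffs 0 M (binomial_coeffs M) = fun=> 0.
  apply/funext => -[|l]; rewrite /kernel_coeffs ?addr0 ?mul0r ?subr0//.
  rewrite !add0r /binomial_coeffs pochhammerS natr_mx.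
  rewrite -!mxscaleAr -!mxscaleAl mul1r.
  have -> : mx_pochhammer M l * (M + l%:R) = (M + l%:R) * mx_pochhammer M l.
    apply/esym/comm_pochhammer; apply/commr_sym/commrD; first by [].
    exact: commr_nat.
  rewrite !scalerA -scalerBl -!rmorphM -rmorphB /=.
  rewrite (_ : _ - _ = 0) ?scale0r//.
  have fl0 : l`!%:R != 0 :> R by rewrite pnatr_eq0 -lt0n fact_gt0.
  by rewrite factS natrM; field; rewrite fl0 nat1r pnatr_eq0.
have dH u : 0 < u < 1 -> is_mxderive u H 0.
  move=> u01; have [rho01 ur] := mid_rho u01.
  have [K hK] := binomial_coeffs_bounded hM rho01.
  have c0 : GRing.comm (0 : MC) M by exact/commr_sym/commr0.
  have := is_mxderive_kernel c0 hK ur u01.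
  rewrite k0 (_ : mps _ u = 0).
    rewrite !mulr0 (_ : (fun v => _) = H)//; apply/funext => v.
    have e0 : mexp (0 : MC) (ln v) = 1.
      by have := mexp_cst (N := N) (0 : R) (ln v); rewrite scale0r mul0r expR0 scale1r.
    by rewrite e0 mul1r.
  apply: mps_lim; rewrite mpseries.unlock (_ : series _ = fun=> 0); first exact: cvg_cst.
  by apply/funext => n; rewrite /series /= big1// => l _; rewrite scaler0.
have Hc u : 0 < u < 1 -> H u = H t.
  by move=> u01; exact: (is_mxderive0_cst_oo dH u01 t01).
have H1 : H u @[u --> 0^'+] --> (1 : MC).
  have h2 : 0 < (2^-1 : R) < 1 by apply/andP; split; lra.
  have [K hK] := binomial_coeffs_bounded hM h2.
  have n0 : `|0 : R| < 2^-1 by rewrite normr0; case/andP: h2.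
  have c1 := is_mxderive_cvg (is_mxderive_mps hK n0).
  have [h20 _] := andP h2.
  rewrite (mps0 h20 hK) in c1.
  have e1 : binomial_coeffs M 0 = 1.
    by rewrite /binomial_coeffs /mx_pochhammer big_ord0 invr1 scale1r.
  rewrite e1 in c1.
  have l1 : 0 < 1 - 0 :> R by rewrite subr0.
  have c2 := is_mxderive_cvg (is_mxderive_comp (F := fun v => mexp M (ln v))
    (g := fun u => 1 - u) (is_derive_onem 0) (is_mxderive_mexp_ln M l1)).
  rewrite subr0 ln1 mexp0 in c2.
  have := mxcvgM (cvg_at_right_filter c2) (cvg_at_right_filter c1).
  by rewrite mulr1; apply.
apply: (mxcvg_unique (F := 0^'+) (f := H)); last exact: H1.
apply: cvg_near_cst; near=> u; apply: Hc; apply/andP; split.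
  by near: u; exact: nbhs_right_gt.
by near: u; apply: nbhs_right_lt; exact: ltr01.
Unshelve. all: by end_near. Qed.

End BinomialSeries.

(** * Inverses, and quotients of Pochhammer symbols *)

Section InverseMatrices.
Context {R : realType} {N : nat}.
Local Notation MC := 'M[R[i]]_N.
Implicit Types (A B M X Y Z U V : MC).

Lemma mx_mulVK X : X \in unitmx -> invmx X * X = 1.
Proof. exact: mulVmx. Qed.

Lemma mx_mulKV X : X \in unitmx -> X * invmx X = 1.
Proof. exact: mulmxV. Qed.

Lemma invmx_eq X Y : X * Y = 1 -> invmx X = Y.
Proof.
move=> XY; have [Xu _] := mulmx1_unit (XY : X *m Y = 1%:M).
by rewrite -[LHS]mulr1 -XY mulrA mx_mulVK// mul1r.
Qed.

Lemma invmx_mul X Y : X \in unitmx -> Y \in unitmx -> invmx (X * Y) = invmx Y * invmx X.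
Proof.
move=> Xu Yu; apply: invmx_eq.
by rewrite -mulrA (mulrA Y) mx_mulKV// mul1r mx_mulKV.
Qed.

Lemma comm_invmx X Y : GRing.comm X Y -> GRing.comm X (invmx Y).
Proof.
(* For singular Y the value [invmx Y] is Y itself. *)
move=> XY; have [Yu|Yu] := boolP (Y \in unitmx); last by rewrite /invmx (negbTE Yu).
rewrite /GRing.comm -[LHS]mul1r -{1}(mx_mulVK Yu) -mulrA (mulrA Y) -XY.
by rewrite -mulrA mx_mulKV// mulr1.
Qed.

Lemma unitmx_mulr X Y : X \in unitmx -> Y \in unitmx -> X * Y \in unitmx.
Proof. by move=> Xu Yu; rewrite -[X * Y]/(X *m Y) unitmx_mul Xu. Qed.

Lemma mexp_unit M (s : R) : mexp M s \in unitmx.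
Proof. by have [] := mulmx1_unit (mexpKN M s : _ *m _ = 1%:M). Qed.

Lemma pochhammer_unit M l : pos_spectrum M -> mx_pochhammer M l \in unitmx.
Proof.
move=> hM; elim: l => [|l IH]; first by rewrite /mx_pochhammer big_ord0; exact: unitmx1.
by rewrite pochhammerS unitmx_mulr// pos_spectrum_unit.
Qed.

Lemma gamma_ratio_unit M m : pos_spectrum M -> gamma_ratio M m \in unitmx.
Proof.
move=> hM; rewrite /gamma_ratio unitmxZ.
  apply: unitmx_mulr; first exact: mexp_unit.
  exact/mxGamma_unit/pos_spectrumDn.
by rewrite unitfE fmorph_eq0 invr_eq0 pnatr_eq0 -lt0n fact_gt0.
Qed.

(** For a positive spectrum this equals (M)_(m+1) (m+1)^-M / m!, Gauss's approximation to
    Gamma(M)^-1; [gamma_approx] is its exact inverse. *)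
Definition inv_gamma_approx M m : MC := gamma_ratio M m * invmx (mxGamma M).
Definition gamma_approx M m : MC := mxGamma M * invmx (gamma_ratio M m).

Lemma inv_gamma_approxK M m : pos_spectrum M ->
  inv_gamma_approx M m * gamma_approx M m = 1.
Proof.
move=> hM; rewrite /inv_gamma_approx /gamma_approx -mulrA (mulrA (invmx (mxGamma M))).
by rewrite mx_mulVK ?mxGamma_unit// mul1r mx_mulKV// gamma_ratio_unit.
Qed.

Lemma cvg_inv_gamma_approx M : pos_spectrum M ->
  inv_gamma_approx M m @[m --> \oo] --> invmx (mxGamma M).
Proof.
move=> hM; have h := mxcvgMr (invmx (mxGamma M)) (cvg_gamma_ratio hM).
by rewrite mul1r in h; exact: h.
Qed.

Lemma cvg_gamma_approx M : pos_spectrum M ->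
  gamma_approx M m @[m --> \oo] --> mxGamma M.
Proof.
move=> hM; have h := mxcvgMl (mxGamma M) (cvg_invmx1 (cvg_gamma_ratio hM)).
by rewrite mulr1 in h; exact: h.
Qed.

Lemma comm_gamma_ratio X M m : pos_spectrum M -> GRing.comm X M ->
  GRing.comm X (gamma_ratio M m).
Proof.
move=> hM XM; rewrite /gamma_ratio /GRing.comm -mxscaleAr -mxscaleAl; congr (_ *: _).
apply: commrM; first exact: mexp_comm.
by apply: mxGamma_comm; [exact: pos_spectrumDn|apply: commrD => //; exact: commr_nat].
Qed.

Lemma comm_inv_gamma_approx X M m : pos_spectrum M -> GRing.comm X M ->
  GRing.comm X (inv_gamma_approx M m).
Proof.
move=> hM XM; apply: commrM; first exact: comm_gamma_ratio.
exact/comm_invmx/mxGamma_comm.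
Qed.

Lemma comm_gamma_approx X M m : pos_spectrum M -> GRing.comm X M ->
  GRing.comm X (gamma_approx M m).
Proof.
move=> hM XM; apply: commrM; first exact: mxGamma_comm.
exact/comm_invmx/comm_gamma_ratio.
Qed.

Lemma invmx_pochhammer M m : pos_spectrum M -> invmx (mx_pochhammer M m.+1) =
  (m`!%:R^-1)%:C *: (gamma_approx M m * mexp M (- ln m.+1%:R)).
Proof.
move=> hM; apply: invmx_eq; rewrite pochhammer_gamma_ratio// -mxscaleAl -mxscaleAr.
rewrite scalerA -rmorphM /= mulfV ?scale1r; last by rewrite pnatr_eq0 -lt0n fact_gt0.
rewrite -/(inv_gamma_approx M m) -mulrA (mulrA (inv_gamma_approx M m)).
by rewrite inv_gamma_approxK// mul1r mexpKN.
Qed.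

Lemma scale2M (a b : R) X Y Z : a * b = 1 ->
  (a%:C *: X) * (Y * (b%:C *: Z)) = X * (Y * Z).
Proof.
move=> ab; rewrite -(mxscaleAr b%:C Y) -(mxscaleAr b%:C) -mxscaleAl scalerA.
by rewrite -rmorphM mulrC ab scale1r.
Qed.

Lemma scale3M (a b : R) X Y Z U V : a * b = 1 ->
  (a%:C *: X) * (Y * (Z * ((b%:C *: U) * V))) = X * (Y * (Z * (U * V))).
Proof. by move=> ab; rewrite -(mxscaleAl b%:C U) -(mxscaleAr b%:C Z) scale2M. Qed.

(** Accounts for the extra factor A + l in the denominator of [pochhammer_quotient], rescaled so as
    to converge to I. *)
Definition shifted_inverse A (m : nat) : MC := (m.+1%:R)%:C *: invmx (A + m.+1%:R).

Lemma cvg_shifted_inverse A : pos_spectrum A -> shifted_inverse A m @[m --> \oo] --> (1 : MC).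
Proof.
move=> hA; pose f (m : nat) : MC := (m.+1%:R^-1)%:C *: (A + m.+1%:R).
have f1 : f @ \oo --> (1 : MC).
  have h := mxcvgD (mxcvgZ (cvg_harmonic (R := R)) (mxcvg_cst A)) (mxcvg_cst (1 : MC)).
  rewrite scale0r add0r in h; apply: eq_cvg_to (h _ _ _ _) => m.
  by rewrite /f scalerDr natr_mx scalerA -rmorphM /= mulVf ?scale1r ?pnatr_eq0.
apply: eq_cvg_to (cvg_invmx1 f1) => m; apply: invmx_eq.
rewrite /f /shifted_inverse -mxscaleAl -mxscaleAr scalerA -rmorphM /=.
by rewrite mulVf ?pnatr_eq0// scale1r mx_mulKV// pos_spectrum_unit.
Qed.

Definition quotient_factor A B M m : MC :=
  gamma_approx M m * (inv_gamma_approx B m * (shifted_inverse A m * gamma_approx A m)).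

Lemma cvg_quotient_factor A B M : pos_spectrum A -> pos_spectrum B -> pos_spectrum M ->
  quotient_factor A B M m @[m --> \oo] -->
  mxGamma M * (invmx (mxGamma B) * (1 * mxGamma A)).
Proof.
move=> hA hB hM; apply: mxcvgM (cvg_gamma_approx hM) _.
apply: mxcvgM (cvg_inv_gamma_approx hB) _.
exact: mxcvgM (cvg_shifted_inverse hA) (cvg_gamma_approx hA).
Qed.

(** The E_l of the overview: the two inverses together make up that of (A)_(l+1). *)
Definition pochhammer_quotient A B (l : nat) : MC :=
  mx_pochhammer B l * (invmx (A + l%:R) * invmx (mx_pochhammer A l)).

(** With w = m + 1, the powers w^B and w^-A combine into w^M. Inserting [inv_gamma_approx M m] and
    its inverse completes the binomial coefficient, whose 1 / w is offset by [shifted_inverse]. *)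
Lemma pochhammer_quotientE A B m : GRing.comm A B ->
  pos_spectrum A -> pos_spectrum B -> pos_spectrum (B - A) ->
  pochhammer_quotient A B m.+1 =
  binomial_coeffs (B - A) m.+1 * quotient_factor A B (B - A) m.
Proof.
move=> AB hA hB; set M := B - A => hM; have w0 : 0 < m.+1%:R :> R by rewrite ltr0n.
have f0 : m`!%:R != 0 :> R by rewrite pnatr_eq0 -lt0n fact_gt0.
pose s : R := ln m.+1%:R.
have AM : GRing.comm A M by apply: commrB.
have eB : mexp B s = mexp M s * mexp A s.
  by rewrite -mexpMD ?subrK//; exact/commr_sym.
have cA X : GRing.comm X A -> GRing.comm X (mexp A (- s)) by exact: mexp_comm.
rewrite /pochhammer_quotient (pochhammer_gamma_ratio m hB) (invmx_pochhammer m hA).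
rewrite -/s -/(inv_gamma_approx B m) eB.
have -> : binomial_coeffs M m.+1 =
    (m.+1%:R^-1)%:C *: (mexp M s * inv_gamma_approx M m).
  rewrite /binomial_coeffs pochhammer_gamma_ratio// scalerA -rmorphM /=.
  by congr (_%:C *: _); rewrite factS natrM invfM mulfVK.
rewrite /quotient_factor /shifted_inverse.
have e1 : invmx (A + m.+1%:R) * (gamma_approx A m * mexp A (- s)) =
    mexp A (- s) * (invmx (A + m.+1%:R) * gamma_approx A m).
  rewrite mulrA; apply/commr_sym/commrM.
    apply/comm_invmx/commrD; first exact/commr_sym/cA.
    exact: commr_nat.
  by apply: comm_gamma_approx => //; exact/commr_sym/cA.
have e2 : mexp A s * inv_gamma_approx B m * (mexp A (- s) *
    (invmx (A + m.+1%:R) * gamma_approx A m)) =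
    inv_gamma_approx B m * (invmx (A + m.+1%:R) * gamma_approx A m).
  have c : GRing.comm (mexp A s) (inv_gamma_approx B m).
    by apply: comm_inv_gamma_approx => //; exact/commr_sym/mexp_comm/commr_sym.
  by rewrite c -mulrA (mulrA (mexp A s)) mexpKN mul1r.
move: e1 e2 (inv_gamma_approxK m hM).
move: (mexp M s) (mexp A s) (mexp A (- s)) (inv_gamma_approx M m) (gamma_approx M m)
  (inv_gamma_approx B m) (gamma_approx A m) (invmx (A + m.+1%:R)) => eM eA eA' gM gM' gB gA iA.
move=> e1 e2 e3; have w1 : m.+1%:R^-1 * m.+1%:R = 1 :> R by rewrite mulVf// pnatr_eq0.
rewrite (scale2M _ iA (gA * eA') (mulfV f0)) (scale3M (eM * gM) gM' gB iA gA w1) e1.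
by rewrite -(mulrA eM eA) -(mulrA eM (eA * gB)) e2 -(mulrA eM gM) (mulrA gM gM') e3 mul1r.
Qed.

End InverseMatrices.

(** * The Euler integral *)

Section AbelianTheorem.
Context {R : realType} {N : nat}.
Local Notation MC := 'M[R[i]]_N.
Implicit Types (A B M X Y Z L : MC) (t d : R).

(** The weights (1 - d)^M b_l d^l, with b_l the binomial coefficients, sum to I, their norms have
    bounded sums, and each tends to 0 as d tends to 1: the conditions of Toeplitz's theorem on
    weighted means. *)
Lemma toeplitz M (Y : nat -> MC) L : pos_spectrum M -> Y @ \oo --> L ->
  mexp M (ln (1 - d)) * mps (fun l => binomial_coeffs M l * Y l) d @[d --> 1^'-] --> L.
Proof.
move=> hM YL; pose Z l := Y l - L.
have Z0 : Z @ \oo --> (0 : MC).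
  by have h := cvgB YL (mxcvg_cst L); rewrite subrr in h; exact: h.
have [KY KY0 hKY] := mxcvg_bounded YL; have [KZ KZ0 hKZ] := mxcvg_bounded Z0.
have [K K0 hK] := binomial_sum_bound hM.
pose E d := mexp M (ln (1 - d)).
have cvgW (W : nat -> MC) KW d : 0 < d < 1 -> (forall l, mnorm (W l) <= KW) ->
    mpseries (fun l => binomial_coeffs M l * W l) d n @[n --> \oo] -->
    mps (fun l => binomial_coeffs M l * W l) d.
  move=> d01 hW; have [rho01 dr] := mid_rho d01.
  have [K1 hK1] := mul_binomial_coeffs_bounded hM rho01 hW.
  by apply: (mps_cvg hK1); rewrite ger0_norm//; case/andP: d01 => /ltW.
have decomp d : 0 < d < 1 ->
    E d * mps (fun l => binomial_coeffs M l * Y l) d - L =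
    E d * mps (fun l => binomial_coeffs M l * Z l) d.
  move=> d01; have [rho01 dr] := mid_rho d01.
  have [K1 hK1] := binomial_coeffs_bounded hM rho01.
  have cb : mpseries (binomial_coeffs M) d n @[n --> \oo] --> mps (binomial_coeffs M) d.
    by apply: (mps_cvg hK1); rewrite ger0_norm//; case/andP: d01 => /ltW.
  have -> : mps (fun l => binomial_coeffs M l * Y l) d =
      mps (fun l => binomial_coeffs M l * Z l) d + mps (binomial_coeffs M) d * L.
    apply: mps_lim; apply: eq_cvg_to (mxcvgD (cvgW Z KZ d d01 hKZ) (mxcvgMr L cb)) => n.
    rewrite -(mpseries_scaler L) mpseries.unlock /series /= -big_split /=.
    by apply: eq_bigr => l _; rewrite -scalerDr -mulrDr subrK.
  by rewrite mulrDr mulrA (binomial_series hM d01) mul1r addrK.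
apply/cvg_mnormP/cvgrPdist_lt => e e0.
(* The tail beyond n0 costs at most eps K <= e / 2. *)
pose eps := e / (2 * (K + 1)).
have K1 : 0 < K + 1 by rewrite ltr_wpDl.
have eps0 : 0 < eps by rewrite divr_gt0// mulr_gt0.
have [n0 _ hn0] : \forall l \near \oo, mnorm (Z l) < eps.
  by have /cvg_mnormP/cvgr_lt/(_ _ eps0) := Z0; apply: filterS => l; rewrite subr0.
(* Bounds the terms below n0 without the factor (1 - d)^M, which tends to 0 and makes them
   negligible. *)
pose cL := KZ * \sum_(0 <= l < n0) mnorm (binomial_coeffs M l).
have cL0 : 0 <= cL by rewrite mulr_ge0// sumr_ge0// => *; exact: mnorm_ge0.
have cL1 : 0 < cL + 1 by rewrite ltr_wpDl.
have eE : 0 < e / 2 / (cL + 1) by rewrite !divr_gt0.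
near=> d; rewrite sub0r normrN ger0_norm ?mnorm_ge0//.
have d01 : 0 < d < 1.
  apply/andP; split; near: d; [exact: nbhs_left_gt|exact: nbhs_left_lt].
have Ed : mnorm (E d) < e / 2 / (cL + 1).
  near: d; have /cvg_mnormP/cvgr_lt/(_ _ eE) := cvg_ln1B hM.
  by apply: filterS => d; rewrite subr0.
have [d0 d1] := andP d01.
have dl l : d ^+ l <= 1 by rewrite exprn_ile1// ltW.
have dl0 l : 0 <= d ^+ l by rewrite exprn_ge0// ltW.
rewrite -/(E d) (decomp d d01).
apply: (@le_lt_trans _ _ (mnorm (E d) * cL + eps * K)); last first.
  apply: (@le_lt_trans _ _ (mnorm (E d) * (cL + 1) + eps * K)).
    by rewrite lerD2r ler_wpM2l ?mnorm_ge0// lerDl.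
  have -> : e = e / 2 + e / 2 by rewrite -splitr.
  apply: ltr_leD; first by rewrite -ltr_pdivlMr.
  rewrite /eps invfM !mulrA -mulrA ler_piMr ?divr_ge0 ?(ltW e0)// mulrC ler_pdivrMr// mul1r.
  by rewrite lerDl.
have h := mxcvgMl (E d) (cvgW Z KZ d d01 hKZ).
apply: (mxcvg_le_mnorm _ (h _)); near=> n.
have nn0 : (n0 <= n)%N by near: n; exact: nbhs_infty_ge.
rewrite mpseries.unlock /series /= (big_cat_nat (leq0n n0) nn0)//= mulrDr.
apply: le_trans (mnormD _ _) _; apply: lerD.
  apply: le_trans (mnormM _ _) _; rewrite ler_wpM2l ?mnorm_ge0//.
  apply: le_trans (mnorm_sum _ _ _) _; rewrite /cL mulr_sumr; apply: ler_sum => l _.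
  rewrite mnormZ ger0_norm//; apply: (@le_trans _ _ (1 * (mnorm (binomial_coeffs M l) * KZ))).
    apply: ler_pM => //; first exact: mnorm_ge0.
    by apply: le_trans (mnormM _ _) _; rewrite ler_wpM2l ?mnorm_ge0.
  by rewrite mul1r mulrC.
apply: (@le_trans _ _ (\sum_(n0 <= l < n) eps * (mnorm (E d * binomial_coeffs M l) * d ^+ l))).
  rewrite mulr_sumr; apply: le_trans (mnorm_sum _ _ _) _.
  apply: ler_sum_nat => l /andP[nl _].
  rewrite -mxscaleAr mulrA mnormZ ger0_norm//.
  have -> (x : R) : eps * (x * d ^+ l) = d ^+ l * (x * eps) by ring.
  rewrite ler_wpM2l//.
  apply: le_trans (mnormM _ _) _; rewrite ler_wpM2l ?mnorm_ge0//.
  by apply/ltW/hn0.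
rewrite -mulr_sumr ler_wpM2l ?(ltW eps0)//; apply: le_trans (hK d n d01).
rewrite -(big_mkord xpredT (fun l => mnorm (E d * binomial_coeffs M l) * d ^+ l)).
rewrite [leRHS](big_cat_nat (leq0n n0) nn0)//= lerDr sumr_ge0// => l _.
by rewrite mulr_ge0// mnorm_ge0.
Unshelve. all: by end_near. Qed.

End AbelianTheorem.

(** * Evaluation of the improper integral through its antiderivative *)

Section EulerIntegral.
Context {R : realType} {N : nat}.
Local Notation mu := (@lebesgue_measure R).
Local Notation MC := 'M[R[i]]_N.
Implicit Types (A B M X Y Z L : MC) (t d : R) (c : nat -> MC).

Lemma mx_Rintegral_FTC (F dF H : R -> MC) (a b : R) : a <= b ->
  (forall u, a <= u <= b -> is_mxderive u H (F u)) ->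
  (forall u, a <= u <= b -> is_mxderive u F (dF u)) ->
  mx_Rintegral `[a, b] F = H b - H a.
Proof.
move=> ab dH hF; apply: co_inj => k; rewrite coB.
have -> : co k (mx_Rintegral `[a, b] F) = \int[mu]_(u in `[a, b]) co k (F u).
  by case: k => [[[] i] j]; rewrite /co mxE.
exact: (Rintegral_FTC (F := fun u => co k (H u)) ab (fun u hu => dH u hu k)
  (fun u hu => is_derive_continuous (hF u hu k))).
Qed.

Lemma mx_improper_FTC (F dF H : R -> MC) (L : MC) :
  (forall u, 0 < u < 1 -> is_mxderive u H (F u)) ->
  (forall u, 0 < u < 1 -> is_mxderive u F (dF u)) ->
  H u @[u --> 0^'+] --> (0 : MC) -> H u @[u --> 1^'-] --> L ->
  mx_improper_fmap 0 1 F --> L.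
Proof.
move=> dH hF H0 H1.
have h1 : (fun cd : R * R => H cd.2 - H cd.1) @ filter_prod 0^'+ 1^'- --> L.
  rewrite -[L]subr0; apply: cvgB.
  - exact: (cvg_comp _ _ (@cvg_snd _ _ _ _ _) H1).
  - exact: (cvg_comp _ _ (@cvg_fst _ _ _ _ _) H0).
apply: cvg_trans h1; apply: near_eq_cvg.
(* The point 1/2 separates the two neighbourhoods and so guarantees c <= d. *)
exists ([set c : R | 0 < c < 2^-1], [set d : R | 2^-1 < d < 1]) => /=.
  split; near=> u => /=; apply/andP; split; near: u.
  - exact: nbhs_right_gt.
  - by apply: nbhs_right_lt; rewrite invr_gt0.
  - by apply: nbhs_left_gt; rewrite invf_lt1// ltr1n.
  - exact: nbhs_left_lt.
move=> [c d] /= [/andP[c0 c2] /andP[d2 d1]].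
apply/esym/(mx_Rintegral_FTC (dF := dF)); first by lra.
  by move=> u /andP[cu ud]; apply: dH; apply/andP; split; lra.
by move=> u /andP[cu ud]; apply: hF; apply/andP; split; lra.
Unshelve. all: by end_near. Qed.

(** Turns plain convergence at t into the boundedness that encodes a radius: the terms are
    differences of consecutive partial sums, hence converge. *)
Lemma cvgn_mpseries_bounded c t : 0 <= t -> cvgn (mpseries c t) ->
  exists K, forall l, mnorm (c l) * t ^+ l <= K.
Proof.
move=> t0 h; have h0 := cvgB (cvg_to_succ h) h; rewrite subrr in h0.
have [K _ hK] := mxcvg_bounded (h0 _); exists K => l; apply: le_trans (hK l).
rewrite fctE mpseries.unlock /series /= big_nat_recr//= addrAC subrr add0r.
by rewrite mnormZ ger0_norm ?exprn_ge0// mulrC.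
Qed.

(** With G_l = (B)_l (A)_l^-1, this identity and the next read (A + l) E_l = G_l and (B + l) E_l =
    G_(l+1). They dictate the choice of E_l, as they make the kernel coefficients of E_l S_l
    telescope. *)
Lemma pochhammer_quotientl A B l : GRing.comm A B -> pos_spectrum A ->
  (A + l%:R) * pochhammer_quotient A B l =
  mx_pochhammer B l * invmx (mx_pochhammer A l).
Proof.
move=> AB hA; rewrite /pochhammer_quotient mulrA.
have -> : (A + l%:R) * mx_pochhammer B l = mx_pochhammer B l * (A + l%:R).
  apply: comm_pochhammer; apply/commr_sym/commrD; first exact/commr_sym.
  exact: commr_nat.
rewrite -mulrA (mulrA (A + l%:R)) mx_mulKV ?mul1r//; exact: pos_spectrum_unit.
Qed.

Lemma pochhammer_quotientr A B l : pos_spectrum A ->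
  (B + l%:R) * pochhammer_quotient A B l =
  mx_pochhammer B l.+1 * invmx (mx_pochhammer A l.+1).
Proof.
move=> hA; rewrite /pochhammer_quotient mulrA.
have -> : (B + l%:R) * mx_pochhammer B l = mx_pochhammer B l * (B + l%:R).
  apply: comm_pochhammer; apply/commr_sym/commrD => //; exact: commr_nat.
rewrite -pochhammerS (pochhammerS A) invmx_mul//; first exact: pochhammer_unit.
exact: pos_spectrum_unit.
Qed.

Lemma mulr_cancel4 (X Y Z X' Y' Z' L : MC) : Z' * Z = 1 -> Y' * X' = X' * Y' ->
  Y' * Y = 1 -> X * X' = 1 -> L = X * Y' * Z' * (Z * (X' * Y) * L).
Proof.
move=> ZZ YX YY XX.
rewrite -(mulrA Z) (mulrA _ Z) -(mulrA _ Z' Z) ZZ mulr1 (mulrA _ (X' * Y)).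
by rewrite (mulrA _ X') -(mulrA X) YX (mulrA X) XX mul1r YY mul1r.
Qed.

(** The coefficients c are arbitrary, so that the incomplete gamma weights never enter the
    analysis. *)
Lemma beta_integral_series A B c (F : R -> MC) :
  let M := B - A in
  let a := fun l => mx_pochhammer A l * (invmx (mx_pochhammer B l) * c l) in
  GRing.comm A B -> pos_spectrum A -> pos_spectrum B -> pos_spectrum M ->
  (forall t, 0 < t < 1 -> cvgn (mpseries c t)) -> cvgn (series a) ->
  (forall t, F t = mexp (A - 1) (ln t) * (mexp (M - 1) (ln (1 - t)) * mps c t)) ->
  mx_improper_cvg 0 1 F /\
  limn (series a) = mxGamma B * invmx (mxGamma A) * invmx (mxGamma M) *
     mx_improper_integral 0 1 F.
Proof.
move=> M a AB hA hB hM hc ha FE; set S := limn (series a).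
have AM : GRing.comm A M by apply: commrB.
(* [series a n] stops before n, so [l.+1] makes the partial sum include the term of index l. *)
pose Sn l := series a l.+1.
have cS : Sn @ \oo --> S by exact: (cvg_to_succ ha).
pose C l := pochhammer_quotient A B l * Sn l.
(* The factorization of the quotient starts at l = 1; the value at 0 merely has to reproduce
   [C 0]. *)
pose Y l := if l is m.+1 then quotient_factor A B M m * Sn l else C 0%N.
have CY : C = fun l => binomial_coeffs M l * Y l.
  apply/funext => -[|m]; rewrite /C /=.
    by rewrite /binomial_coeffs /mx_pochhammer big_ord0 invr1 scale1r mul1r.
  by rewrite pochhammer_quotientE// mulrA.
pose T : MC := mxGamma M * (invmx (mxGamma B) * (1 * mxGamma A)).
have cY : Y @ \oo --> T * S.
  have hq := mxcvgM (cvg_quotient_factor hA hB hM) (cvg_to_succ cS).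
  by apply: cvg_of_succ; apply: (eq_cvg_to _ (hq _)) => m.
have [KY _ hKY] := mxcvg_bounded cY.
have Cbound rho : 0 < rho < 1 -> exists K, forall l, mnorm (C l) * rho ^+ l <= K.
  by move=> rho01; rewrite CY; exact: (mul_binomial_coeffs_bounded hM rho01 hKY).
have Ga l : mx_pochhammer B l * invmx (mx_pochhammer A l) * a l = c l.
  rewrite /a -mulrA (mulrA (invmx (mx_pochhammer A l))) mx_mulVK ?pochhammer_unit// mul1r mulrA.
  by rewrite mx_mulKV ?pochhammer_unit// mul1r.
(* Summation by parts: both products carry the left factor (B)_l (A)_l^-1, leaving S_l - S_(l-1) =
   a_l, and this factor times a_l is c_l. *)
have kC : kernel_coeffs A M C = c.
  have q1 l : (A + l%:R) * C l = mx_pochhammer B l * invmx (mx_pochhammer A l) * Sn l.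
    by rewrite [LHS](mulrA _ (pochhammer_quotient A B l)) pochhammer_quotientl.
  have q2 l : (A + M + l%:R) * C l =
      mx_pochhammer B l.+1 * invmx (mx_pochhammer A l.+1) * Sn l.
    have -> : A + M = B by rewrite addrC subrK.
    by rewrite [LHS](mulrA _ (pochhammer_quotient A B l)) pochhammer_quotientr.
  apply/funext => -[|l]; rewrite /kernel_coeffs q1.
    by rewrite subr0 /Sn /series /= big_nat1 Ga.
  rewrite q2 -mulrBr -[RHS]Ga; congr (_ * _).
  by rewrite /Sn /series /= (big_nat_recr l.+1)//= addrAC subrr add0r.
pose H u := mexp A (ln u) * (mexp M (ln (1 - u)) * mps C u).
have dH u : 0 < u < 1 -> is_mxderive u H (F u).
  move=> u01; have [rho01 ur] := mid_rho u01; have [K hK] := Cbound _ rho01.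
  by rewrite FE -kC; exact: (is_mxderive_kernel AM hK ur u01).
(* Convergence at the larger radius (1 + u) / 2 makes F differentiable at u, hence continuous as the
   fundamental theorem requires. *)
have [dF hF] : exists dF : R -> MC, forall u, 0 < u < 1 -> is_mxderive u F (dF u).
  have -> : F = fun t => mexp (A - 1) (ln t) * (mexp (M - 1) (ln (1 - t)) * mps c t).
    exact/funext.
  eexists => u u01; have [rho01 ur] := mid_rho u01; have [u0 u1] := andP u01.
  have [rho0 _] := andP rho01.
  have [K hK] := cvgn_mpseries_bounded (ltW rho0) (hc _ rho01).
  have ur' : `|u| < (1 + u) / 2 by rewrite ger0_norm// ltW.
  have s0 : 0 < 1 - u by rewrite subr_gt0.
  exact: (is_mxderiveM (is_mxderive_mexp_ln (A - 1) u0) (is_mxderiveM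
    (is_mxderive_comp (F := fun v => mexp (M - 1) (ln v)) (g := fun u => 1 - u)
    (is_derive_onem u) (is_mxderive_mexp_ln (M - 1) s0)) (is_mxderive_mps hK ur'))).
have H0 : H u @[u --> 0^'+] --> (0 : MC).
  have h2 : 0 < (2^-1 : R) < 1 by apply/andP; split; lra.
  have [K hK] := Cbound _ h2.
  have n0 : `|0 : R| < 2^-1 by rewrite normr0; case/andP: h2.
  have c1 := is_mxderive_cvg (is_mxderive_mps hK n0).
  have l1 : 0 < 1 - 0 :> R by rewrite subr0.
  have c2 := is_mxderive_cvg (is_mxderive_comp (F := fun v => mexp M (ln v))
    (g := fun u => 1 - u) (is_derive_onem 0) (is_mxderive_mexp_ln M l1)).
  have := mxcvgM (cvg_mexp_ln0 hA) (mxcvgM (cvg_at_right_filter c2) (cvg_at_right_filter c1)).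
  by rewrite mul0r; apply.
have H1 : H u @[u --> 1^'-] --> T * S.
  have c1 := is_mxderive_cvg (is_mxderive_mexp_ln A (ltr01 : 0 < (1 : R))).
  rewrite ln1 mexp0 in c1.
  have := mxcvgM (cvg_at_left_filter c1) (toeplitz hM cY).
  by rewrite mul1r -CY; apply.
have lim := mx_improper_FTC dH hF H0 H1.
split; first by apply/cvg_ex; exists (T * S).
rewrite /mx_improper_integral (mx_cvg_lim lim) /T mul1r.
have uA := mxGamma_unit hA; have uB := mxGamma_unit hB; have uM := mxGamma_unit hM.
have cAB : GRing.comm (mxGamma B) (mxGamma A).
  by apply: mxGamma_comm => //; apply/commr_sym/mxGamma_comm.
have cAB' : GRing.comm (invmx (mxGamma A)) (invmx (mxGamma B)).
  exact/comm_invmx/commr_sym/comm_invmx.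
exact: (mulr_cancel4 S (mx_mulVK uM) cAB' (mx_mulVK uA) (mx_mulKV uB)).
Qed.

End EulerIntegral.

(** * Hypergeometric terms and the two identities *)

Section HypergeometricTerms.
Context {R : realType} {N : nat}.
Local Notation MC := 'M[R[i]]_N.
Implicit Types (t : R) (z : R[i]).

Lemma prod_pochhammer_unit s (B : 'I_s -> MC) l : (forall j, pos_spectrum (B j)) ->
  \prod_(j < s) mx_pochhammer (B j) l \in unitmx.
Proof.
move=> hB; elim/big_ind: _ => [|X Y|j _]; first exact: unitmx1.
  exact: unitmx_mulr.
exact: pochhammer_unit.
Qed.

Lemma comm_prod_pochhammer (X : MC) s (B : 'I_s -> MC) l :
  (forall j, GRing.comm X (B j)) ->
  GRing.comm X (\prod_(j < s) mx_pochhammer (B j) l).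
Proof.
move=> XB; elim/big_ind: _ => [|Y Z|j _]; first exact: commr1.
  exact: commrM.
exact: comm_pochhammer.
Qed.

Lemma hyp_termZ r s (A : 'I_r -> MC) (B : 'I_s -> MC) z t l :
  hyp_term A B (z * t%:C) l = (t ^+ l)%:C *: hyp_term A B z l.
Proof.
rewrite /hyp_term scalerA rmorphXn /=; congr (_ *: _).
by rewrite exprMn mulrA [z ^+ l * _]mulrC.
Qed.

Lemma hyp_term_recl r s (A : 'I_r.+1 -> MC) (B : 'I_s.+1 -> MC) z l :
  (forall i, GRing.comm (B ord0) (A i)) -> (forall j, GRing.comm (B ord0) (B j)) ->
  (forall j, pos_spectrum (B j)) ->
  hyp_term A B z l = mx_pochhammer (A ord0) l * (invmx (mx_pochhammer (B ord0) l) *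
    hyp_term (fam_behead A) (fam_behead B) z l).
Proof.
move=> BA BB hB; rewrite /hyp_term -!mxscaleAr; congr (_ *: _).
rewrite !big_ord_recl -!mulrA; congr (_ * _).
set X := \prod_(i < r) _; set Y := \prod_(i < s) _; set b := mx_pochhammer (B ord0) l.
have Yu : Y \in unitmx by exact: (prod_pochhammer_unit (B := fun j => B (lift ord0 j))).
rewrite (invmx_mul (pochhammer_unit l (hB ord0)) Yu) !mulrA -/b.
have c (s' : nat) (D : 'I_s' -> MC) : (forall j, GRing.comm (B ord0) (D j)) ->
    GRing.comm (invmx b) (\prod_(j < s') mx_pochhammer (D j) l).
  move=> BD; apply/commr_sym/comm_invmx/comm_pochhammer/commr_sym.
  exact: comm_prod_pochhammer.
have cX : GRing.comm (invmx b) X by exact: (c r (fun i => A (lift ord0 i))).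
have cY : GRing.comm (invmx b) (invmx Y).
  by apply: comm_invmx; exact: (c s (fun j => B (lift ord0 j))).
by rewrite -mulrA -cY mulrA -cX.
Qed.

(** W stands for the incomplete gamma factor of each term, so that both identities are instances of
    this one. *)
Lemma hyp_euler_integral r s (A : 'I_r.+1 -> MC) (B : 'I_s.+1 -> MC) z (W : nat -> MC)
    (u : nat -> MC) (v : R -> nat -> MC) (F : R -> MC) :
  (forall l, u l = hyp_term A B z l * W l) ->
  (forall t l, v t l =
     hyp_term (fam_behead A) (fam_behead B) (z * t%:C) l * W l) ->
  (forall t, F t = mxpow t (A ord0 - 1) * mxpow (1 - t) (B ord0 - A ord0 - 1) *
                   limn (series (v t))) ->
  (forall i, GRing.comm (B ord0) (A i)) -> (forall j, GRing.comm (B ord0) (B j)) ->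
  (forall i, pos_spectrum (A i)) -> (forall j, pos_spectrum (B j)) ->
  pos_spectrum (B ord0 - A ord0) ->
  cvgn (series u) -> (forall t : R, 0 < t < 1 -> cvgn (series (v t))) ->
  mx_improper_cvg 0 1 F /\
  limn (series u) = mxGamma (B ord0) * invmx (mxGamma (A ord0)) *
    invmx (mxGamma (B ord0 - A ord0)) * mx_improper_integral 0 1 F.
Proof.
move=> uE vE FE BA BB hA hB hBA cu cv.
pose c l := hyp_term (fam_behead A) (fam_behead B) z l * W l.
have vc t : series (v t) = mpseries c t.
  rewrite mpseries.unlock; congr series; apply/funext => l.
  by rewrite vE hyp_termZ -mxscaleAl.
have uc : u = (fun l => mx_pochhammer (A ord0) l *
    (invmx (mx_pochhammer (B ord0) l) * c l)).
  apply/funext => l; rewrite uE (hyp_term_recl z l BA BB hB) /c.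
  move: (mx_pochhammer _ l) (invmx _) (hyp_term _ _ _ _) (W l) => X1 X2 X3 X4.
  by rewrite -mulrA -mulrA.
have hc t : 0 < t < 1 -> cvgn (mpseries c t) by move=> /cv; rewrite vc.
have Fc t : F t = mexp (A ord0 - 1) (ln t) *
    (mexp (B ord0 - A ord0 - 1) (ln (1 - t)) * mps c t).
  rewrite FE vc !mxpowE mps.unlock.
  move: (mexp _ _) (mexp _ _) (limn _) => X1 X2 X3.
  by rewrite mulrA.
rewrite uc in cu *.
exact: (@beta_integral_series R N (A ord0) (B ord0) c F (commr_sym (BA ord0))
  (hA ord0) (hB ord0) hBA hc cu Fc).
Qed.

End HypergeometricTerms.

Theorem theorem3p6 (R : realType) (N r s : nat) (P Q : 'M[R[i]]_N)
    (A : 'I_r.+1 -> 'M[R[i]]_N) (B : 'I_s.+1 -> 'M[R[i]]_N)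
    (x : R) (z : R[i])
    (hcomm : all2rel comm_mxb [:: P, Q & codom A ++ codom B])
    (hP : pos_spectrum P) (hQ : pos_spectrum Q)
    (hA : forall i, pos_spectrum (A i)) (hB : forall j, pos_spectrum (B j))
    (hBA : pos_spectrum (B ord0 - A ord0)) (hx : 0 < x) :
  let A' := fam_behead A in
  let B' := fam_behead B in
  let K := mxGamma (B ord0) * invmx (mxGamma (A ord0)) *
           invmx (mxGamma (B ord0 - A ord0)) in
  let kernel := fun t : R =>
    mxpow t (A ord0 - 1) * mxpow (1 - t) (B ord0 - A ord0 - 1) in
  let fe := fun t : R => kernel t * lower_e x P Q A' B' (z * t%:C) in
  let fE := fun t : R => kernel t * upper_E x P Q A' B' (z * t%:C) in
  (cvgn (series (lower_e_term x P Q A B z)) ->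
   (forall t : R, 0 < t < 1 ->
      cvgn (series (lower_e_term x P Q A' B' (z * t%:C)))) ->
   mx_improper_cvg 0 1 fe /\
   lower_e x P Q A B z = K * mx_improper_integral 0 1 fe) /\
  (cvgn (series (upper_E_term x P Q A B z)) ->
   (forall t : R, 0 < t < 1 ->
      cvgn (series (upper_E_term x P Q A' B' (z * t%:C)))) ->
   mx_improper_cvg 0 1 fE /\
   upper_E x P Q A B z = K * mx_improper_integral 0 1 fE).
Proof.
move=> A' B' K kernel fe fE.
have comm X Y : X \in codom A ++ codom B -> Y \in codom A ++ codom B -> GRing.comm X Y.
  move=> hX hY; apply/eqP; move/allrelP : hcomm; apply; rewrite !inE.
    by rewrite hX !orbT.
  by rewrite hY !orbT.
have memA i : A i \in codom A ++ codom B by rewrite mem_cat codom_f.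
have memB j : B j \in codom A ++ codom B by rewrite mem_cat codom_f orbT.
have BA i : GRing.comm (B ord0) (A i) by exact: comm.
have BB j : GRing.comm (B ord0) (B j) by exact: comm.
(* The two families of functions differ only in these weights. *)
pose wl l := mx_lower_gamma (P *+ l + Q) x * invmx (mxGamma (P *+ l + Q)).
pose wu l := mx_upper_gamma (P *+ l + Q) x * invmx (mxGamma (P *+ l + Q)).
have el r' s' (D : 'I_r' -> 'M[R[i]]_N) (E : 'I_s' -> 'M[R[i]]_N) y l :
    lower_e_term x P Q D E y l = hyp_term D E y l * wl l.
  rewrite /lower_e_term /wl; move: (hyp_term _ _ _ _) (mx_lower_gamma _ _) (invmx _).
  by move=> X1 X2 X3; rewrite mulrA.
have eu r' s' (D : 'I_r' -> 'M[R[i]]_N) (E : 'I_s' -> 'M[R[i]]_N) y l :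
    upper_E_term x P Q D E y l = hyp_term D E y l * wu l.
  rewrite /upper_E_term /wu; move: (hyp_term _ _ _ _) (mx_upper_gamma _ _) (invmx _).
  by move=> X1 X2 X3; rewrite mulrA.
split=> cu cv.
- have FE t : fe t = mxpow t (A ord0 - 1) * mxpow (1 - t) (B ord0 - A ord0 - 1) *
      limn (series (lower_e_term x P Q A' B' (z * t%:C))) by [].
  exact: (@hyp_euler_integral R N r s A B z wl (lower_e_term x P Q A B z)
    (fun t => lower_e_term x P Q A' B' (z * t%:C)) fe (el _ _ A B z)
    (fun t => el _ _ A' B' (z * t%:C)) FE BA BB hA hB hBA cu cv).
- have FE t : fE t = mxpow t (A ord0 - 1) * mxpow (1 - t) (B ord0 - A ord0 - 1) *
      limn (series (upper_E_term x P Q A' B' (z * t%:C))) by [].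
  exact: (@hyp_euler_integral R N r s A B z wu (upper_E_term x P Q A B z)
    (fun t => upper_E_term x P Q A' B' (z * t%:C)) fE (eu _ _ A B z)
    (fun t => eu _ _ A' B' (z * t%:C)) FE BA BB hA hB hBA cu cv).
Qed.
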